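(* Let $\equiv$ be a good equivalence relation on theories. Let $T$ and $U$ be $\Sigma^1_1$-definable, $\Pi^1_1$-sound theories extending $\mathsf{ACA}_0$ such that $|T|_{\mathsf{WF}}=|U|_{\mathsf{WF}}$. Then $T\equiv U$.
   Context: $\mathcal{L}_2$ is the language of second-order arithmetic; a theory is a set of $\mathcal{L}_2$-sentences; $T+\varphi$ denotes $T\cup\{\varphi\}$ and $T+V$ denotes $T\cup V$. A theory is $\Sigma^1_1$-definable if the set of Gödel numbers of its axioms is definable in the standard model by a $\Sigma^1_1$ formula. A theory is $\Pi^1_1$-sound if every $\Pi^1_1$ sentence it proves is true (in the standard model). ''True'' always means true in the standard model. For a primitive recursive binary relation $\prec$ on $\mathbb{N}$, $\mathsf{WF}(\prec)$ is the sentence $\forall X\big(\exists x\in X\to\exists x\in X\,\forall y\in X\, \neg(y\prec x)\big)$. $|T|_{\mathsf{WF}}$ is the supremum of the order types of the primitive recursive presentations $\prec$ of well-orderings such that $T\vdash\mathsf{WF}(\prec)$. $T\equiv_{\Pi^1_1}U$ means $T$ and $U$ prove exactly the same $\Pi^1_1$ sentences. An equivalence relation $\equiv$ on theories is called good if for all $\Sigma^1_1$-definable, $\Pi^1_1$-sound theories $T,U$ extending $\mathsf{ACA}_0$: (1) if $T\equiv_{\Pi^1_1}U$ then $T\equiv U$; (2) if $V$ is any set of true $\Sigma^1_1$ sentences then $T\equiv T+V$. *)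

(* Defs.v *)
From Stdlib Require Import RelationClasses List.
From mathcomp Require Import all_boot.


Set Implicit Arguments.
Unset Strict Implicit.
Unset Printing Implicit Defensive.

Inductive prf : nat -> Type :=
| PZ : prf 0
| PS : prf 1
| PP : forall n, 'I_n -> prf n
| PC : forall k n, prf k -> ('I_k -> prf n) -> prf n
| PR : forall n, prf n -> prf n.+2 -> prf n.+1.

Definition vcons (a : nat) (v : nat -> nat) : nat -> nat :=
  fun j => if j is j'.+1 then v j' else a.

(* argument vectors are represented by nat -> nat (only the first n entries matter);
   for PR n g h:  r(0, x) = g(x),  r(m+1, x) = h(m, r(m,x), x)   (first argument = m) *)
Fixpoint peval n (f : prf n) (v : nat -> nat) {struct f} : nat :=
  match f with
  | PZ => 0
  | PS => (v 0).+1
  | PP _ i => v (nat_of_ord i)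
  | PC k _ g hs =>
      peval g (fun j => match (insub j : option 'I_k) with
                        | Some o => peval (hs o) v
                        | None => 0 end)
  | PR _ g h =>
      let fix r m := match m with
                     | 0 => peval g (fun j => v j.+1)
                     | m'.+1 => peval h (vcons m' (vcons (r m') (fun j => v j.+1)))
                     end in r (v 0)
  end.

(* The language L_2 (with a function symbol for each primitive          *)
(* recursive function).  Two sorts of de Bruijn variables: number       *)
(* variables (in terms) and set variables (in Mem).                     *)
Inductive term : Type :=
| TVar : nat -> term
| TApp : forall n, prf n -> ('I_n -> term) -> term.

Inductive formula : Type :=
| FBot : formula
| FEq : term -> term -> formula
| FMem : term -> nat -> formula
| FImp : formula -> formula -> formula
| FAll : formula -> formula
| FAll2 : formula -> formula.

Definition FNot (p : formula) := FImp p FBot.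
Definition FAnd (p q : formula) := FNot (FImp p (FNot q)).
Definition FOr (p q : formula) := FImp (FNot p) q.
Definition FIff (p q : formula) := FAnd (FImp p q) (FImp q p).
Definition FEx (p : formula) := FNot (FAll (FNot p)).
Definition FEx2 (p : formula) := FNot (FAll2 (FNot p)).

Definition targs n (l : seq term) : 'I_n -> term := fun i => nth (TVar 0) l i.

Fixpoint teval (rho : nat -> nat) (t : term) {struct t} : nat :=
  match t with
  | TVar i => rho i
  | TApp n f a => peval f (fun j => match (insub j : option 'I_n) with
                                   | Some o => teval rho (a o)
                                   | None => 0 end)
  end.

Definition scons (X : nat -> Prop) (eta : nat -> nat -> Prop) : nat -> nat -> Prop :=
  fun k => if k is k'.+1 then eta k' else X.

Fixpoint sat (rho : nat -> nat) (eta : nat -> nat -> Prop) (p : formula) : Prop :=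
  match p with
  | FBot => False
  | FEq t s => teval rho t = teval rho s
  | FMem t k => eta k (teval rho t)
  | FImp p q => sat rho eta p -> sat rho eta q
  | FAll p => forall n : nat, sat (vcons n rho) eta p
  | FAll2 p => forall X : nat -> Prop, sat rho (scons X eta) p
  end.

(* truth in the standard model (used for sentences; the environment is irrelevant) *)
Definition true_in_N (p : formula) : Prop := sat (fun _ => 0) (fun _ _ => False) p.

Fixpoint tnv (t : term) : nat :=
  match t with
  | TVar i => i.+1
  | TApp n _ a => foldr maxn 0 (map (fun i => tnv (a i)) (enum 'I_n))
  end.

(* 1 + largest free number variable (0 if none) *)
Fixpoint nv (p : formula) : nat :=
  match p with
  | FBot => 0
  | FEq t s => maxn (tnv t) (tnv s)
  | FMem t _ => tnv t
  | FImp p q => maxn (nv p) (nv q)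
  | FAll p => (nv p).-1
  | FAll2 p => nv p
  end.

(* 1 + largest free set variable (0 if none) *)
Fixpoint sv (p : formula) : nat :=
  match p with
  | FBot | FEq _ _ => 0
  | FMem _ k => k.+1
  | FImp p q => maxn (sv p) (sv q)
  | FAll p => sv p
  | FAll2 p => (sv p).-1
  end.

Definition sentence (p : formula) : Prop := nv p = 0 /\ sv p = 0.

Definition closure (p : formula) : formula := iter (sv p) FAll2 (iter (nv p) FAll p).

Fixpoint tsubst (s : nat -> term) (t : term) : term :=
  match t with
  | TVar i => s i
  | TApp n f a => TApp f (fun i => tsubst s (a i))
  end.

Definition tshift : term -> term := tsubst (fun k => TVar k.+1).

Definition up (s : nat -> term) : nat -> term :=
  fun i => if i is j.+1 then tshift (s j) else TVar 0.

Fixpoint fsubst (s : nat -> term) (p : formula) : formula :=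
  match p with
  | FBot => FBot
  | FEq t u => FEq (tsubst s t) (tsubst s u)
  | FMem t k => FMem (tsubst s t) k
  | FImp p q => FImp (fsubst s p) (fsubst s q)
  | FAll p => FAll (fsubst (up s) p)
  | FAll2 p => FAll2 (fsubst s p)
  end.

Definition sup (r : nat -> nat) : nat -> nat := fun i => if i is j.+1 then (r j).+1 else 0.

Fixpoint fssubst (r : nat -> nat) (p : formula) : formula :=
  match p with
  | FBot => FBot
  | FEq t u => FEq t u
  | FMem t k => FMem t (r k)
  | FImp p q => FImp (fssubst r p) (fssubst r q)
  | FAll p => FAll (fssubst r p)
  | FAll2 p => FAll2 (fssubst (sup r) p)
  end.

Definition shift (p : formula) : formula := fsubst (fun k => TVar k.+1) p.
Definition sshift (p : formula) : formula := fssubst S p.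

Definition inst (t : term) : nat -> term := fun i => if i is j.+1 then TVar j else t.
Definition sinst (k : nat) : nat -> nat := fun i => if i is j.+1 then j else k.

Definition theory := formula -> Prop.

Definition is_theory (T : theory) : Prop := forall p, T p -> sentence p.

Inductive Prv (T : theory) : formula -> Prop :=
| PrvAx : forall p, T p -> Prv T p
| PrvK : forall p q, Prv T (FImp p (FImp q p))
| PrvS : forall p q r,
    Prv T (FImp (FImp p (FImp q r)) (FImp (FImp p q) (FImp p r)))
| PrvDN : forall p, Prv T (FImp (FNot (FNot p)) p)
| PrvMP : forall p q, Prv T (FImp p q) -> Prv T p -> Prv T q
| PrvInst : forall p t, Prv T (FImp (FAll p) (fsubst (inst t) p))
| PrvInst2 : forall p k, Prv T (FImp (FAll2 p) (fssubst (sinst k) p))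
| PrvVac : forall p, Prv T (FImp p (FAll (shift p)))
| PrvVac2 : forall p, Prv T (FImp p (FAll2 (sshift p)))
| PrvDist : forall p q, Prv T (FImp (FAll (FImp p q)) (FImp (FAll p) (FAll q)))
| PrvDist2 : forall p q, Prv T (FImp (FAll2 (FImp p q)) (FImp (FAll2 p) (FAll2 q)))
| PrvGen : forall p, Prv T p -> Prv T (FAll p)
| PrvGen2 : forall p, Prv T p -> Prv T (FAll2 p)
| PrvRefl : forall t, Prv T (FEq t t)
| PrvLeib : forall p s t,
    Prv T (FImp (FEq s t) (FImp (fsubst (inst s) p) (fsubst (inst t) p))).

Fixpoint arithmetical (p : formula) : bool :=
  match p with
  | FBot | FEq _ _ | FMem _ _ => true
  | FImp p q => arithmetical p && arithmetical q
  | FAll p => arithmetical p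
  | FAll2 _ => false
  end.

Definition sigma11 (p : formula) : Prop :=
  exists k q, arithmetical q /\ p = iter k FEx2 q.

Definition pi11 (p : formula) : Prop :=
  exists k q, arithmetical q /\ p = iter k FAll2 q.

Definition tzero : term := TApp PZ (@targs 0 [::]).
Definition tsucc (t : term) : term := TApp PS (@targs 1 [:: t]).
Definition tvars n (off : nat) : 'I_n -> term := fun i => TVar (off + i).

Definition fun_axioms n (f : prf n) : seq formula :=
  match f with
  | PZ => [::]
  | PS => [:: FNot (FEq (tsucc (TVar 0)) tzero);
              FImp (FEq (tsucc (TVar 0)) (tsucc (TVar 1))) (FEq (TVar 0) (TVar 1))]
  | PP n i => [:: FEq (TApp (PP i) (@tvars n 0)) (TVar i)]
  | PC k n g hs =>
      [:: FEq (TApp (PC g hs) (@tvars n 0))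
              (TApp g (fun j => TApp (hs j) (@tvars n 0)))]
  | PR n g h =>
      [:: FEq (TApp (PR g h) (@targs n.+1 (tzero :: [seq TVar i | i <- iota 0 n])))
              (TApp g (@tvars n 0));
          FEq (TApp (PR g h) (@targs n.+1 (tsucc (TVar 0) :: [seq TVar i | i <- iota 1 n])))
              (TApp h (@targs n.+2 (TVar 0 ::
                                   TApp (PR g h) (@tvars n.+1 0) ::
                                   [seq TVar i | i <- iota 1 n])))]
  end.

Definition induction_ax : formula :=
  FAll2 (FImp (FAnd (FMem tzero 0) (FAll (FImp (FMem (TVar 0) 0) (FMem (tsucc (TVar 0)) 0))))
              (FAll (FMem (TVar 0) 0))).

Definition comprehension (p : formula) : formula :=
  closure (FEx2 (FAll (FIff (FMem (TVar 0) 0) (sshift p)))).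

Definition ACA0 : theory := fun q =>
  (exists n (f : prf n) p, In p (fun_axioms f) /\ q = closure p)
  \/ q = induction_ax
  \/ (exists p, arithmetical p /\ q = comprehension p).

Definition extends_ACA0 (T : theory) : Prop := forall p, ACA0 p -> Prv T p.

Definition pr (a b : nat) : nat := 2 ^ a * (2 * b).+1.
Definition enc_list (l : seq nat) : nat := foldr (fun a b => (pr a b).+1) 0 l.

Fixpoint enc_prf n (f : prf n) : nat :=
  match f with
  | PZ => pr 0 0
  | PS => pr 1 0
  | PP n i => pr 2 (pr n i)
  | PC k n g hs => pr 3 (pr k (pr n (pr (enc_prf g)
                          (enc_list (map (fun i => enc_prf (hs i)) (enum 'I_k))))))
  | PR n g h => pr 4 (pr n (pr (enc_prf g) (enc_prf h)))
  end.

Fixpoint enc_term (t : term) : nat :=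
  match t with
  | TVar i => pr 0 i
  | TApp n f a => pr 1 (pr n (pr (enc_prf f)
                      (enc_list (map (fun i => enc_term (a i)) (enum 'I_n)))))
  end.

Fixpoint godel (p : formula) : nat :=
  match p with
  | FBot => pr 0 0
  | FEq t s => pr 1 (pr (enc_term t) (enc_term s))
  | FMem t k => pr 2 (pr (enc_term t) k)
  | FImp p q => pr 3 (pr (godel p) (godel q))
  | FAll p => pr 4 (godel p)
  | FAll2 p => pr 5 (godel p)
  end.

Definition sigma11_definable (T : theory) : Prop :=
  exists p, sigma11 p /\ nv p <= 1 /\ sv p = 0 /\
    forall n, (exists q, T q /\ godel q = n) <-> sat (fun _ => n) (fun _ _ => False) p.

Definition pi11_sound (T : theory) : Prop :=
  forall p, sentence p -> pi11 p -> Prv T p -> true_in_N p.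

Definition pi11_equiv (T U : theory) : Prop :=
  forall p, sentence p -> pi11 p -> (Prv T p <-> Prv U p).

Definition tunion (T V : theory) : theory := fun p => T p \/ V p.

Definition prec (f : prf 2) (x y : nat) : Prop := peval f (vcons x (vcons y (fun _ => 0))) <> 0.

Definition tprec (f : prf 2) (s t : term) : formula := FNot (FEq (TApp f (@targs 2 [:: s; t])) tzero).

Definition WF (f : prf 2) : formula :=
  FAll2 (FImp (FEx (FMem (TVar 0) 0))
              (FEx (FAnd (FMem (TVar 0) 0)
                         (FAll (FImp (FMem (TVar 0) 0) (FNot (tprec f (TVar 0) (TVar 1)))))))).

Definition in_field (R : nat -> nat -> Prop) (x : nat) : Prop := exists y, R x y \/ R y x.

Definition well_ordering (R : nat -> nat -> Prop) : Prop :=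
  (forall x, ~ R x x) /\ (forall x y z, R x y -> R y z -> R x z) /\
  (forall x y, in_field R x -> in_field R y -> x = y \/ R x y \/ R y x) /\
  well_founded R.

(* order type of the initial segment of R below x  <  order type of S :
   it embeds order-preservingly into a proper initial segment of S *)
Definition otp_seg_lt (R : nat -> nat -> Prop) (x : nat) (S : nat -> nat -> Prop) : Prop :=
  exists y g, in_field S y /\
    (forall a b, R a b -> R b x -> S (g a) (g b)) /\ (forall a, R a x -> S (g a) y).

(* |T|_WF <= |U|_WF : every ordinal below an order type in the defining set of T
   is below some order type in the defining set of U *)
Definition wf_ord_le (T U : theory) : Prop :=
  forall f : prf 2, well_ordering (prec f) -> Prv T (WF f) ->
  forall x, in_field (prec f) x ->
    exists g : prf 2, well_ordering (prec g) /\ Prv U (WF g) /\ otp_seg_lt (prec f) x (prec g).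

Definition wf_ord_eq (T U : theory) : Prop := wf_ord_le T U /\ wf_ord_le U T.

Definition admissible (T : theory) : Prop :=
  is_theory T /\ sigma11_definable T /\ pi11_sound T /\ extends_ACA0 T.

Definition good (E : theory -> theory -> Prop) : Prop :=
  (forall T U, admissible T -> admissible U -> pi11_equiv T U -> E T U) /\
  (forall T U, admissible T -> admissible U ->
     forall V : theory, (forall p, V p -> sentence p /\ sigma11 p /\ true_in_N p) ->
     E T (tunion T V)).

(* Main.v *)
From Stdlib Require Import RelationClasses Classical ClassicalEpsilon.
From Stdlib Require Import FunctionalExtensionality PropExtensionality Eqdep_dec.
From mathcomp Require Import all_boot zify.
Require Import Defs.

(* Let V be the set of true sentences "prec f embeds in prec g", a Sigma^1_1 set of true
   Sigma^1_1 sentences. Goodness gives T == T + V and U == U + V, so it suffices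
   that T + V and U + V prove the same Pi^1_1 sentences. If T + V proves p, then T
   proves a Pi^1_1 sentence psi expressing that finitely many members of V imply p.
   The Kleene-Brouwer order f of the tree of attempts to refute psi satisfies
   ACA_0 |- psi <-> WF(f), so T |- WF(f), and as psi is true, f is a well-order,
   whose greatest element is the root of the tree. Since |T| <= |U|, f then embeds
   in some g with U |- WF(g); the embedding belongs to V, hence U + V proves WF(f),
   psi, and p. Derivability in ACA_0 is handled semantically, through a Henkin
   completeness theorem. *)

Set Implicit Arguments.
Unset Strict Implicit.
Unset Printing Implicit Defensive.

(** * Henkin semantics and soundness *)

(** Equality of suprema yields some [g] with [WF g] provable in [U], but [U] need not know that [f]
    embeds in [g]. That embedding is a true $\Sigma^1_1$ sentence, exactly what goodness allows one
    to add for free. The first clause of goodness is then applied to the enlarged theories, so these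
    must again be $\Sigma^1_1$-definable: truth of an embedding sentence has to be expressed
    uniformly in its Goedel number, which requires a set that evaluates codes of primitive recursive
    functions. Soundness survives because finitely many $\Sigma^1_1$ hypotheses of a $\Pi^1_1$
    sentence are absorbed into its universal prefix. The comparison of ordinals speaks only of
    segments below an element of the field; a greatest element makes such a segment exhaust all the
    rest of the order. Models of [ACA0] may contain nonstandard numbers. Sequences, tree and order
    are therefore primitive recursive symbols whose properties are proved inside an arbitrary model,
    by induction on definable sets only. *)

Record model := Model {
  dom : Type;
  sets : Type;
  mm : dom -> sets -> Prop;
  fi : forall n, prf n -> ('I_n -> dom) -> dom }.

Definition mcons (D : Type) (a : D) (v : nat -> D) : nat -> D :=
  fun j => if j is j'.+1 then v j' else a.

Fixpoint mteval (M : model) (rho : nat -> dom M) (t : term) {struct t} : dom M :=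
  match t with
  | TVar i => rho i
  | TApp n f a => fi f (fun i => mteval rho (a i))
  end.

Fixpoint msat (M : model) (rho : nat -> dom M) (eta : nat -> sets M) (p : formula) : Prop :=
  match p with
  | FBot => False
  | FEq t s => mteval rho t = mteval rho s
  | FMem t k => mm (mteval rho t) (eta k)
  | FImp p q => msat rho eta p -> msat rho eta q
  | FAll p => forall x, msat (mcons x rho) eta p
  | FAll2 p => forall X, msat rho (mcons X eta) p
  end.

Definition models (M : model) (T : theory) : Prop :=
  forall p, T p -> forall rho eta, @msat M rho eta p.

Lemma mcons_eta D (v : nat -> D) : mcons (v 0) (fun j => v j.+1) = v.
Proof. by apply: functional_extensionality; case. Qed.

Section Semantics.
Variable M : model.
Implicit Types (rho : nat -> dom M) (eta : nat -> sets M).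

Lemma msat_and rho eta p q : msat rho eta (FAnd p q) <-> msat rho eta p /\ msat rho eta q.
Proof. by rewrite /=; split => [H|[H1 H2] H]; [split; apply: NNPP; tauto | exact: H]. Qed.

Lemma msat_or rho eta p q : msat rho eta (FOr p q) <-> msat rho eta p \/ msat rho eta q.
Proof. by rewrite /=; case: (classic (msat rho eta p)); tauto. Qed.

Lemma msat_iff rho eta p q : msat rho eta (FIff p q) <-> (msat rho eta p <-> msat rho eta q).
Proof. by rewrite /FIff msat_and /=; tauto. Qed.

Lemma msat_ex rho eta p : msat rho eta (FEx p) <-> exists x, msat (mcons x rho) eta p.
Proof.
rewrite /=; split => [H|[x Hx] H]; last exact: (H x).
by apply: NNPP => H1; apply: H => x Hx; apply: H1; exists x.
Qed.

Lemma msat_ex2 rho eta p : msat rho eta (FEx2 p) <-> exists X, msat rho (mcons X eta) p.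
Proof.
rewrite /=; split => [H|[x Hx] H]; last exact: (H x).
by apply: NNPP => H1; apply: H => x Hx; apply: H1; exists x.
Qed.

Lemma mteval_subst rho s t : mteval rho (tsubst s t) = mteval (fun i => mteval rho (s i)) t.
Proof.
elim: t => //= n f a IH; congr (fi f _).
by apply: functional_extensionality => i; exact: IH.
Qed.

Lemma mteval_shift x rho t : mteval (mcons x rho) (tshift t) = mteval rho t.
Proof. by rewrite mteval_subst. Qed.

Lemma mteval_up x rho s :
  (fun i => mteval (mcons x rho) (up s i)) = mcons x (fun i => mteval rho (s i)).
Proof. by apply: functional_extensionality => -[|i] //=; rewrite mteval_shift. Qed.

Lemma msat_subst p : forall rho eta s,
  msat rho eta (fsubst s p) <-> msat (fun i => mteval rho (s i)) eta p.
Proof.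
elim: p => [|t u|t k|p IHp q IHq|p IH|p IH] rho eta s //=.
- by rewrite !mteval_subst.
- by rewrite mteval_subst.
- by rewrite IHp IHq.
- by split=> H x; move: (H x); rewrite IH mteval_up.
- by split=> H X; move: (H X); rewrite IH.
Qed.

Lemma sup_mcons X eta r : (fun i => mcons X eta (sup r i)) = mcons X (fun i => eta (r i)).
Proof. by apply: functional_extensionality => -[]. Qed.

Lemma msat_ssubst p : forall rho eta r,
  msat rho eta (fssubst r p) <-> msat rho (fun i => eta (r i)) p.
Proof.
elim: p => [|t u|t k|p IHp q IHq|p IH|p IH] rho eta r //=.
- by rewrite IHp IHq.
- by split=> H x; move: (H x); rewrite IH.
- by split=> H X; move: (H X); rewrite IH sup_mcons.
Qed.

Lemma msat_shift x rho eta p : msat (mcons x rho) eta (shift p) <-> msat rho eta p.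
Proof. by rewrite msat_subst. Qed.

Lemma msat_sshift X rho eta p : msat rho (mcons X eta) (sshift p) <-> msat rho eta p.
Proof. by rewrite msat_ssubst. Qed.

Lemma msat_inst rho eta t p :
  msat rho eta (fsubst (inst t) p) <-> msat (mcons (mteval rho t) rho) eta p.
Proof.
rewrite msat_subst.
suff -> : (fun i => mteval rho (inst t i)) = mcons (mteval rho t) rho by [].
by apply: functional_extensionality => -[].
Qed.

Lemma msat_sinst rho eta k p :
  msat rho eta (fssubst (sinst k) p) <-> msat rho (mcons (eta k) eta) p.
Proof.
rewrite msat_ssubst.
suff -> : (fun i => eta (sinst k i)) = mcons (eta k) eta by [].
by apply: functional_extensionality => -[].
Qed.

Theorem soundness T p : Prv T p -> models M T -> forall rho eta, @msat M rho eta p.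
Proof.
move=> H HM; elim: H => {p} /=.
- by move=> p Tp; exact: HM.
- by [].
- by move=> p q r rho eta; tauto.
- by move=> p rho eta H; apply: NNPP; tauto.
- by move=> p q _ H1 _ H2 rho eta; apply: H1; exact: H2.
- by move=> p t rho eta H; apply/msat_inst; exact: H.
- by move=> p k rho eta H; apply/msat_sinst; exact: H.
- by move=> p rho eta H x; apply/msat_shift.
- by move=> p rho eta H X; apply/msat_sshift.
- by move=> p q rho eta H1 H2 x; apply: H1; exact: H2.
- by move=> p q rho eta H1 H2 x; apply: H1; exact: H2.
- by move=> p _ H rho eta x; exact: H.
- by move=> p _ H rho eta x; exact: H.
- by [].
- by move=> p s t rho eta H; rewrite !msat_inst H.
Qed.

Lemma tnv_app n (f : prf n) a i : tnv (a i) <= tnv (TApp f a).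
Proof.
rewrite /=; have: i \in enum 'I_n by rewrite mem_enum.
elim: (enum _) => //= j l IH; rewrite inE => /orP[/eqP <-|/IH H].
  exact: leq_maxl.
exact: leq_trans H (leq_maxr _ _).
Qed.

Lemma tnv_appP n (f : prf n) a m : (tnv (TApp f a) <= m) <-> (forall i, tnv (a i) <= m).
Proof.
split=> [H i|H /=]; first exact: leq_trans (tnv_app f a i) H.
by elim: (enum _) => //= j l IH; rewrite geq_max H.
Qed.

Lemma mteval_ext rho rho' t :
  (forall i, i < tnv t -> rho i = rho' i) -> mteval rho t = mteval rho' t.
Proof.
elim: t => [i|n f a IH] H; first by apply: H => /=.
rewrite /=; congr (fi f _).
apply: functional_extensionality => i; apply: IH => j Hj; apply: H.
exact: leq_trans Hj (tnv_app f a i).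
Qed.

Lemma msat_ext p : forall rho rho' eta eta',
  (forall i, i < nv p -> rho i = rho' i) -> (forall i, i < sv p -> eta i = eta' i) ->
  msat rho eta p <-> msat rho' eta' p.
Proof.
elim: p => [|t u|t k|p IHp q IHq|p IH|p IH] rho rho' eta eta' /= H1 H2 //.
- rewrite (@mteval_ext rho rho' t) ?(@mteval_ext rho rho' u) // => i Hi; apply: H1;
  by rewrite leq_max Hi ?orbT.
- by rewrite (@mteval_ext rho rho' t) ?H2.
- rewrite (IHp rho rho' eta eta') ?(IHq rho rho' eta eta') // => i Hi; (apply: H1 || apply: H2);
  by rewrite leq_max Hi ?orbT.
- split=> H x; move: (H x); [rewrite (IH _ (mcons x rho') _ eta')|rewrite -(IH (mcons x rho) _ eta)] => //;
  by move=> [|i] Hi //=; apply: H1; lia.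
- split=> H x; move: (H x);
  [rewrite (IH _ rho' _ (mcons x eta'))|rewrite -(IH rho _ (mcons x eta))] => //;
  by move=> [|i] Hi //=; apply: H2; lia.
Qed.

Lemma msat_sentence p rho rho' eta eta' : sentence p -> msat rho eta p <-> @msat M rho' eta' p.
Proof. by case=> H1 H2; apply: msat_ext; rewrite ?H1 ?H2. Qed.

Lemma msat_iter_all k q rho eta : msat rho eta (iter k FAll q) <->
  forall rho', (forall i, rho' (i + k) = rho i) -> @msat M rho' eta q.
Proof.
elim: k rho => [|k IH] rho.
  split=> [H rho' E|]; last by apply=> i; rewrite addn0.
  suff -> : rho' = rho by [].
  by apply: functional_extensionality => i; rewrite -E addn0.
rewrite iterS; split=> [H rho' E|H x].
  by have /IH := H (rho' k); apply=> -[|i] //=; rewrite addSnnS E.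
by apply/IH => rho' E; apply: H => i; rewrite addnS -addSn E.
Qed.

Lemma msat_iter_all2 k q rho eta : msat rho eta (iter k FAll2 q) <->
  forall eta', (forall i, eta' (i + k) = eta i) -> @msat M rho eta' q.
Proof.
elim: k eta => [|k IH] eta.
  split=> [H eta' E|]; last by apply=> i; rewrite addn0.
  suff -> : eta' = eta by [].
  by apply: functional_extensionality => i; rewrite -E addn0.
rewrite iterS; split=> [H eta' E|H X].
  by have /IH := H (eta' k); apply=> -[|i] //=; rewrite addSnnS E.
by apply/IH => eta' E; apply: H => i; rewrite addnS -addSn E.
Qed.

Lemma msat_closure p rho eta :
  msat rho eta (closure p) <-> forall rho' eta', @msat M rho' eta' p.
Proof.
split=> [|H]; last first.
  by apply/msat_iter_all2 => eta' _; apply/msat_iter_all => rho' _; exact: H.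
move=> /msat_iter_all2 H rho' eta'.
(* [eta1], like [rho1] below, takes the indices that occur in [p] from the new assignment and then
   continues with the old one, as the iterated quantifiers demand. *)
pose eta1 i := if i < sv p then eta' i else eta (i - sv p).
have /msat_iter_all H1 : msat rho eta1 (iter (nv p) FAll p).
  by apply: H => i; rewrite /eta1 ltnNge leq_addl /= addnK.
pose rho1 i := if i < nv p then rho' i else rho (i - nv p).
have H2 : msat rho1 eta1 p by apply: H1 => i; rewrite /rho1 ltnNge leq_addl /= addnK.
by rewrite (@msat_ext p rho' rho1 eta' eta1) // => i Hi; rewrite /rho1 /eta1 Hi.
Qed.

End Semantics.

(** * Completeness *)

Lemma pr_inj a b a' b' : pr a b = pr a' b' -> a = a' /\ b = b'.
Proof.
rewrite /pr.
(* After cancelling [2 ^ x] the left side is odd, so no factor 2 can remain on the right. *)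
have aux x y u v : x <= u -> 2 ^ x * (2 * y).+1 = 2 ^ u * (2 * v).+1 -> x = u /\ y = v.
  move=> le H; have E : (2 * y).+1 = 2 ^ (u - x) * (2 * v).+1.
    apply/eqP; rewrite -(@eqn_pmul2l (2 ^ x)) ?expn_gt0 //.
    by rewrite mulnA -expnD subnKC // H.
  case: (posnP (u - x)) => [E0|lt0]; first by rewrite E0 in E; lia.
  have : odd (2 ^ (u - x) * (2 * v).+1) by rewrite -E; lia.
  by rewrite oddM oddX; case: (u - x) lt0.
by case/orP: (leq_total a a') => le H; [exact: aux H|case: (aux _ _ _ _ le (esym H))].
Qed.

Lemma enc_list_inj : injective enc_list.
Proof.
elim=> [|a l IH] [|b m] //= [E].
by case: (pr_inj E) => -> /IH ->.
Qed.

Lemma enc_fun_inj k (h h' : 'I_k -> nat) :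
  enc_list (map h (enum 'I_k)) = enc_list (map h' (enum 'I_k)) -> forall i, h i = h' i.
Proof.
move/enc_list_inj/eq_in_map => H i; by apply: H; rewrite mem_enum.
Qed.

(** The arity is itself read off the code, hence the dependent pair; decidability of equality on
    [nat] turns this into equality at a fixed arity. *)
Lemma enc_prf_inj_dep n (f : prf n) : forall m (g : prf m),
  enc_prf f = enc_prf g -> existT prf n f = existT prf m g.
Proof.
elim: f => [||n' i|k n' g IHg hs IHh|n' g IHg h IHh] m f'; case: f' => [||m' j|k' m' g' hs'|m' g' h'] /= E;
  case: (pr_inj E) => // _ {}E.
- case: (pr_inj E) => E1; subst m' => Eij; by rewrite (val_inj Eij).
- case: (pr_inj E) => E1; subst k' => {}E.
  case: (pr_inj E) => E1; subst m' => {}E.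
  case: (pr_inj E) => /IHg Eg /enc_fun_inj Eh.
  have -> : g = g' by apply: inj_pair2_eq_dec Eg; exact: PeanoNat.Nat.eq_dec.
  suff -> : hs = hs' by [].
  apply: functional_extensionality => i.
  by have := IHh i _ _ (Eh i); apply: inj_pair2_eq_dec; exact: PeanoNat.Nat.eq_dec.
- case: (pr_inj E) => E1; subst m' => {}E.
  case: (pr_inj E) => /IHg Eg /IHh Eh.
  have -> : g = g' by apply: inj_pair2_eq_dec Eg; exact: PeanoNat.Nat.eq_dec.
  suff -> : h = h' by [].
  by apply: inj_pair2_eq_dec Eh; exact: PeanoNat.Nat.eq_dec.
Qed.

Lemma enc_prf_inj n : injective (@enc_prf n).
Proof.
move=> f g /enc_prf_inj_dep; apply: inj_pair2_eq_dec; exact: PeanoNat.Nat.eq_dec.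
Qed.

Lemma enc_term_inj : injective enc_term.
Proof.
elim=> [i|n f a IH] [j|m g b] /= E; case: (pr_inj E) => // _ {}E; first by rewrite E.
case: (pr_inj E) => E1; subst m => {}E.
case: (pr_inj E) => /enc_prf_inj -> /enc_fun_inj Ea.
congr TApp; apply: functional_extensionality => i; exact: IH.
Qed.

Lemma godel_inj : injective godel.
Proof.
elim=> [|t u|t k|p IHp q IHq|p IH|p IH] [|t' u'|t' k'|p' q'|p'|p'] /= E; case: (pr_inj E) => // _ {}E.
- by case: (pr_inj E) => /enc_term_inj -> /enc_term_inj ->.
- by case: (pr_inj E) => /enc_term_inj -> ->.
- by case: (pr_inj E) => /IHp -> /IHq ->.
- by rewrite (IH _ E).
- by rewrite (IH _ E).
Qed.

(** * Substitution calculus *)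

Lemma tsubst_id t : tsubst TVar t = t.
Proof. by elim: t => //= n f a IH; congr TApp; apply: functional_extensionality. Qed.

Lemma tsubst_comp s s' t : tsubst s (tsubst s' t) = tsubst (fun i => tsubst s (s' i)) t.
Proof. by elim: t => //= n f a IH; congr TApp; apply: functional_extensionality. Qed.

Lemma up_id : up TVar = TVar.
Proof. by apply: functional_extensionality => -[]. Qed.

Lemma up_comp s s' : (fun i => tsubst (up s) (up s' i)) = up (fun i => tsubst s (s' i)).
Proof.
by apply: functional_extensionality => -[|i] //=; rewrite /tshift !tsubst_comp.
Qed.

Lemma fsubst_id p : fsubst TVar p = p.
Proof.
elim: p => //= [t u|t k|p -> q ->|p IH|p ->] //; by rewrite ?tsubst_id // up_id IH.
Qed.

Lemma fsubst_comp p : forall s s', fsubst s (fsubst s' p) = fsubst (fun i => tsubst s (s' i)) p.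
Proof.
elim: p => //= [t u|t k|p IHp q IHq|p IH|p IH] s s'; rewrite ?tsubst_comp ?IHp ?IHq ?IH //.
by rewrite up_comp.
Qed.

Lemma fsubst_ssubst p : forall s r, fsubst s (fssubst r p) = fssubst r (fsubst s p).
Proof. by elim: p => //= [p IHp q IHq|p IH|p IH] s r; rewrite ?IHp ?IHq ?IH. Qed.

Lemma fssubst_id p : fssubst id p = p.
Proof.
elim: p => //= [p -> q ->|p ->|p IH] //.
suff -> : sup id = id by rewrite IH.
by apply: functional_extensionality => -[].
Qed.

Lemma fssubst_comp p : forall r r', fssubst r (fssubst r' p) = fssubst (r \o r') p.
Proof.
elim: p => //= [p IHp q IHq|p IH|p IH] r r'; rewrite ?IHp ?IHq ?IH //.
by congr (FAll2 (fssubst _ _)); apply: functional_extensionality => -[].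
Qed.

Lemma tsubst_ext s s' t : (forall i, i < tnv t -> s i = s' i) -> tsubst s t = tsubst s' t.
Proof.
elim: t => [i|n f a IH] H; first by apply: H => /=.
rewrite /=; congr TApp; apply: functional_extensionality => i; apply: IH => j Hj; apply: H.
exact: leq_trans Hj (tnv_app f a i).
Qed.

Lemma fsubst_ext p : forall s s', (forall i, i < nv p -> s i = s' i) -> fsubst s p = fsubst s' p.
Proof.
elim: p => //= [t u|t k|p IHp q IHq|p IH|p IH] s s' H.
- by congr FEq; apply: tsubst_ext => i Hi; apply: H; rewrite leq_max Hi ?orbT.
- by congr FMem; apply: tsubst_ext => i Hi; apply: H.
- by congr FImp; (apply: IHp || apply: IHq) => i Hi; apply: H; rewrite leq_max Hi ?orbT.
- by congr FAll; apply: IH => -[|i] Hi //=; rewrite H //; lia.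
- by congr FAll2; apply: IH.
Qed.

Lemma fssubst_ext p : forall r r', (forall i, i < sv p -> r i = r' i) -> fssubst r p = fssubst r' p.
Proof.
elim: p => //= [t k|p IHp q IHq|p IH|p IH] s s' H.
- by rewrite H.
- by congr FImp; (apply: IHp || apply: IHq) => i Hi; apply: H; rewrite leq_max Hi ?orbT.
- by congr FAll; apply: IH.
- by congr FAll2; apply: IH => -[|i] Hi //=; rewrite H //; lia.
Qed.

Lemma fsubst_sentence s p : sentence p -> fsubst s p = p.
Proof. by case=> H _; rewrite -[RHS]fsubst_id; apply: fsubst_ext; rewrite H. Qed.

Lemma fssubst_sentence r p : sentence p -> fssubst r p = p.
Proof. by case=> _ H; rewrite -[RHS]fssubst_id; apply: fssubst_ext; rewrite H. Qed.

Lemma tsubst_inst_shift u t : tsubst (inst u) (tshift t) = t.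
Proof. by rewrite /tshift tsubst_comp -[RHS]tsubst_id. Qed.

Lemma fsubst_inst s t p :
  fsubst s (fsubst (inst t) p) = fsubst (inst (tsubst s t)) (fsubst (up s) p).
Proof.
rewrite !fsubst_comp; congr fsubst; apply: functional_extensionality => -[|i] //=.
by rewrite tsubst_inst_shift.
Qed.

Lemma fsubst_up_shift s p : fsubst (up s) (shift p) = shift (fsubst s p).
Proof. by rewrite /shift !fsubst_comp. Qed.

Lemma fssubst_sinst r k p :
  fssubst r (fssubst (sinst k) p) = fssubst (sinst (r k)) (fssubst (sup r) p).
Proof.
by rewrite !fssubst_comp; congr fssubst; apply: functional_extensionality => -[|i].
Qed.

Lemma fssubst_sup_shift r p : fssubst (sup r) (sshift p) = sshift (fssubst r p).
Proof. by rewrite /sshift !fssubst_comp. Qed.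

(** * Henkin completeness: open hypotheses, maximal extension, term model *)

Section Completeness.
Variable T : theory.
Hypothesis Tsent : is_theory T.

(** Axioms of [T] are sentences, hence fixed, and each logical scheme and rule is stable under
    substitution. This is what allows a fresh free variable to be renamed into a bound one. *)
Lemma Prv_subst p : Prv T p -> forall s, Prv T (fsubst s p).
Proof.
elim=> {p} /= *.
- by rewrite fsubst_sentence; [exact: PrvAx|exact: Tsent].
- exact: PrvK.
- exact: PrvS.
- exact: PrvDN.
- by apply: PrvMP; eauto.
- rewrite fsubst_inst; exact: PrvInst.
- rewrite fsubst_ssubst; exact: PrvInst2.
- rewrite fsubst_up_shift; exact: PrvVac.
- rewrite /sshift fsubst_ssubst; exact: PrvVac2.
- exact: PrvDist.
- exact: PrvDist2.
- exact: PrvGen.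
- exact: PrvGen2.
- exact: PrvRefl.
- rewrite !fsubst_inst; exact: PrvLeib.
Qed.

Lemma Prv_ssubst p : Prv T p -> forall r, Prv T (fssubst r p).
Proof.
elim=> {p} /= *.
- by rewrite fssubst_sentence; [exact: PrvAx|exact: Tsent].
- exact: PrvK.
- exact: PrvS.
- exact: PrvDN.
- by apply: PrvMP; eauto.
- rewrite -fsubst_ssubst; exact: PrvInst.
- rewrite fssubst_sinst; exact: PrvInst2.
- rewrite /shift -fsubst_ssubst; exact: PrvVac.
- rewrite fssubst_sup_shift; exact: PrvVac2.
- exact: PrvDist.
- exact: PrvDist2.
- exact: PrvGen.
- exact: PrvGen2.
- exact: PrvRefl.
- rewrite -!fsubst_ssubst; exact: PrvLeib.
Qed.

(* Consequences of open hypotheses G: generalisation is not allowed over them. *)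
Inductive Der (G : formula -> Prop) : formula -> Prop :=
| DerHyp p : G p -> Der G p
| DerThm p : Prv T p -> Der G p
| DerMP p q : Der G (FImp p q) -> Der G p -> Der G q.

Definition add1 (G : formula -> Prop) a : formula -> Prop := fun p => G p \/ p = a.

Lemma Der_mono (G G' : formula -> Prop) p : (forall q, G q -> G' q) -> Der G p -> Der G' p.
Proof.
move=> H; elim=> [q /H|q|q r _ H1 _ H2]; [exact: DerHyp|exact: DerThm|exact: DerMP H1 H2].
Qed.

Lemma Der_I G p : Der G (FImp p p).
Proof.
apply: DerThm; apply: PrvMP (PrvK T p p).
exact: PrvMP (PrvS T p (FImp p p) p) (PrvK T p (FImp p p)).
Qed.

Lemma Der_weak G p q : Der G q -> Der G (FImp p q).
Proof. by apply: DerMP; apply: DerThm; exact: PrvK. Qed.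

Lemma Der_S G p q r : Der G (FImp p (FImp q r)) -> Der G (FImp p q) -> Der G (FImp p r).
Proof. by move=> H; apply: DerMP; apply: DerMP H; apply: DerThm; exact: PrvS. Qed.

Lemma deduction G a p : Der (add1 G a) p -> Der G (FImp a p).
Proof.
elim=> [q [Gq|->]|q H|q r _ H1 _ H2].
- by apply: Der_weak; exact: DerHyp.
- exact: Der_I.
- by apply: Der_weak; exact: DerThm.
- exact: Der_S H1 H2.
Qed.

Lemma Der_add1 G a : Der (add1 G a) a.
Proof. by apply: DerHyp; right. Qed.

Lemma Der_add1w G a p : Der G p -> Der (add1 G a) p.
Proof. by apply: Der_mono => q; left. Qed.

Lemma Der_raa G p : Der (add1 G (FNot p)) FBot -> Der G p.
Proof. by move/deduction => H; apply: DerMP H; apply: DerThm; exact: PrvDN. Qed.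

Lemma Der_exfalso G p : Der G FBot -> Der G p.
Proof. by move=> H; apply: Der_raa; apply: Der_add1w. Qed.

Lemma Der_notimp G p q : Der G (FNot (FImp p q)) -> Der G p /\ Der G (FNot q).
Proof.
move=> H; split.
  apply: Der_raa; apply: DerMP (Der_add1w _ H) _.
  apply: deduction; apply: Der_exfalso; apply: DerMP (Der_add1 _ _).
  exact/Der_add1w/Der_add1.
apply: deduction; apply: DerMP (Der_add1w _ H) _.
exact/Der_weak/Der_add1.
Qed.

(** A shifted hypothesis does not mention variable 0, so [PrvVac] generalises it, and [PrvDist]
    carries generalisation through modus ponens. *)
Lemma Der_gen G G' p :
  (forall q, G' q -> exists2 q0, G q0 & q = shift q0) -> Der G' p -> Der G (FAll p).
Proof.
move=> HG; elim=> [q /HG [q0 Gq ->]|q H|q r _ H1 _ H2].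
- by apply: DerMP (DerHyp Gq); apply: DerThm; exact: PrvVac.
- by apply: DerThm; exact: PrvGen.
- by apply: DerMP H2; apply: DerMP H1; apply: DerThm; exact: PrvDist.
Qed.

Lemma Der_gen2 G G' p :
  (forall q, G' q -> exists2 q0, G q0 & q = sshift q0) -> Der G' p -> Der G (FAll2 p).
Proof.
move=> HG; elim=> [q /HG [q0 Gq ->]|q H|q r _ H1 _ H2].
- by apply: DerMP (DerHyp Gq); apply: DerThm; exact: PrvVac2.
- by apply: DerThm; exact: PrvGen2.
- by apply: DerMP H2; apply: DerMP H1; apply: DerThm; exact: PrvDist2.
Qed.

Lemma Der_subst G G' s p : (forall q, G q -> G' (fsubst s q)) -> Der G p -> Der G' (fsubst s p).
Proof.
move=> HG; elim=> [q /HG|q H|q r _ /= H1 _ H2]; first exact: DerHyp.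
  by apply: DerThm; exact: Prv_subst.
exact: DerMP H1 H2.
Qed.

Lemma Der_ssubst G G' r p : (forall q, G q -> G' (fssubst r q)) -> Der G p -> Der G' (fssubst r p).
Proof.
move=> HG; elim=> [q /HG|q H|q r' _ /= H1 _ H2]; first exact: DerHyp.
  by apply: DerThm; exact: Prv_ssubst.
exact: DerMP H1 H2.
Qed.

Definition bounded (N : nat) (G : formula -> Prop) := forall q, G q -> nv q <= N /\ sv q <= N.

Lemma Der_fresh G k p : bounded k G -> nv p <= k.+1 ->
  Der G (fsubst (inst (TVar k)) p) -> Der G (FAll p).
Proof.
move=> HG Hp H.
(* [s] sends the fresh variable to 0 and shifts all others: hypotheses become shifts, and the
   instance of [p] at [k] becomes [p] again. *)
pose s i := if i == k then TVar 0 else TVar i.+1.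
pose G' q := exists2 q0, G q0 & q = shift q0.
have H1 : Der G' (fsubst s (fsubst (inst (TVar k)) p)).
  apply: Der_subst H => q Gq; exists q => //.
  apply: fsubst_ext => i Hi; rewrite /s; case: eqP => // Ei.
  by case: (HG _ Gq) => Hq _; lia.
suff Es : fsubst s (fsubst (inst (TVar k)) p) = p by rewrite Es in H1; exact: Der_gen H1.
rewrite fsubst_comp -[RHS]fsubst_id; apply: fsubst_ext => -[|i] Hi /=; rewrite /s ?eqxx //.
by case: eqP => //; lia.
Qed.

Lemma Der_sfresh G k p : bounded k G -> sv p <= k.+1 ->
  Der G (fssubst (sinst k) p) -> Der G (FAll2 p).
Proof.
move=> HG Hp H.
pose s i := if i == k then 0 else i.+1.
pose G' q := exists2 q0, G q0 & q = sshift q0.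
have H1 : Der G' (fssubst s (fssubst (sinst k) p)).
  apply: Der_ssubst H => q Gq; exists q => //.
  apply: fssubst_ext => i Hi; rewrite /s; case: eqP => // Ei.
  by case: (HG _ Gq) => _ Hq; lia.
suff Es : fssubst s (fssubst (sinst k) p) = p by rewrite Es in H1; exact: Der_gen2 H1.
rewrite fssubst_comp -[RHS]fssubst_id; apply: fssubst_ext => -[|i] Hi /=; rewrite /s ?eqxx //.
by case: eqP => //; lia.
Qed.

Definition consistent G := ~ Der G FBot.

(** Henkin axiom: variable [k] is a generic counterexample to [p]. Fresh free variables play the
    part of Henkin constants, so the language is never enlarged. *)
Definition hax k p := FImp (fsubst (inst (TVar k)) p) (FAll p).
Definition hax2 k p := FImp (fssubst (sinst k) p) (FAll2 p).

(** Refuting the axiom would derive both the instance at [k] and the negation of [FAll p]; freshness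
    of [k] generalises the former. *)
Lemma consistent_hax G k p : bounded k G -> nv p <= k.+1 -> consistent G ->
  consistent (add1 G (hax k p)).
Proof.
move=> HG Hp HC /deduction /Der_notimp [H1 H2]; apply: HC.
by apply: DerMP H2 _; apply: Der_fresh H1.
Qed.

Lemma consistent_hax2 G k p : bounded k G -> sv p <= k.+1 -> consistent G ->
  consistent (add1 G (hax2 k p)).
Proof.
move=> HG Hp HC /deduction /Der_notimp [H1 H2]; apply: HC.
by apply: DerMP H2 _; apply: Der_sfresh H1.
Qed.

Definition enumf (n : nat) : formula := epsilon (inhabits FBot) (fun p => godel p = n).

Lemma enumf_godel p : enumf (godel p) = p.
Proof.
have : godel (enumf (godel p)) = godel p by apply: (@epsilon_spec _ _ (fun q => godel q = godel p)); exists p.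
exact: godel_inj.
Qed.

Definition extend (G : formula -> Prop) p q : Prop := G q \/ (q = p /\ consistent (add1 G p)).

Lemma extend_consistent G p : consistent G -> consistent (extend G p).
Proof.
move=> HC; case: (classic (consistent (add1 G p))) => H.
  by move=> H1; apply: H; apply: Der_mono H1 => q [|[]]; [left|right].
by move=> H1; apply: HC; apply: Der_mono H1 => q [|[]].
Qed.

(** One step provides number and set counterexamples for [p] and then adds [p] if this is
    consistent. A bound on all free indices is itself a fresh index; [N1] is computed anew because
    the first Henkin axiom mentions variable [N]. *)
Definition stage_step (G : formula -> Prop) p : formula -> Prop :=
  let N := epsilon (inhabits 0) (fun N => bounded N G /\ nv p <= N /\ sv p <= N) in
  let G1 := add1 G (hax N p) in
  let N1 := epsilon (inhabits 0) (fun N => bounded N G1 /\ nv p <= N /\ sv p <= N) in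
  extend (add1 G1 (hax2 N1 p)) p.

Lemma bounded_ex G p : (exists N, bounded N G) ->
  exists N, bounded N G /\ nv p <= N /\ sv p <= N.
Proof.
move=> [N HN]; exists (N + nv p + sv p); split; last by lia.
by move=> q /HN; lia.
Qed.

Lemma bounded_add1 G p : (exists N, bounded N G) -> exists N, bounded N (add1 G p).
Proof.
move=> [N HN]; exists (N + nv p + sv p) => q [/HN|->]; lia.
Qed.

Lemma stage_stepP G p : (exists N, bounded N G) -> consistent G ->
  [/\ exists N, bounded N (stage_step G p), consistent (stage_step G p),
      forall q, G q -> stage_step G p q,
      (exists k, stage_step G p (hax k p)) /\ (exists k, stage_step G p (hax2 k p)) &
      stage_step G p p \/ ~ consistent (add1 (stage_step G p) p)].
Proof.
move=> HN HC; rewrite /stage_step.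
set N := epsilon _ _.
have [BN [nN sN]] : bounded N G /\ nv p <= N /\ sv p <= N.
  exact: (epsilon_spec (inhabits 0) (fun N => bounded N G /\ nv p <= N /\ sv p <= N) (bounded_ex _ _)).
set G1 := add1 G _.
have HN1 : exists N, bounded N G1 by exact: bounded_add1.
set N1 := epsilon _ _.
have [BN1 [nN1 sN1]] : bounded N1 G1 /\ nv p <= N1 /\ sv p <= N1.
  exact: (epsilon_spec (inhabits 0) (fun N => bounded N G1 /\ nv p <= N /\ sv p <= N) (bounded_ex _ _)).
have C1 : consistent G1 by apply: consistent_hax => //; lia.
set G2 := add1 G1 _.
have C2 : consistent G2 by apply: consistent_hax2 => //; lia.
split.
- case: (@bounded_add1 G2 p); first exact: bounded_add1.
  move=> K HK; exists K => q Hq; apply: HK.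
  by case: Hq => [|[]]; [left|right].
- exact: extend_consistent.
- by move=> q Gq; left; left; left.
- by split; [exists N; left; left; right|exists N1; left; right].
- case: (classic (consistent (add1 G2 p))) => H; first by left; right.
  right=> H1; apply: H => H2; apply: H1; apply: Der_mono H2 => q [H|->]; last by right.
  by left; left.
Qed.

Fixpoint stage G n := if n is n'.+1 then stage_step (stage G n') (enumf n') else G.

Definition henkin G p := exists n, stage G n p.

Section Henkin.
Variable G : formula -> Prop.
Hypothesis Gbounded : exists N, bounded N G.
Hypothesis Gcons : consistent G.

Lemma stageP n : (exists N, bounded N (stage G n)) /\ consistent (stage G n).
Proof. by elim: n => //= n [H1 H2]; case: (stage_stepP (enumf n) H1 H2). Qed.

Lemma stage_mono n m p : n <= m -> stage G n p -> stage G m p.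
Proof.
move=> /subnK <-; elim: (m - n) => //= k IH /IH H.
have [H1 H2] := stageP (k + n).
by case: (stage_stepP (enumf (k + n)) H1 H2) => _ _ H3 _ _; exact: H3.
Qed.

Lemma Der_henkin p : Der (henkin G) p -> exists n, Der (stage G n) p.
Proof.
elim=> [q [n H]|q H|q r _ [n H1] _ [m H2]].
- by exists n; exact: DerHyp.
- by exists 0; exact: DerThm.
- exists (maxn n m); apply: (@DerMP _ q).
    by apply: Der_mono H1 => ?; apply: stage_mono; exact: leq_maxl.
  by apply: Der_mono H2 => ?; apply: stage_mono; exact: leq_maxr.
Qed.

Local Notation Th := (Der (henkin G)).

Lemma henkin_cons : ~ Th FBot.
Proof. by move=> /Der_henkin [n]; case: (stageP n). Qed.

Lemma henkin_stage p :
  [/\ (exists k, henkin G (hax k p)), (exists k, henkin G (hax2 k p)) & Th p \/ Th (FNot p)].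
Proof.
have [H1 H2] := stageP (godel p).
have [_ _ _ [[k Hk] [k2 Hk2]] H] := stage_stepP p H1 H2.
have E q : stage_step (stage G (godel p)) p q -> henkin G q.
  by move=> Hq; exists (godel p).+1; rewrite /= enumf_godel.
split; [by exists k; exact: E|by exists k2; exact: E|].
case: H => [/E|/NNPP/deduction H]; first by left; exact: DerHyp.
by right; apply: Der_mono H.
Qed.

Lemma Th_imp p q : Th (FImp p q) <-> (Th p -> Th q).
Proof.
split=> [H|H]; first exact: DerMP H.
have [_ _ [/H|Hn]] := henkin_stage p; first exact: Der_weak.
apply: deduction; apply: Der_exfalso; apply: DerMP (Der_add1 _ _).
exact: Der_add1w.
Qed.

Lemma Th_all p : Th (FAll p) <-> forall t, Th (fsubst (inst t) p).
Proof.
split=> [H t|H]; first by apply: DerMP H; apply: DerThm; exact: PrvInst.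
by have [[k Hk] _ _] := henkin_stage p; apply: DerMP (H (TVar k)); exact: DerHyp.
Qed.

Lemma Th_all2 p : Th (FAll2 p) <-> forall k, Th (fssubst (sinst k) p).
Proof.
split=> [H t|H]; first by apply: DerMP H; apply: DerThm; exact: PrvInst2.
by have [_ [k Hk] _] := henkin_stage p; apply: DerMP (H k); exact: DerHyp.
Qed.

Lemma Th_refl t : Th (FEq t t).
Proof. by apply: DerThm; exact: PrvRefl. Qed.

Lemma Th_leib p s t : Th (FEq s t) -> Th (fsubst (inst s) p) -> Th (fsubst (inst t) p).
Proof. by move=> H; apply: DerMP; apply: DerMP H; apply: DerThm; exact: PrvLeib. Qed.

Lemma Th_sym s t : Th (FEq s t) -> Th (FEq t s).
Proof.
move=> H; have := @Th_leib (FEq (TVar 0) (tshift s)) _ _ H.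
by rewrite /= !tsubst_inst_shift; apply; exact: Th_refl.
Qed.

Lemma Th_trans s t u : Th (FEq s t) -> Th (FEq t u) -> Th (FEq s u).
Proof.
move=> H1 H2; have := @Th_leib (FEq (tshift s) (TVar 0)) _ _ H2.
by rewrite /= !tsubst_inst_shift; apply.
Qed.

Lemma Th_mem s t k : Th (FEq s t) -> Th (FMem s k) -> Th (FMem t k).
Proof. by move=> H; have := @Th_leib (FMem (TVar 0) k) _ _ H. Qed.

Lemma Th_app n (f : prf n) a b : (forall i, Th (FEq (a i) (b i))) ->
  Th (FEq (TApp f a) (TApp f b)).
Proof.
(* The Leibniz scheme replaces one term, so the arguments are exchanged one at a time; [c j] has the
   first [j] exchanged. *)
move=> H; pose c j i := if val i < j then b i else a i : term.
have Hc j : j <= n -> Th (FEq (TApp f a) (TApp f (c j))).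
  elim: j => [|j IH] Hj; first exact: Th_refl.
  have {}IH := IH (ltnW Hj).
  pose P := FEq (tshift (TApp f a)) (TApp f (fun i => if val i == j then TVar 0 else tshift (c j i))).
  have E t : fsubst (inst t) P =
      FEq (TApp f a) (TApp f (fun i => if val i == j then t else c j i)).
    rewrite /= -/(tsubst (inst t) (tshift (TApp f a))).
    congr FEq; congr TApp; apply: functional_extensionality => i.
      exact: tsubst_inst_shift.
    by case: (val i == j) => //; exact: tsubst_inst_shift.
  have := @Th_leib P _ _ (H (Ordinal Hj)); rewrite !E.
  have -> : (fun i => if val i == j then a (Ordinal Hj) else c j i) = c j.
    apply: functional_extensionality => i; case: eqP => // Ei.
    have -> : i = Ordinal Hj by exact: val_inj.
    by rewrite /c /= ltnn.
  have -> : (fun i => if val i == j then b (Ordinal Hj) else c j i) = c j.+1.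
    apply: functional_extensionality => i; case: eqP => Ei.
      have -> : i = Ordinal Hj by exact: val_inj.
      by rewrite /c /= ltnSn.
    by move/eqP: Ei => Ei; rewrite /c; congr (if _ then _ else _); move: Ei => /=; lia.
  by apply.
have -> : b = c n by apply: functional_extensionality => i; rewrite /c ltn_ord.
exact: Hc.
Qed.

(** Chosen representatives stand in for a quotient by derivable equality. That equal terms share one
    representative rests on extensionality of predicates. *)
Definition rep (t : term) : term := epsilon (inhabits t) (fun u => Th (FEq t u)).

Lemma rep_eq t : Th (FEq t (rep t)).
Proof. exact: (epsilon_spec (inhabits t) (fun u => Th (FEq t u)) (ex_intro _ t (Th_refl t))). Qed.

Lemma rep_ext t u : Th (FEq t u) -> rep t = rep u.
Proof.
move=> H; rewrite /rep.
have -> : (fun v => Th (FEq t v)) = (fun v => Th (FEq u v)).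
  apply: functional_extensionality => v; apply: propositional_extensionality.
  by split; apply: Th_trans => //; exact: Th_sym.
rewrite (_ : inhabits t = inhabits u) //; exact: proof_irrelevance.
Qed.

Definition tdom := {t : term | rep t = t}.

Lemma rep_idem t : rep (rep t) = rep t.
Proof. by apply: rep_ext; apply: Th_sym; exact: rep_eq. Qed.

Definition cls (t : term) : tdom := exist _ (rep t) (rep_idem t).

Lemma cls_eq t u : cls t = cls u <-> Th (FEq t u).
Proof.
split=> [/(congr1 (@proj1_sig _ _)) /= E|/rep_ext E].
  by apply: Th_trans (rep_eq t) _; rewrite E; apply: Th_sym; exact: rep_eq.
by apply: eq_sig_hprop => //= *; exact: proof_irrelevance.
Qed.

Lemma cls_surj (d : tdom) : d = cls (proj1_sig d).
Proof. by apply: eq_sig_hprop => [*|]; [exact: proof_irrelevance|case: d]. Qed.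

(** Set variables are the only set terms of the language, so their indices serve as the sets. *)
Definition term_model : model :=
  @Model tdom nat (fun d k => Th (FMem (proj1_sig d) k))
    (fun n f a => cls (TApp f (fun i => proj1_sig (a i)))).

Lemma mteval_cls s t : @mteval term_model (fun i => cls (s i)) t = cls (tsubst s t).
Proof.
elim: t => //= n f a IH; apply/cls_eq; apply: Th_app => i.
by rewrite IH /=; apply: Th_sym; exact: rep_eq.
Qed.

Lemma truth q : forall s r,
  @msat term_model (fun i => cls (s i)) r q <-> Th (fssubst r (fsubst s q)).
Proof.
elim: q => [|t u|t k|p IHp q IHq|p IH|p IH] s r.
- by split=> // /henkin_cons.
- by rewrite /= !mteval_cls cls_eq.
- rewrite /= mteval_cls /=; split; apply: Th_mem; last exact: rep_eq.
  by apply: Th_sym; exact: rep_eq.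
- by rewrite /= IHp IHq Th_imp.
- rewrite /= Th_all.
  have E t : fsubst (inst t) (fssubst r (fsubst (up s) p)) = fssubst r (fsubst (mcons t s) p).
    rewrite fsubst_ssubst fsubst_comp; congr fssubst; congr fsubst.
    by apply: functional_extensionality => -[|i] //=; exact: tsubst_inst_shift.
  have E2 t : mcons (cls t) (fun i => cls (s i)) = (fun i => cls (mcons t s i)).
    by apply: functional_extensionality => -[].
  split=> H t; first by rewrite E -IH -E2; exact: H.
  by rewrite (cls_surj t) E2 IH -E.
- rewrite /= Th_all2.
  have E k : fssubst (sinst k) (fssubst (sup r) (fsubst s p)) = fssubst (mcons k r) (fsubst s p).
    by rewrite fssubst_comp; congr fssubst; apply: functional_extensionality => -[].
  by split=> H k; move: (H k); rewrite E IH.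
Qed.

End Henkin.

Theorem completeness p :
  (forall M, models M T -> forall rho eta, @msat M rho eta p) -> Prv T p.
Proof.
move=> H; apply: NNPP => Hp.
pose G q := q = FNot p.
have GN : exists N, bounded N G.
  by exists (nv (FNot p) + sv (FNot p)) => q ->; lia.
have PrvDer q : Der (fun _ => False) q -> Prv T q.
  by elim=> // q' r _ H1 _ H2; exact: PrvMP H1 H2.
have GC : consistent G.
  move=> H1; apply: Hp; apply: PrvDer; apply: Der_raa.
  by apply: Der_mono H1 => q; right.
have HM : models (term_model G) T.
  move=> q Tq rho eta.
  have -> : rho = (fun i => cls G (proj1_sig (rho i))).
    by apply: functional_extensionality => i; exact: cls_surj.
  apply/(truth GN GC); apply: DerThm; apply: Prv_ssubst; apply: Prv_subst; exact: PrvAx.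
have := H _ HM (fun i => cls G (TVar i)) id.
rewrite (truth GN GC) fsubst_id fssubst_id => H1.
apply: (henkin_cons GN GC); apply: DerMP H1.
by apply: DerHyp; exists 0.
Qed.

End Completeness.

(** * Models of ACA_0 and definability *)

(** [set0M] is a default value for finite lists of set parameters; in applications it is a value of
    the given assignment. *)
Record aca_model := AcaModel {
  aca_base :> model;
  set0M : sets aca_base;
  aca_ax : models aca_base ACA0 }.

Definition ord0_elim (A : Type) (i : 'I_0) : A := False_rect A (Bool.diff_false_true (ltn_ord i)).

Definition mz (M : model) : dom M := fi PZ (@ord0_elim (dom M)).
Arguments mz {M}.

Definition ap (M : model) n (f : prf n) (l : seq (dom M)) : dom M := fi f (fun i => nth mz l i).

Arguments mteval : simpl never.

Definition TT n (f : prf n) (l : seq term) : term := TApp f (targs l).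

(** Abstraction of a term into a function symbol. A variable beyond the arity becomes 0, in
    agreement with the default of [nth mz]. *)
Fixpoint lam n (t : term) : prf n :=
  match t with
  | TVar i => if (insub i : option 'I_n) is Some o then PP o else PC PZ (@ord0_elim (prf n))
  | TApp k f a => PC f (fun i => lam n (a i))
  end.

(** In [t1] variable 0 is the counter, variable 1 the previous value, and the parameters start at 2;
    in [t0] they start at 0. *)
Definition prec_ n (t0 t1 : term) : prf n.+1 := PR (lam n t0) (lam n.+2 t1).

Notation ms x := (ap PS [:: x]).

Lemma ord0_fun A (v w : 'I_0 -> A) : v = w.
Proof. by apply: functional_extensionality => -[]. Qed.

Section AnyModel.
Variable M : model.
Implicit Types (rho : nat -> dom M) (l : seq (dom M)).

Lemma mt_var rho i : mteval rho (TVar i) = rho i.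
Proof. by []. Qed.

Lemma mt_app rho n (f : prf n) a : mteval rho (TApp f a) = fi f (fun i => mteval rho (a i)).
Proof. by []. Qed.

Lemma mt_TT rho n (f : prf n) (l : seq term) : size l = n ->
  mteval rho (TT f l) = ap f [seq mteval rho t | t <- l].
Proof.
move=> Hl; rewrite mt_app; congr fi; apply: functional_extensionality => i.
by rewrite (nth_map (TVar 0)) // Hl.
Qed.

Lemma mt_zero rho : mteval rho tzero = mz.
Proof. rewrite mt_app; congr fi; exact: ord0_fun. Qed.

Lemma mt_succ rho t : mteval rho (tsucc t) = ms (mteval rho t).
Proof. exact: mt_TT. Qed.

Section Definability.
Variables (A : Type) (pv : A -> nat -> dom M) (pe : A -> nat -> sets M).

(* Definability with the free number and set variables read off a context in A by [pv] and [pe]. *)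
Definition DT (t : A -> dom M) := exists tm, forall a, mteval (pv a) tm = t a.
Definition DF (P : A -> Prop) := exists q, arithmetical q /\ forall a, msat (pv a) (pe a) q <-> P a.

Lemma DT_var i t : (forall a, pv a i = t a) -> DT t.
Proof. by move=> H; exists (TVar i). Qed.

Lemma DT_fi n (f : prf n) (v : A -> 'I_n -> dom M) : (forall i, DT (fun a => v a i)) ->
  DT (fun a => fi f (v a)).
Proof.
move=> H; pose tm i := proj1_sig (constructive_indefinite_description _ (H i)).
exists (TApp f tm) => a; rewrite mt_app; congr fi; apply: functional_extensionality => i.
by rewrite /tm; case: (constructive_indefinite_description _ _) => t /= ->.
Qed.

Lemma DT_mz : DT (fun _ => mz).
Proof. by exists tzero => a; exact: mt_zero. Qed.

Lemma DT_ap n (f : prf n) (ls : A -> seq (dom M)) :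
  (forall j, DT (fun a => nth mz (ls a) j)) -> DT (fun a => ap f (ls a)).
Proof. by move=> H; apply: DT_fi => i; exact: H. Qed.

Lemma DT_ap1 n (f : prf n) t : DT t -> DT (fun a => ap f [:: t a]).
Proof. by move=> H; apply: DT_ap => -[|j] //=; rewrite nth_nil; exact: DT_mz. Qed.

Lemma DT_ap2 n (f : prf n) t u : DT t -> DT u -> DT (fun a => ap f [:: t a; u a]).
Proof. by move=> H H'; apply: DT_ap => -[|[|j]] //=; rewrite nth_nil; exact: DT_mz. Qed.

Lemma DT_ap3 n (f : prf n) t u w : DT t -> DT u -> DT w -> DT (fun a => ap f [:: t a; u a; w a]).
Proof. by move=> H H' H2; apply: DT_ap => -[|[|[|j]]] //=; rewrite nth_nil; exact: DT_mz. Qed.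

Lemma DT_apl n (f : prf n) t l : DT t -> (exists d, forall a j, pv a (d + j) = nth mz l j) ->
  DT (fun a => ap f (t a :: l)).
Proof.
move=> H [d Hd]; apply: DT_ap => -[|j] //=.
by apply: (@DT_var (d + j)) => a; rewrite Hd.
Qed.

Lemma DF_eq t u : DT t -> DT u -> DF (fun a => t a = u a).
Proof. by move=> [t' Ht] [u' Hu]; exists (FEq t' u'); split=> // a /=; rewrite Ht Hu. Qed.

Lemma DF_mem t X : DT t -> (exists k, forall a, pe a k = X a) -> DF (fun a => mm (t a) (X a)).
Proof. by move=> [t' Ht] [k Hk]; exists (FMem t' k); split=> // a /=; rewrite Ht Hk. Qed.

Lemma DF_false : DF (fun _ => False).
Proof. by exists FBot. Qed.

Lemma DF_imp P Q : DF P -> DF Q -> DF (fun a => P a -> Q a).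
Proof.
move=> [p [Hp1 Hp2]] [q [Hq1 Hq2]]; exists (FImp p q); split=> [|a] /=; first exact/andP.
by rewrite Hp2 Hq2.
Qed.

Lemma DF_not P : DF P -> DF (fun a => ~ P a).
Proof. by move=> H; apply: DF_imp H _; exact: DF_false. Qed.

Lemma DF_and P Q : DF P -> DF Q -> DF (fun a => P a /\ Q a).
Proof.
move=> [p [Hp1 Hp2]] [q [Hq1 Hq2]]; exists (FAnd p q); split=> [|a]; first by rewrite /= Hp1 Hq1.
by rewrite msat_and Hp2 Hq2.
Qed.

Lemma DF_or P Q : DF P -> DF Q -> DF (fun a => P a \/ Q a).
Proof.
move=> [p [Hp1 Hp2]] [q [Hq1 Hq2]]; exists (FOr p q); split=> [|a]; first by rewrite /= Hp1 Hq1.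
by rewrite msat_or Hp2 Hq2.
Qed.

Lemma DF_iff P Q : DF P -> DF Q -> DF (fun a => P a <-> Q a).
Proof. by move=> H1 H2; apply: DF_and; exact: DF_imp. Qed.

End Definability.

Lemma DF_all A pv pe (B : A -> dom M -> Prop) :
  DF (fun ax : A * dom M => mcons ax.2 (pv ax.1)) (fun ax => pe ax.1) (fun ax => B ax.1 ax.2) ->
  DF pv pe (fun a => forall x, B a x).
Proof.
move=> [q [H1 H2]]; exists (FAll q); split=> // a /=.
by split=> H x; apply/(H2 (a, x)).
Qed.

Lemma DF_ex A pv pe (B : A -> dom M -> Prop) :
  DF (fun ax : A * dom M => mcons ax.2 (pv ax.1)) (fun ax => pe ax.1) (fun ax => B ax.1 ax.2) ->
  DF pv pe (fun a => exists x, B a x).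
Proof.
move=> [q [H1 H2]]; exists (FEx q); split=> [|a]; first by rewrite /= H1.
rewrite msat_ex.
by split=> -[x Hx]; exists x; apply/(H2 (a, x)).
Qed.

End AnyModel.

Ltac dvar := first
  [ exists (TVar 0); intro; reflexivity | exists (TVar 1); intro; reflexivity
  | exists (TVar 2); intro; reflexivity | exists (TVar 3); intro; reflexivity
  | exists (TVar 4); intro; reflexivity | exists (TVar 5); intro; reflexivity
  | exists (TVar 6); intro; reflexivity | exists (TVar 7); intro; reflexivity
  | exists (TVar 8); intro; reflexivity | exists (TVar 9); intro; reflexivity
  | exists (TVar 10); intro; reflexivity | exists (TVar 11); intro; reflexivity
  | exists (TVar 12); intro; reflexivity | exists (TVar 13); intro; reflexivity ].

Ltac dset := first
  [ exists 0; intro; reflexivity | exists 1; intro; reflexivity | exists 2; intro; reflexivity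
  | exists 3; intro; reflexivity | exists 4; intro; reflexivity | exists 5; intro; reflexivity ].

Ltac dlist := first
  [ exists 0; intros ? ?; reflexivity | exists 1; intros ? ?; reflexivity
  | exists 2; intros ? ?; reflexivity | exists 3; intros ? ?; reflexivity
  | exists 4; intros ? ?; reflexivity | exists 5; intros ? ?; reflexivity ].

Ltac dterm := cbv beta; first
  [ apply DT_mz
  | apply DT_ap1; dterm | apply DT_ap2; [dterm|dterm] | apply DT_ap3; [dterm|dterm|dterm]
  | apply DT_apl; [dterm|dlist]
  | dvar ].

Ltac dform := cbv beta; lazymatch goal with
  | |- DF _ _ (fun a => False) => apply DF_false
  | |- DF _ _ (fun a => @?P a <-> @?Q a) => apply (@DF_iff _ _ _ _ P Q); dform
  | |- DF _ _ (fun a => @?P a /\ @?Q a) => apply (@DF_and _ _ _ _ P Q); dform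
  | |- DF _ _ (fun a => @?P a \/ @?Q a) => apply (@DF_or _ _ _ _ P Q); dform
  | |- DF _ _ (fun a => ~ @?P a) => apply (@DF_not _ _ _ _ P); dform
  | |- @DF ?M _ _ _ (fun a => exists x, @?B a x) => apply (@DF_ex M _ _ _ B); dform
  | |- @DF ?M _ _ _ (fun a => _ = _) => apply (@DF_eq M); dterm
  | |- DF _ _ (fun a => mm _ _) => apply DF_mem; [dterm|dset]
  | |- DF _ _ (fun a => @?P a -> @?Q a) => apply (@DF_imp _ _ _ _ P Q); dform
  | |- @DF ?M _ _ _ (fun a => forall x, @?B a x) => apply (@DF_all M _ _ _ B); dform
  end.

Ltac collect T acc :=
  match goal with
  | x : T |- _ =>
      let acc' := lazymatch acc with context [cons x _] => fail | _ => constr:(cons x acc) end in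
      collect T acc'
  | _ => acc
  end.

(** A hook, redefined as predicates are introduced, that unfolds them before a definability goal is
    decomposed. *)
Ltac dunf := idtac.
Ltac dsolve := dunf; dform.

(** * Recursion equations, comprehension and induction in a model *)

Section Aca.
Variable M : aca_model.
Local Notation D := (dom M).
Implicit Types (x y z : D) (l : seq D).

Lemma ax_fun n (f : prf n) p : List.In p (fun_axioms f) -> forall rho eta, @msat M rho eta p.
Proof.
move=> Hp rho eta; have H : ACA0 (closure p) by left; exists n, f, p.
by have /msat_closure := aca_ax H rho (fun _ => set0M M).
Qed.

Lemma fi_PP n (i : 'I_n) (v : 'I_n -> D) : fi (PP i) v = v i.
Proof.
pose rho j := if (insub j : option 'I_n) is Some o then v o else mz.
have Hr (k : 'I_n) : rho k = v k by rewrite /rho valK.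
have := @ax_fun _ (PP i) _ (or_introl erefl) rho (fun _ => set0M M).
rewrite /= mt_var Hr => <-; rewrite mt_app; congr fi.
by apply: functional_extensionality => k; rewrite -Hr.
Qed.

Lemma fi_PC k n (g : prf k) (hs : 'I_k -> prf n) (v : 'I_n -> D) :
  fi (PC g hs) v = fi g (fun j => fi (hs j) v).
Proof.
pose rho j := if (insub j : option 'I_n) is Some o then v o else mz.
have Hr : (fun i : 'I_n => rho i) = v by apply: functional_extensionality => i; rewrite /rho valK.
have /= := @ax_fun _ (PC g hs) _ (or_introl erefl) rho (fun _ => set0M M).
rewrite !mt_app.
have -> : (fun i => mteval rho (tvars 0 i)) = v by rewrite -Hr.
by move=> ->; congr fi; apply: functional_extensionality => j; rewrite mt_app -Hr.
Qed.

Lemma ap_lam n t l : size l = n -> ap (lam n t) l = mteval (nth mz l) t.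
Proof.
move=> Hl; elim: t => [i|k f a IH] /=.
  case: insubP => [o Ho Eo|Hi]; first by rewrite /ap fi_PP Eo.
  rewrite /ap fi_PC mt_var nth_default; last by rewrite Hl leqNgt.
  by congr fi; exact: ord0_fun.
rewrite {1}/ap fi_PC mt_app; congr fi; apply: functional_extensionality => j; exact: IH.
Qed.

Lemma nth_map_TVar n i0 l (j : 'I_n) :
  mteval (nth mz l) (nth (TVar 0) [seq TVar i | i <- iota i0 n] j) = nth mz l (i0 + j).
Proof. by rewrite (nth_map 0) ?size_iota // nth_iota // mt_var. Qed.

Lemma ap_PR0 n (g : prf n) h l : ap (PR g h) (mz :: l) = ap g l.
Proof.
have /= := @ax_fun _ (PR g h) _ (or_introl erefl) (nth mz l) (fun _ => set0M M).
rewrite !mt_app => E.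
transitivity (fi g (fun i : 'I_n => mteval (nth mz l) (tvars 0 i))); last first.
  by congr fi; apply: functional_extensionality => i; rewrite mt_var.
rewrite -E; congr fi; apply: functional_extensionality => -[[|i] Hi] /=.
  by rewrite /targs /= mt_zero.
rewrite /targs /=; have Hi' : i < n by [].
by rewrite -[i]/(nat_of_ord (Ordinal Hi')) nth_map_TVar.
Qed.

Lemma ap_PRS n (g : prf n) h x l :
  ap (PR g h) (ms x :: l) = ap h (x :: ap (PR g h) (x :: l) :: l).
Proof.
have /= := @ax_fun _ (PR g h) _ (or_intror (or_introl erefl)) (nth mz (x :: l)) (fun _ => set0M M).
rewrite !mt_app => E.
transitivity (fi (PR g h) (fun i : 'I_n.+1 => mteval (nth mz (x :: l))
   (targs (n := n.+1) (tsucc (TVar 0) :: [seq TVar i | i <- iota 1 n]) i))).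
  congr fi; apply: functional_extensionality => -[[|i] Hi] /=.
    by rewrite /targs /= mt_succ.
  rewrite /targs /=; have Hi' : i < n by [].
  by rewrite -[i]/(nat_of_ord (Ordinal Hi')) nth_map_TVar.
rewrite E; congr fi; apply: functional_extensionality => -[[|[|i]] Hi] /=.
- by rewrite /targs /= mt_var.
- rewrite /targs /= mt_app; congr fi.
- rewrite /targs /=; have Hi' : i < n by [].
  by rewrite -[i]/(nat_of_ord (Ordinal Hi')) nth_map_TVar.
Qed.

Lemma rec0 n t0 t1 l : size l = n -> ap (prec_ n t0 t1) (mz :: l) = mteval (nth mz l) t0.
Proof. by move=> H; rewrite ap_PR0 ap_lam. Qed.

Lemma recS n t0 t1 x l : size l = n ->
  ap (prec_ n t0 t1) (ms x :: l) = mteval (nth mz (x :: ap (prec_ n t0 t1) (x :: l) :: l)) t1.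
Proof. by move=> H; rewrite ap_PRS ap_lam //= H. Qed.

Lemma msS_neq x : ms x <> mz.
Proof.
have := @ax_fun _ PS _ (or_introl erefl) (fun _ => x) (fun _ => set0M M).
by rewrite /= mt_succ mt_zero.
Qed.

Lemma ms_inj x y : ms x = ms y -> x = y.
Proof.
have := @ax_fun _ PS _ (or_intror (or_introl erefl)) (nth mz [:: x; y]) (fun _ => set0M M).
by rewrite /= !mt_succ.
Qed.

Lemma comprehend A (pv : A -> nat -> D) pe a P : DF (fun x => mcons x (pv a)) (fun _ => pe a) P ->
  exists X : sets M, forall x, mm x X <-> P x.
Proof.
move=> [q [Hq H]]; have H1 : ACA0 (comprehension q) by right; right; exists q.
have := aca_ax H1 (pv a) (fun _ => set0M M).
rewrite msat_closure => /(_ (pv a) (pe a)) /msat_ex2 [X HX].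
exists X => x; move: (HX x).
by rewrite -/msat msat_iff msat_sshift (H x).
Qed.

Lemma set_ind (X : sets M) : mm mz X -> (forall x, mm x X -> mm (ms x) X) -> forall x, mm x X.
Proof.
move=> H0 HS x.
have H1 : ACA0 induction_ax by right; left.
have H : msat (fun _ => mz) (mcons X (fun _ => set0M M))
    (FAnd (FMem tzero 0) (FAll (FImp (FMem (TVar 0) 0) (FMem (tsucc (TVar 0)) 0)))) ->
    forall y, mm y X := aca_ax H1 (fun _ => mz) (fun _ => set0M M) X.
apply: H; rewrite msat_and; split; first by rewrite /= mt_zero.
by move=> y /=; rewrite mt_succ; exact: HS.
Qed.

Lemma formula_ind rho eta (P : D -> Prop) : DF (fun x => mcons x rho) (fun _ => eta) P ->
  P mz -> (forall x, P x -> P (ms x)) -> forall x, P x.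
Proof.
move=> HP H0 HS x.
have [X HX] := @comprehend unit (fun _ => rho) (fun _ => eta) tt P HP.
by apply/HX; apply: set_ind => [|y /HX]; [exact/HX|move=> /HS /HX].
Qed.

Lemma formula_set rho eta (P : D -> Prop) : DF (fun x => mcons x rho) (fun _ => eta) P ->
  exists X : sets M, forall x, mm x X <-> P x.
Proof. exact: (@comprehend unit (fun _ => rho) (fun _ => eta) tt P). Qed.

End Aca.

(* Induction in M; all elements and sets in the context serve as parameters. *)
Ltac mind M :=
  let ps := collect (dom M) (@nil (dom M)) in
  let Xs := collect (sets M) (@nil (sets M)) in
  match goal with |- forall x, @?P x =>
    apply (@formula_ind M (nth mz ps) (nth (set0M M) Xs) P); [dsolve | | ] end; cbv beta.

Ltac mset M P :=
  let ps := collect (dom M) (@nil (dom M)) in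
  let Xs := collect (sets M) (@nil (sets M)) in
  let H := fresh in
  assert (H : exists X : sets M, forall x, mm x X <-> P x); [
    apply (@formula_set M (nth mz ps) (nth (set0M M) Xs) P); dsolve | cbv beta in H; move: H ].

(** * Arithmetic in a model of ACA_0 *)

Definition pAdd : prf 2 := prec_ 1 (TVar 0) (tsucc (TVar 1)).
Definition pPred : prf 1 := prec_ 0 tzero (TVar 0).
(* Arguments in the order (subtrahend, minuend). *)
Definition pSub : prf 2 := prec_ 1 (TVar 0) (TT pPred [:: TVar 1]).
Definition pIsz : prf 1 := prec_ 0 (tsucc tzero) tzero.
Definition pIte : prf 3 := prec_ 2 (TVar 1) (TVar 2).

Fact tkey : unit. Proof. exact: tt. Qed.
(* Locked, so that rewriting with one connective does not see through another. *)
Definition tnot : term -> term := locked_with tkey (fun a => TT pIsz [:: a]).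
Definition tor : term -> term -> term := locked_with tkey (fun a b => TT pAdd [:: a; b]).
Definition tand : term -> term -> term := locked_with tkey (fun a b => tnot (tor (tnot a) (tnot b))).
Definition timp : term -> term -> term := locked_with tkey (fun a b => tor (tnot a) b).
Definition tle : term -> term -> term := locked_with tkey (fun a b => tnot (TT pSub [:: b; a])).
Definition tlt : term -> term -> term := locked_with tkey (fun a b => tle (tsucc a) b).
Definition teq : term -> term -> term := locked_with tkey (fun a b => tand (tle a b) (tle b a)).

(** The value stays at the first witness once it is reached and otherwise moves on; without a
    witness it ends at the bound. Testing [c] at this value therefore decides the bounded
    existential, which is [tbex]. *)
Definition pBmin n (c : prf n.+1) : prf n.+1 :=
  prec_ n tzero (TT pIte [:: TT c (TVar 1 :: [seq TVar i | i <- iota 2 n]); TVar 1; tsucc (TVar 0)]).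
Definition tmin n (c : prf n.+1) b ps := TT (pBmin c) (b :: ps).
Definition tbex n (c : prf n.+1) b ps := TT c (tmin c b ps :: ps).

Notation madd x y := (ap pAdd [:: x; y]).
Notation tru x := (x <> mz).

Definition mle (M : model) (x y : dom M) := exists z, madd x z = y.
Notation mlt x y := (mle (ms x) y).

Ltac dunf ::= unfold mle.

Section Arith.
Variable M : aca_model.
Local Notation D := (dom M).
Implicit Types (x y z i j k : D) (l : seq D) (rho : nat -> D).

Lemma add0x y : madd mz y = y.
Proof. by rewrite rec0. Qed.

Lemma addSx x y : madd (ms x) y = ms (madd x y).
Proof. by rewrite recS // mt_succ. Qed.

Lemma addx0 x : madd x mz = x.
Proof.
move: x; mind M; first by rewrite !add0x.
by move=> x IH; rewrite !addSx IH.
Qed.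

Lemma addxS x y : madd x (ms y) = ms (madd x y).
Proof.
move: x; mind M; first by rewrite !add0x.
by move=> x IH; rewrite !addSx IH.
Qed.

Lemma maddC x y : madd x y = madd y x.
Proof.
move: x; mind M; first by rewrite add0x addx0.
by move=> x IH; rewrite addSx addxS IH.
Qed.

Lemma maddA x y z : madd x (madd y z) = madd (madd x y) z.
Proof.
move: x; mind M; first by rewrite !add0x.
by move=> x IH; rewrite !addSx IH.
Qed.

Lemma maddI x y z : madd x y = madd x z -> y = z.
Proof.
move: x; mind M; first by rewrite !add0x.
by move=> x IH; rewrite !addSx => /ms_inj.
Qed.

Lemma mcases x : x = mz \/ exists y, x = ms y.
Proof.
move: x; mind M; first by left.
by move=> x _; right; exists x.
Qed.

Lemma le0x x : mle mz x.
Proof. by exists x; rewrite add0x. Qed.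

Lemma le_refl x : mle x x.
Proof. by exists mz; rewrite addx0. Qed.

Lemma le_trans y x z : mle x y -> mle y z -> mle x z.
Proof. by move=> [u <-] [v <-]; exists (madd u v); rewrite maddA. Qed.

Lemma leSS x y : mle (ms x) (ms y) <-> mle x y.
Proof.
by split=> -[u]; rewrite ?addSx => H; exists u; rewrite ?addSx ?H //; exact: ms_inj.
Qed.

Lemma leS0 x : ~ mle (ms x) mz.
Proof. by move=> [u]; rewrite addSx => /msS_neq. Qed.

Lemma le_S x : mle x (ms x).
Proof. by exists (ms mz); rewrite addxS addx0. Qed.

Lemma lex0 x : mle x mz -> x = mz.
Proof. by case: (mcases x) => [->|[y ->]] // /leS0. Qed.

Lemma le_addl x y : mle x (madd x y).
Proof. by exists y. Qed.

Lemma le_addr x y : mle y (madd x y).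
Proof. by exists x; rewrite maddC. Qed.

Lemma lt_irrefl x : ~ mlt x x.
Proof.
by case=> z; rewrite addSx -addxS -{2}(addx0 x) => /maddI /msS_neq.
Qed.

Lemma lt_le x y : mlt x y -> mle x y.
Proof. exact: le_trans (le_S x). Qed.

Lemma lt_le_trans y x z : mlt x y -> mle y z -> mlt x z.
Proof. exact: le_trans. Qed.

Lemma lt_trans y x z : mlt x y -> mlt y z -> mlt x z.
Proof. by move=> H /lt_le; exact: le_trans. Qed.

Lemma le_or_lt x y : mle x y \/ mlt y x.
Proof.
move: x y; mind M; first by move=> y; left; exact: le0x.
move=> x IH y; case: (mcases y) => [->|[z ->]]; first by right; rewrite leSS; exact: le0x.
by rewrite !leSS.
Qed.

Lemma le_eqlt x y : mle x y -> x = y \/ mlt x y.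
Proof.
case=> z <-; case: (mcases z) => [->|[u ->]]; first by left; rewrite addx0.
by right; rewrite addxS leSS; exact: le_addl.
Qed.

Lemma le_anti x y : mle x y -> mle y x -> x = y.
Proof. by move=> /le_eqlt [] // H1 H2; case: (lt_irrefl (lt_le_trans H1 H2)). Qed.

Lemma trichotomy x y : [\/ x = y, mlt x y | mlt y x].
Proof.
case: (le_or_lt x y) => [/le_eqlt [|]|] H; [exact: Or31|exact: Or32|exact: Or33].
Qed.

Lemma lt_neq x y : mlt x y -> x <> y.
Proof. by move=> H E; subst; exact: lt_irrefl H. Qed.

Lemma add_le x x' y y' : mle x x' -> mle y y' -> mle (madd x y) (madd x' y').
Proof.
move=> [u <-] [v <-]; exists (madd u v).
by rewrite -!maddA; congr (ap _ [:: _; _]); rewrite !maddA (maddC y).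
Qed.

Lemma tru_not rho a : tru (mteval rho (tnot a)) <-> ~ tru (mteval rho a).
Proof.
rewrite [tnot]unlock mt_TT //=; case: (mcases (mteval rho a)) => [->|[y ->]].
  by rewrite rec0 // mt_succ mt_zero; split=> _; [apply|exact: msS_neq].
by rewrite recS // mt_zero; split=> // H; case: H; exact: msS_neq.
Qed.

Lemma add_eq0 x y : madd x y = mz <-> x = mz /\ y = mz.
Proof.
split=> [|[-> ->]]; last by rewrite add0x.
case: (mcases x) => [->|[z ->]]; first by rewrite add0x.
by rewrite addSx => /msS_neq.
Qed.

Lemma tru_or rho a b : tru (mteval rho (tor a b)) <-> tru (mteval rho a) \/ tru (mteval rho b).
Proof.
rewrite [tor]unlock mt_TT //= add_eq0.
by case: (classic (mteval rho a = mz)); tauto.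
Qed.

Lemma tru_and rho a b : tru (mteval rho (tand a b)) <-> tru (mteval rho a) /\ tru (mteval rho b).
Proof. rewrite [tand]unlock tru_not tru_or !tru_not; tauto. Qed.

Lemma tru_imp rho a b : tru (mteval rho (timp a b)) <-> (tru (mteval rho a) -> tru (mteval rho b)).
Proof. rewrite [timp]unlock tru_or !tru_not; tauto. Qed.

Lemma predS x : ap pPred [:: ms x] = x.
Proof. by rewrite recS. Qed.

Lemma subx0 x : ap pSub [:: mz; x] = x.
Proof. by rewrite rec0. Qed.

Lemma subSx y x : ap pSub [:: ms y; x] = ap pPred [:: ap pSub [:: y; x]].
Proof. by rewrite recS // mt_TT. Qed.

Lemma sub0 y : ap pSub [:: y; mz] = mz.
Proof.
move: y; mind M; first by rewrite subx0.
by move=> y IH; rewrite subSx IH rec0 // mt_zero.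
Qed.

Lemma subSS y x : ap pSub [:: ms y; ms x] = ap pSub [:: y; x].
Proof.
move: y; mind M; first by rewrite subSx !subx0 predS.
by move=> y IH; rewrite subSx IH -subSx.
Qed.

Lemma sub_eq0 y x : ap pSub [:: y; x] = mz <-> mle x y.
Proof.
move: y x; mind M.
  move=> x; rewrite subx0; split=> [->|]; [exact: le_refl|exact: lex0].
move=> y IH x; case: (mcases x) => [->|[z ->]].
  by rewrite sub0; split=> // _; exact: le0x.
by rewrite subSS IH leSS.
Qed.

Lemma tru_le rho a b : tru (mteval rho (tle a b)) <-> mle (mteval rho a) (mteval rho b).
Proof. by rewrite [tle]unlock tru_not mt_TT //= sub_eq0; tauto. Qed.

Lemma tru_lt rho a b : tru (mteval rho (tlt a b)) <-> mlt (mteval rho a) (mteval rho b).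
Proof. by rewrite [tlt]unlock tru_le mt_succ. Qed.

Lemma tru_eq rho a b : tru (mteval rho (teq a b)) <-> mteval rho a = mteval rho b.
Proof.
rewrite [teq]unlock tru_and !tru_le; split=> [[]|->]; first exact: le_anti.
by split; exact: le_refl.
Qed.

Lemma ite0 x y : ap pIte [:: mz; x; y] = y.
Proof. by rewrite rec0. Qed.

Lemma iteS z x y : tru z -> ap pIte [:: z; x; y] = x.
Proof. by case: (mcases z) => [->|[u ->]] // _; rewrite recS. Qed.

Lemma bmin0 n (c : prf n.+1) l : size l = n -> ap (pBmin c) (mz :: l) = mz.
Proof. by move=> H; rewrite rec0 // mt_zero. Qed.

Lemma bminS n (c : prf n.+1) l k : size l = n -> ap (pBmin c) (ms k :: l) =
  ap pIte [:: ap c (ap (pBmin c) (k :: l) :: l); ap (pBmin c) (k :: l); ms k].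
Proof.
move=> H; rewrite {1}/pBmin recS // -/(pBmin c) mt_TT //= mt_succ !mt_var /=.
rewrite mt_TT /= ?size_map ?size_iota // mt_var /=.
congr (ap pIte [:: ap c (_ :: _); _; _]).
apply: (@eq_from_nth _ mz); rewrite !size_map size_iota // => i Hi.
by rewrite (nth_map (TVar 0)) ?size_map ?size_iota // (nth_map 0) ?size_iota // nth_iota.
Qed.

Lemma bminP n (c : prf n.+1) l : size l = n -> forall k,
  [/\ mle (ap (pBmin c) (k :: l)) k,
      (forall i, mlt i (ap (pBmin c) (k :: l)) -> ap c (i :: l) = mz) &
      tru (ap c (ap (pBmin c) (k :: l) :: l)) \/ ap (pBmin c) (k :: l) = k].
Proof.
move=> Hl.
suff H k : mle (ap (pBmin c) (k :: l)) k /\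
  (forall i, mlt i (ap (pBmin c) (k :: l)) -> ap c (i :: l) = mz) /\
  (tru (ap c (ap (pBmin c) (k :: l) :: l)) \/ ap (pBmin c) (k :: l) = k).
  by move=> k; case: (H k) => ? [].
move: k; apply: (@formula_ind M (nth mz l) (fun _ => set0M M)); first by dsolve.
  rewrite bmin0 //; split; first exact: le_refl.
  by split=> [i /leS0|]; last right.
move=> k [H1 [H2 H3]]; rewrite bminS //.
case: (classic (ap c (ap (pBmin c) (k :: l) :: l) = mz)) => Hc; last first.
  by rewrite (iteS _ _ Hc); split; [exact: le_trans H1 (le_S k)|split; [|left]].
rewrite Hc ite0; case: H3 => // H3; rewrite H3 in H2 Hc.
split; first exact: le_refl.
split; last by right.
by move=> i /leSS/le_eqlt [->|/H2].
Qed.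

Lemma bmin_find n (c : prf n.+1) l k i : size l = n -> mle i k -> tru (ap c (i :: l)) ->
  tru (ap c (ap (pBmin c) (k :: l) :: l)).
Proof.
move=> Hl Hi Hc; case: (bminP c Hl k) => H1 H2 [|E] //.
rewrite E in H2 *; case: (le_eqlt Hi) => [<- //|/H2 H].
by case: Hc.
Qed.

Lemma bex_iff n (c : prf n.+1) l k : size l = n ->
  tru (ap c (ap (pBmin c) (k :: l) :: l)) <-> exists i, mle i k /\ tru (ap c (i :: l)).
Proof.
move=> Hl; split=> [H|[i [Hi Hc]]]; last exact: bmin_find Hi Hc.
by exists (ap (pBmin c) (k :: l)); case: (bminP c Hl k).
Qed.

Lemma mt_min n (c : prf n.+1) rho b ps : size ps = n ->
  mteval rho (tmin c b ps) = ap (pBmin c) (mteval rho b :: [seq mteval rho t | t <- ps]).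
Proof. by move=> H; rewrite /tmin mt_TT /= ?H. Qed.

Lemma tru_bex n (c : prf n.+1) rho b ps : size ps = n ->
  tru (mteval rho (tbex c b ps)) <->
  exists i, mle i (mteval rho b) /\ tru (ap c (i :: [seq mteval rho t | t <- ps])).
Proof.
move=> H; rewrite /tbex mt_TT /= ?H // mt_min // bex_iff ?size_map //.
Qed.

End Arith.

(** * Coded sequences and the Kleene-Brouwer order *)

Definition pTri : prf 1 := prec_ 0 tzero (tsucc (TT pAdd [:: TVar 0; TVar 1])).
(** Cantor pairing plus one: 0 is the empty sequence and every number codes exactly one sequence.
    The newest entry is the head, so initial segments of a tree node are the tails of its code. *)
Definition pCons : prf 2 := lam 2 (tsucc (TT pAdd
  [:: TT pTri [:: TT pAdd [:: TVar 0; TVar 1]]; TVar 0])).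
Definition cHd2 : prf 3 := lam 3 (teq (TT pCons [:: TVar 1; TVar 0]) (TVar 2)).
Definition cHd : prf 2 := lam 2 (tbex cHd2 (TVar 1) [:: TVar 0; TVar 1]).
Definition pHd : prf 1 := lam 1 (tmin cHd (TVar 0) [:: TVar 0]).
Definition cTl2 : prf 3 := lam 3 (teq (TT pCons [:: TVar 0; TVar 1]) (TVar 2)).
Definition cTl : prf 2 := lam 2 (tbex cTl2 (TVar 1) [:: TVar 0; TVar 1]).
Definition pTl : prf 1 := lam 1 (tmin cTl (TVar 0) [:: TVar 0]).
Definition pDrop : prf 2 := prec_ 1 (TVar 0) (TT pTl [:: TVar 1]).
Definition cLen : prf 2 := lam 2 (teq (TT pDrop [:: TVar 0; TVar 1]) tzero).
Definition pLen : prf 1 := lam 1 (tmin cLen (TVar 0) [:: TVar 0]).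
Definition cE : prf 3 := lam 3 (teq (TT pDrop [:: TVar 0; TVar 1]) (TVar 2)).
Definition tE s t := tbex cE s [:: s; t].
Definition cL2 : prf 4 := lam 4 (tand (tand (tE (TVar 2) (TVar 1)) (tE (TVar 3) (TVar 0)))
  (tand (tand (tlt tzero (TVar 0)) (tlt tzero (TVar 1)))
     (tand (teq (TT pTl [:: TVar 0]) (TT pTl [:: TVar 1]))
           (tlt (TT pHd [:: TVar 1]) (TT pHd [:: TVar 0]))))).
Definition cL : prf 3 := lam 3 (tbex cL2 (TVar 2) [:: TVar 0; TVar 1; TVar 2]).
Definition tL s t := tbex cL s [:: s; t].
Definition tKB s t := tor (tL s t) (tand (tnot (teq s t)) (tE s t)).
Definition cLook : prf 3 := lam 3 (teq (TT pLen [:: TT pDrop [:: TVar 0; TVar 1]]) (tsucc (TVar 2))).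
(** Positions are counted from the root: the tail of length [j + 1] has entry number [j] at its
    head. The result is raised by one so that 0 can mean that the sequence is too short. *)
Definition tLook s j := let u := TT pDrop [:: tmin cLook s [:: s; j]; s] in
  TT pIte [:: teq (TT pLen [:: u]) (tsucc j); tsucc (TT pHd [:: u]); tzero].
Definition pLook : prf 2 := lam 2 (tLook (TVar 0) (TVar 1)).

Notation mtri x := (ap pTri [:: x]).
Notation ccons a s := (ap pCons [:: a; s]).
Notation hd s := (ap pHd [:: s]).
Notation tl s := (ap pTl [:: s]).
Notation mdrop i s := (ap pDrop [:: i; s]).
Notation len s := (ap pLen [:: s]).
Notation look s j := (ap pLook [:: s; j]).

Definition mE (M : model) (s t : dom M) := exists i, mdrop i s = t.
(** [s] branches off to the left of [t] directly after the common stem [v]. *)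
Definition mL (M : model) (s t : dom M) :=
  exists v a b, mE s (ccons a v) /\ mE t (ccons b v) /\ mlt a b.
Definition mKB (M : model) (s t : dom M) := mL s t \/ (s <> t /\ mE s t).

Ltac dunf ::= unfold mKB, mL, mE, mle.

Section Lists.
Variable M : aca_model.
Local Notation D := (dom M).
Implicit Types (x y z i j k a b s t u v : D) (l : seq D) (rho : nat -> D).

Lemma tri0 : mtri mz = mz :> D.
Proof. by rewrite rec0 // mt_zero. Qed.

Lemma triS x : mtri (ms x) = ms (madd x (mtri x)).
Proof. by rewrite recS // mt_succ mt_TT. Qed.

Lemma tri_ge x : mle x (mtri x).
Proof.
case: (mcases x) => [->|[y ->]]; first exact: le0x.
by rewrite triS leSS; exact: le_addl.
Qed.

Lemma tri_mono x y : mle x y -> mle (mtri x) (mtri y).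
Proof.
case=> z <-; move: z; mind M; first by rewrite addx0; exact: le_refl.
move=> z IH; rewrite addxS triS; apply: le_trans IH _.
apply: le_trans (le_S _) _; rewrite leSS; exact: le_addr.
Qed.

Lemma consE a s : ccons a s = ms (madd (mtri (madd a s)) a).
Proof. by rewrite ap_lam // mt_succ !mt_TT //= !mt_TT //= mt_TT. Qed.

Lemma cons_neq0 a s : ccons a s <> mz.
Proof. by rewrite consE; exact: msS_neq. Qed.

(** The successor moves along a diagonal from [(a, u + 1)] to [(a + 1, u)], and from its end
    [(a, 0)] to the start [(0, a + 1)] of the next one. *)
Lemma cons_surj s : s = mz \/ exists a t, s = ccons a t.
Proof.
case: (mcases s) => [->|[x ->]]; [by left|right].
move: x; mind M.
  by exists mz, mz; rewrite consE !addx0 tri0.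
move=> x [a [t E]]; rewrite E; case: (mcases t) => [->|[u ->]].
  by exists mz, (ms a); rewrite !consE add0x !addx0 triS (maddC a).
by exists (ms a), u; rewrite !consE addSx !addxS.
Qed.

Lemma cons_inj a s b t : ccons a s = ccons b t -> a = b /\ s = t.
Proof.
rewrite !consE => /ms_inj.
(* The next triangular number exceeds every code on the present diagonal, so equal codes lie on the
   same diagonal. *)
have aux a' s' b' t' : mlt (madd a' s') (madd b' t') ->
    madd (mtri (madd a' s')) a' <> madd (mtri (madd b' t')) b' :> D.
  move=> /tri_mono; rewrite triS => H; apply: lt_neq; apply: lt_le_trans (le_addl _ _).
  apply: le_trans H; rewrite leSS maddC; apply: add_le; [exact: le_addl|exact: le_refl].
case: (trichotomy (madd a s) (madd b t)) => [E H|/aux //|/aux H /esym //].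
rewrite E in H; have {}H := maddI H; rewrite H in E *.
by split=> //; exact: maddI E.
Qed.

Lemma lt_cons_hd a s : mlt a (ccons a s).
Proof. by rewrite consE leSS; exact: le_addr. Qed.

Lemma lt_cons_tl a s : mlt s (ccons a s).
Proof.
rewrite consE leSS; apply: le_trans (le_addl _ _).
by apply: le_trans (tri_ge _); exact: le_addr.
Qed.

Lemma hdE a s : hd (ccons a s) = a.
Proof.
rewrite ap_lam // mt_min //= !mt_var /=.
have cP x : tru (ap cHd [:: x; ccons a s]) <-> x = a.
  rewrite ap_lam // tru_bex //=; split=> [[i [_]]|->].
    rewrite ap_lam // tru_eq mt_TT //= !mt_var /=.
    by case/cons_inj.
  exists s; split; first exact/lt_le/lt_cons_tl.
  by rewrite ap_lam // tru_eq mt_TT.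
by apply/cP; apply: (@bmin_find _ _ _ _ _ a) => //; [exact/lt_le/lt_cons_hd|exact/cP].
Qed.

Lemma tlE a s : tl (ccons a s) = s.
Proof.
rewrite ap_lam // mt_min //= !mt_var /=.
have cP x : tru (ap cTl [:: x; ccons a s]) <-> x = s.
  rewrite ap_lam // tru_bex //=; split=> [[i [_]]|->].
    rewrite ap_lam // tru_eq mt_TT //= !mt_var /=.
    by case/cons_inj.
  exists a; split; first exact/lt_le/lt_cons_hd.
  by rewrite ap_lam // tru_eq mt_TT.
by apply/cP; apply: (@bmin_find _ _ _ _ _ s) => //; [exact/lt_le/lt_cons_tl|exact/cP].
Qed.

Lemma tl0 : tl mz = mz :> D.
Proof. by rewrite ap_lam // mt_min //= !mt_var /= bmin0. Qed.

Lemma drop0 s : mdrop mz s = s.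
Proof. by rewrite rec0. Qed.

Lemma dropS i s : mdrop (ms i) s = tl (mdrop i s).
Proof. by rewrite recS // mt_TT. Qed.

Lemma dropS_tl i s : mdrop (ms i) s = mdrop i (tl s).
Proof.
move: i; mind M; first by rewrite dropS !drop0.
by move=> i IH; rewrite dropS IH -dropS.
Qed.

Lemma dropS_cons i a s : mdrop (ms i) (ccons a s) = mdrop i s.
Proof. by rewrite dropS_tl tlE. Qed.

Lemma drop_nil i : mdrop i mz = mz.
Proof.
move: i; mind M; first by rewrite drop0.
by move=> i IH; rewrite dropS_tl tl0.
Qed.

Lemma drop_add i j s : mdrop (madd i j) s = mdrop i (mdrop j s).
Proof.
move: i; mind M; first by rewrite drop0 add0x.
by move=> i IH; rewrite addSx !dropS IH.
Qed.

Lemma drop_large n s : mle s n -> mdrop n s = mz.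
Proof.
move: n s; mind M; first by move=> s /lex0 ->; exact: drop_nil.
move=> n IH s; case: (cons_surj s) => [->|[a [t ->]]]; first by rewrite drop_nil.
move=> H; rewrite dropS_cons; apply: IH.
by rewrite -leSS; apply: le_trans (lt_cons_tl a t) H.
Qed.

Lemma strong_ind (X : sets M) : (forall x, (forall y, mlt y x -> mm y X) -> mm x X) -> forall x, mm x X.
Proof.
move=> H x; apply: (H); move: x; mind M; first by move=> y /leS0.
by move=> x IH y; rewrite leSS => /le_eqlt [->|]; [exact: H|exact: IH].
Qed.

Lemma least (X : sets M) : (exists x, mm x X) -> exists x, mm x X /\ forall y, mm y X -> mle x y.
Proof.
move=> [x0 Hx0]; apply: NNPP => Hn.
mset M (fun x => ~ mm x X) => -[Y HY].
suff : mm x0 Y by rewrite HY.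
apply: strong_ind => x H; rewrite HY => Hx; apply: Hn; exists x; split=> // y Hy.
by case: (le_or_lt x y) => // /H; rewrite HY.
Qed.

Lemma list_ind rho eta (P : D -> Prop) : DF (fun x => mcons x rho) (fun _ => eta) P ->
  P mz -> (forall a s, P s -> P (ccons a s)) -> forall s, P s.
Proof.
move=> HP H0 HS s; have [X HX] := formula_set HP; apply/HX; apply: strong_ind => x H.
case: (cons_surj x) => [->|[a [t E]]]; first exact/HX.
by apply/HX; rewrite E; apply: HS; apply/HX; apply: H; rewrite E; exact: lt_cons_tl.
Qed.

End Lists.

Ltac mlind M :=
  let ps := collect (dom M) (@nil (dom M)) in
  let Xs := collect (sets M) (@nil (sets M)) in
  match goal with |- forall x, @?P x =>
    apply (@list_ind M (nth mz ps) (nth (set0M M) Xs) P); [dsolve | | ] end; cbv beta.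

Section Lists2.
Variable M : aca_model.
Local Notation D := (dom M).
Implicit Types (x y z i j k a b s t u v : D) (l : seq D) (rho : nat -> D).

Lemma cLenP i s : tru (ap cLen [:: i; s]) <-> mdrop i s = mz.
Proof. by rewrite ap_lam // tru_eq mt_TT //= !mt_var mt_zero. Qed.

Lemma lenP s : mdrop (len s) s = mz /\ (forall i, mlt i (len s) -> mdrop i s <> mz) /\ mle (len s) s.
Proof.
rewrite ap_lam // mt_min //= !mt_var /=; split; [|split].
- apply/cLenP; apply: (@bmin_find _ _ _ _ _ s) (le_refl s) _ => //.
  by apply/cLenP; apply: drop_large; exact: le_refl.
- by move=> i; case: (@bminP M 1 cLen [:: s] erefl s) => _ H _ /H H1; rewrite -cLenP; apply.
- by case: (@bminP M 1 cLen [:: s] erefl s).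
Qed.

Lemma len_unique s k : mdrop k s = mz -> (forall i, mlt i k -> mdrop i s <> mz) -> len s = k.
Proof.
move=> H1 H2; have [H3 [H4 _]] := lenP s.
by case: (trichotomy (len s) k) => // [/H2|/H4].
Qed.

Lemma len0 : len mz = mz :> D.
Proof. by apply: len_unique => [|i /leS0 //]; exact: drop0. Qed.

Lemma lenS a s : len (ccons a s) = ms (len s).
Proof.
have [H1 [H2 _]] := lenP s.
apply: len_unique => [|i]; first by rewrite dropS_cons.
case: (mcases i) => [->|[j ->]]; first by rewrite drop0 => _; exact: cons_neq0.
by rewrite leSS dropS_cons; exact: H2.
Qed.

Lemma len_le s : mle (len s) s.
Proof. by case: (lenP s) => _ []. Qed.

Lemma E_refl s : mE s s.
Proof. by exists mz; rewrite drop0. Qed.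

Lemma E_trans t s u : mE s t -> mE t u -> mE s u.
Proof. by move=> [i <-] [j <-]; exists (madd j i); rewrite drop_add. Qed.

Lemma E_nil s : mE s mz.
Proof. by exists s; apply: drop_large; exact: le_refl. Qed.

Lemma nil_E t : mE mz t -> t = mz.
Proof. by case=> i; rewrite drop_nil. Qed.

Lemma cons_E a s t : mE (ccons a s) t <-> t = ccons a s \/ mE s t.
Proof.
split=> [[i]|[->|[i <-]]]; last by exists (ms i); rewrite dropS_cons.
  case: (mcases i) => [->|[j ->]]; rewrite ?drop0 ?dropS_cons => <-; first by left.
  by right; exists j.
exact: E_refl.
Qed.

Lemma E_cons a s : mE (ccons a s) s.
Proof. by apply/cons_E; right; exact: E_refl. Qed.

Lemma E_len s t : mE s t -> t = s \/ mlt (len t) (len s).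
Proof.
move: s t; mlind M; first by move=> t /nil_E ->; left.
move=> a s IH t /cons_E [->|/IH [->|H]]; [by left|right|right]; rewrite lenS leSS.
  exact: le_refl.
exact: lt_le.
Qed.

Lemma E_linear s t u : mE s t -> mE s u -> mE t u \/ mE u t.
Proof.
move=> [i <-] [j <-]; case: (le_or_lt i j) => [|/lt_le] [z <-]; [left|right];
by exists z; rewrite maddC drop_add.
Qed.

Lemma E_same_len s t u : mE s t -> mE s u -> len t = len u -> t = u.
Proof.
move=> H1 H2 E; case: (E_linear H1 H2) => /E_len []; rewrite ?E // => /lt_irrefl //.
Qed.

Lemma E_anti s t : mE s t -> mE t s -> s = t.
Proof. by move=> /E_len [//|H1] /E_len [//|H2]; case: (lt_irrefl (lt_trans H1 H2)). Qed.

Lemma E_proper s t : mE s t -> s <> t -> exists b, mE s (ccons b t).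
Proof.
move: s t; mlind M; first by move=> t /nil_E ->.
move=> a s IH t /cons_E [-> //|H] _.
case: (classic (s = t)) => [->|/(IH _ H) [b Hb]]; first by exists a; exact: E_refl.
by exists b; apply/cons_E; right.
Qed.

Lemma cons_neq a s : ccons a s <> s.
Proof. by move/esym; apply: lt_neq; exact: lt_cons_tl. Qed.

Lemma len_lt_neq s t : mE s (ccons t s) -> False.
Proof.
move=> /E_len []; first by exact: cons_neq.
by rewrite lenS => /lt_le /lt_irrefl.
Qed.

Lemma E_cons_inj s a b v : mE s (ccons a v) -> mE s (ccons b v) -> a = b.
Proof.
by move=> H1 H2; case: (@cons_inj M a v b v) => //; apply: E_same_len H1 H2 _; rewrite !lenS.
Qed.

Lemma E_le s t : mE s t -> mle t s.
Proof.
move: s t; mlind M; first by move=> t /nil_E ->; exact: le_refl.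
move=> a s IH t /cons_E [->|/IH H]; first exact: le_refl.
by apply: le_trans H _; exact/lt_le/lt_cons_tl.
Qed.

Lemma KB_total s t : [\/ s = t, mKB s t | mKB t s].
Proof.
(* Comparability by extension or branching is a better induction hypothesis, as it carries no
   inequality. *)
suff H : mE s t \/ mE t s \/ mL s t \/ mL t s.
  case: (classic (s = t)) => Est; first exact: Or31.
  case: H => [H|[H|[H|H]]];
    [apply: Or32; right|apply: Or33; right; split=> //; exact: nesym
    |apply: Or32; left|apply: Or33; left] => //.
move: s; mlind M; first by right; left; exact: E_nil.
have LE a s' u v : mL s' u -> mL (ccons a s') u /\ (mL u s' -> mL u (ccons a s')).
  move=> [w [x [y [H1 [H2 H3]]]]]; split.
    by exists w, x, y; split=> //; apply/cons_E; right.
  move=> [w' [x' [y' [H1' [H2' H3']]]]]; exists w', x', y'; split=> //; split=> //.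
  by apply/cons_E; right.
move=> a s [H|[H|[H|H]]].
- by left; apply/cons_E; right.
- case: (classic (t = s)) => [->|/(E_proper H) [b Hb]]; first by left; exact: E_cons.
  case: (trichotomy a b) => [E|lt|lt].
  + by right; left; rewrite E.
  + by right; right; left; exists s, a, b; split; [exact: E_refl|].
  + by right; right; right; exists s, b, a; split; [|split; [exact: E_refl|]].
- by right; right; left; case: (LE a s t t H).
- right; right; right; case: H => w [x [y [H1 [H2 H3]]]]; exists w, x, y; split=> //; split=> //.
  by apply/cons_E; right.
Qed.

Lemma L_irrefl s : ~ mL s s.
Proof.
by move=> [v [a [b [H1 [H2]]]]]; rewrite (E_cons_inj H1 H2) => /lt_irrefl.
Qed.

Lemma KB_irrefl s : ~ mKB s s.
Proof. by case=> [/L_irrefl //|[]]. Qed.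

Lemma L_left s s' t : mE s' s -> mL s t -> mL s' t.
Proof.
by move=> H [v [a [b [H1 [H2 H3]]]]]; exists v, a, b; split; [exact: E_trans H H1|].
Qed.

Lemma KB_trans t s u : mKB s t -> mKB t u -> mKB s u.
Proof.
case=> [Lst|[nst Est]] [Ltu|[ntu Etu]].
- left; case: (Lst) => v [a [b [H1 [H2 H3]]]]; case: (Ltu) => w [c [d [H4 [H5 H6]]]].
  (* The branching closer to the root decides. If both stems have the same length, they coincide
     inside [t] and the entries compose. *)
  case: (trichotomy (len v) (len w)) => [E|lt|lt].
  + have E' : ccons b v = ccons c w by apply: E_same_len H2 H4 _; rewrite !lenS E.
    case: (cons_inj E') => Ebc Evw; subst; exists w, a, d; split=> //; split=> //.
    exact: lt_trans H3 H6.
  + exists v, a, b; split=> //; split=> //; apply: E_trans H5 _; apply/cons_E; right.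
    case: (E_linear H2 (E_trans H4 (E_cons _ _))) => // /E_len [E|]; first by rewrite -E; exact: E_refl.
    by rewrite lenS => H; case: (lt_irrefl (lt_le_trans H lt)).
  + exists w, c, d; split=> //; apply: E_trans H1 _; apply/cons_E; right.
    case: (E_linear H4 (E_trans H2 (E_cons _ _))) => // /E_len [E|]; first by rewrite -E; exact: E_refl.
    by rewrite lenS => H; case: (lt_irrefl (lt_le_trans H lt)).
- case: (Lst) => v [a [b [H1 [H2 H3]]]].
  case: (E_linear H2 Etu) => H; last by left; exists v, a, b.
  case/cons_E: H => [E|H].
    by left; exists v, a, b; rewrite E; split=> //; split=> //; exact: E_refl.
  have Hsu : mE s u by apply: E_trans H1 _; apply/cons_E; right.
  right; split=> // E; rewrite E in H1.
  by apply: (@len_lt_neq v a); exact: E_trans H H1.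
- by left; exact: L_left Ltu.
- right; split; last exact: E_trans Etu.
  by move=> E; subst; apply: nst; exact: E_anti.
Qed.

(** Dropping [s] or more entries from [s] leaves the empty sequence, so a search bounded by [s]
    finds every tail. *)
Lemma tru_E rho (s t : term) : tru (mteval rho (tE s t)) <-> mE (mteval rho s) (mteval rho t).
Proof.
set x := mteval rho s; set y := mteval rho t.
have cP i : tru (ap cE [:: i; x; y]) <-> mdrop i x = y.
  by rewrite ap_lam // tru_eq mt_TT.
rewrite /tE tru_bex //= -/x -/y; split=> [[i [_ /cP H]]|[i H]]; first by exists i.
case: (le_or_lt i x) => Hi; first by exists i; split=> //; exact/cP.
exists x; split; first exact: le_refl.
apply/cP; rewrite -H !drop_large //; [exact: lt_le|exact: le_refl].
Qed.

Lemma tru_L rho (s t : term) : tru (mteval rho (tL s t)) <-> mL (mteval rho s) (mteval rho t).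
Proof.
set x := mteval rho s; set y := mteval rho t.
have c2P w u : tru (ap cL2 [:: w; u; x; y]) <->
    mE x u /\ mE y w /\ w <> mz /\ u <> mz /\ tl w = tl u /\ mlt (hd u) (hd w).
  rewrite ap_lam // !tru_and !tru_E !tru_lt tru_eq !mt_zero !mt_TT //= !mt_var /=.
  have lt0 z : mlt mz z <-> z <> mz.
    case: (mcases z) => [->|[z' ->]]; first by split=> // /leS0.
    by rewrite leSS; split=> _; [exact: msS_neq|exact: le0x].
  rewrite !lt0; tauto.
have cP u : tru (ap cL [:: u; x; y]) <-> exists w, mle w y /\ tru (ap cL2 [:: w; u; x; y]).
  by rewrite ap_lam // tru_bex.
rewrite /tL tru_bex //= -/x -/y; split.
  move=> [u [_ /cP [w [_ /c2P [H1 [H2 [H3 [H4 [H5 H6]]]]]]]]].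
  case: (cons_surj u) H1 H4 H5 H6 => [-> //|[a [v ->]]] H1 _.
  case: (cons_surj w) H2 H3 => [-> //|[b [v' ->]]] H2 _.
  by rewrite !tlE !hdE => E; subst v'; exists v, a, b.
move=> [v [a [b [H1 [H2 H3]]]]]; exists (ccons a v); split; first exact: E_le.
apply/cP; exists (ccons b v); split; first exact: E_le.
by apply/c2P; rewrite !tlE !hdE; do !split => //; exact: cons_neq0.
Qed.

Lemma tru_KB rho (s t : term) : tru (mteval rho (tKB s t)) <-> mKB (mteval rho s) (mteval rho t).
Proof. by rewrite /tKB tru_or tru_L tru_and tru_not tru_eq tru_E. Qed.

Lemma look_iff s j w : look s j = ms w <-> exists v, mE s (ccons w v) /\ len v = j.
Proof.
have cP i : tru (ap cLook [:: i; s; j]) <-> len (mdrop i s) = ms j.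
  by rewrite ap_lam // tru_eq mt_succ !mt_TT //= mt_TT.
rewrite ap_lam // /tLook mt_TT //= mt_succ mt_zero.
set c := mteval _ (teq _ _).
set i := ap (pBmin cLook) [:: s; s; j].
have Hc : tru c <-> len (mdrop i s) = ms j.
  by rewrite tru_eq mt_succ !mt_TT //= mt_TT //= mt_min.
rewrite mt_TT //= mt_TT //= mt_min //= !mt_var /= -/i.
have find v : mE s (ccons w v) -> len v = j -> ccons w v = mdrop i s.
  move=> H Hj; have Hi : tru (ap cLook [:: i; s; j]).
    case: H => k Hk; case: (le_or_lt k s) => [|/lt_le] Hks.
      by apply: (@bmin_find _ _ _ _ _ k) => //; apply/cP; rewrite Hk lenS Hj.
    by rewrite drop_large // in Hk; case: (@cons_neq0 M w v).
  by apply: E_same_len H _ _; [exists i|rewrite lenS Hj; move/cP: Hi].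
case: (classic (tru c)) => [Hc1|/NNPP Hc0].
  rewrite iteS //; move/Hc: Hc1; split.
    move=> /ms_inj <-; case: (cons_surj (mdrop i s)) Hc1 => [->|[a [v E]]].
      by rewrite len0 => /esym /msS_neq.
    rewrite E hdE lenS => /ms_inj Hj; exists v; split=> //.
    by rewrite -E; exists i.
  by move=> [v [H Hj]]; rewrite -(find v) // hdE.
rewrite Hc0 ite0; split=> [/esym /msS_neq //|[v [H Hj]]].
by case: (proj2 Hc) => //; rewrite -(find v) // lenS Hj.
Qed.

End Lists2.

(** * The tree of attempts to refute an arithmetical formula *)

Definition tnum (n : nat) : term := iter n tsucc tzero.
Definition num (M : model) (n : nat) : dom M := iter n (fun x => ms x) mz.
Arguments num {M} n.
Definition env (M : model) (e : dom M) : nat -> dom M := fun i => hd (mdrop (num i) e).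
Definition tenv (e : term) (i : nat) : term := TT pHd [:: TT pDrop [:: tnum i; e]].
Notation key q e := (ccons (num (godel q)) e).

Definition says_true (M : model) (v : dom M) := v = num 1.
Definition says_false (M : model) (v : dom M) := mle (num 2) v.
Definition tT v := teq v (tnum 1).
Definition tF v := tle (tnum 2) v.

(* [lk] is a partial function: value 0 for undefined, 1 for "true", w + 2 for
   "false, with witness w". The FAll clause for truth is stated at the code [e] of
   an environment of the body, whose tail codes the environment of FAll. *)
Fixpoint chk (M : model) (p : formula) (lk : dom M -> dom M) (e : dom M) : Prop :=
  match p with
  | FBot => ~ says_true (lk (key p e))
  | FEq t u =>
      (says_true (lk (key p e)) -> mteval (env e) t = mteval (env e) u) /\
      (says_false (lk (key p e)) -> mteval (env e) t <> mteval (env e) u)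
  | FMem t k =>
      let w := lk (key (FMem (TVar 0) k) (ccons (mteval (env e) t) mz)) in
      (says_true (lk (key p e)) -> ~ says_false w) /\ (says_false (lk (key p e)) -> ~ says_true w)
  | FImp q r =>
      ((says_true (lk (key p e)) -> says_true (lk (key q e)) -> ~ says_false (lk (key r e))) /\
       (says_false (lk (key p e)) -> ~ says_false (lk (key q e)) /\ ~ says_true (lk (key r e)))) /\
      (chk q lk e /\ chk r lk e)
  | FAll q =>
      ((says_true (lk (key p (tl e))) -> ~ says_false (lk (key q e))) /\
       (says_false (lk (key p e)) ->
          ~ says_true (lk (key q (ccons (ap pPred [:: ap pPred [:: lk (key p e)]]) e))))) /\
      chk q lk e
  | FAll2 q => True
  end.

Definition tV (q : formula) (e : term) : term := TT pLook [:: TVar 1; TT pCons [:: tnum (godel q); e]].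

(* variable 0 is the code of the environment, variable 1 the node *)
Fixpoint tchk (p : formula) : term :=
  let v := tV p (TVar 0) in
  match p with
  | FBot => tnot (tT v)
  | FEq t u =>
      let e := teq (tsubst (tenv (TVar 0)) t) (tsubst (tenv (TVar 0)) u) in
      tand (timp (tT v) e) (timp (tF v) (tnot e))
  | FMem t k =>
      let w := tV (FMem (TVar 0) k) (TT pCons [:: tsubst (tenv (TVar 0)) t; tzero]) in
      tand (timp (tT v) (tnot (tF w))) (timp (tF v) (tnot (tT w)))
  | FImp q r =>
      tand (tand (timp (tT v) (timp (tT (tV q (TVar 0))) (tnot (tF (tV r (TVar 0))))))
                 (timp (tF v) (tand (tnot (tF (tV q (TVar 0)))) (tnot (tT (tV r (TVar 0)))))))
           (tand (tchk q) (tchk r))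
  | FAll q =>
      tand (tand (timp (tT (tV p (TT pTl [:: TVar 0]))) (tnot (tF (tV q (TVar 0)))))
                 (timp (tF v) (tnot (tT (tV q (TT pCons [:: TT pPred [:: TT pPred [:: v]]; TVar 0]))))))
           (tchk q)
  | FAll2 q => teq tzero tzero
  end.

(** Checking only environments [e <= s] keeps membership primitive recursive; along an infinite
    branch the nodes grow, so every environment is checked eventually. The first conjunct makes a
    branch an attempt to falsify [r]. *)
Definition mTree (M : model) (r : formula) (s : dom M) :=
  ~ says_true (look s (key r mz)) /\ forall e, mle e s -> chk r (fun k => look s k) e.

Definition cTree (r : formula) : prf 2 := lam 2 (tnot (tchk r)).
Definition tTree (r : formula) (t : term) : term :=
  tand (tnot (tT (TT pLook [:: t; TT pCons [:: tnum (godel r); tzero]])))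
       (tnot (tbex (cTree r) t [:: t])).

Definition treeord (r : formula) : prf 2 :=
  lam 2 (tand (tTree r (TVar 0)) (tand (tTree r (TVar 1)) (tKB (TVar 0) (TVar 1)))).

Section Tree.
Variable M : aca_model.
Local Notation D := (dom M).
Implicit Types (x y z e s t w : D) (rho : nat -> D) (p q r : formula).

Lemma mt_num rho n : mteval rho (tnum n) = num n.
Proof. by elim: n => [|n IH]; rewrite /tnum /= ?mt_zero // mt_succ -/(tnum n) IH. Qed.

Lemma num_inj m n : num m = num n :> D -> m = n.
Proof.
elim: m n => [|m IH] [|n] //=; first by move/esym/msS_neq.
  by move/msS_neq.
by move/ms_inj/IH ->.
Qed.

Lemma key_inj p q e e' : key p e = key q e' -> p = q /\ e = e'.
Proof. by case/cons_inj => /num_inj/godel_inj. Qed.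

Lemma env_cons x e : env (ccons x e) = mcons x (env e).
Proof.
apply: functional_extensionality => -[|i] /=; rewrite /env /=; first by rewrite drop0 hdE.
by rewrite dropS_cons.
Qed.

Lemma env_tl e : env e = mcons (hd e) (env (tl e)).
Proof.
apply: functional_extensionality => -[|i] /=; rewrite /env /=; first by rewrite drop0.
by rewrite dropS_tl.
Qed.

Lemma mt_env rho (t : term) i : mteval rho (tenv t i) = env (mteval rho t) i.
Proof. by rewrite /tenv mt_TT //= mt_TT //= mt_num. Qed.

Lemma tru_T rho (t : term) : tru (mteval rho (tT t)) <-> says_true (mteval rho t).
Proof. by rewrite tru_eq mt_num. Qed.

Lemma tru_F rho (t : term) : tru (mteval rho (tF t)) <-> says_false (mteval rho t).
Proof. by rewrite tru_le mt_num. Qed.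

Lemma mt_V e s q (t : term) : mteval (nth mz [:: e; s]) (tV q t) =
  look s (key q (mteval (nth mz [:: e; s]) t)).
Proof. by rewrite /tV mt_TT //= mt_TT //= mt_num. Qed.

Lemma tru_chk e s p : tru (mteval (nth mz [:: e; s]) (tchk p)) <-> chk p (fun k => look s k) e.
Proof.
have He (t : term) : mteval (nth mz [:: e; s]) (tsubst (tenv (TVar 0)) t) = mteval (env e) t.
  rewrite mteval_subst; congr mteval; apply: functional_extensionality => i.
  by rewrite mt_env.
elim: p => [|t u|t k|p IHp q IHq|p IH|p IH] /=.
- by rewrite tru_not tru_T mt_V.
- by rewrite tru_and !tru_imp tru_not tru_eq tru_T tru_F mt_V !He.
- by rewrite tru_and !tru_imp !tru_not !tru_T !tru_F !mt_V mt_TT //= He mt_zero.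
- by rewrite !tru_and IHp IHq !tru_imp !tru_and !tru_not !tru_T !tru_F !mt_V.
- rewrite !tru_and IH !tru_imp !tru_not !tru_T !tru_F !mt_V.
  rewrite (@mt_TT M _ 1 pTl) // (@mt_TT M _ 2 pCons) //=.
  by rewrite (@mt_TT M _ 1 pPred) //= (@mt_TT M _ 1 pPred) //= mt_V.
- by rewrite tru_eq.
Qed.

Lemma tru_Tree rho r (t : term) : tru (mteval rho (tTree r t)) <-> mTree r (mteval rho t).
Proof.
rewrite tru_and !tru_not tru_T mt_TT //= mt_TT //= mt_num mt_zero tru_bex //=.
have cP e s : tru (ap (cTree r) [:: e; s]) <-> ~ chk r (fun k => look s k) e.
  by rewrite ap_lam // tru_not tru_chk.
split=> -[H1 H2]; split=> //.
  by move=> e He; apply: NNPP => Hn; apply: H2; exists e; split=> //; exact/cP.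
by move=> [e [He /cP]]; apply; exact: H2.
Qed.

Lemma tru_treeord r s t :
  tru (ap (treeord r) [:: s; t]) <-> mTree r s /\ mTree r t /\ mKB s t.
Proof. by rewrite ap_lam // tru_and tru_Tree tru_and tru_Tree tru_KB. Qed.

Lemma says_false_ex (v : D) : says_false v <-> exists x, v = ms (ms x).
Proof.
split=> [[x <-]|[x ->]]; first by exists x; rewrite !addSx add0x.
by rewrite /says_false /= !leSS; exact: le0x.
Qed.

Section Path.
Variable F : D -> D.

Lemma says_true_ms x : says_true (ms x) <-> x = mz.
Proof. by rewrite /says_true /=; split=> [/ms_inj|->]. Qed.

Lemma says_false_ms x : says_false (ms x) <-> x <> mz.
Proof.
rewrite says_false_ex; split=> [[y /ms_inj ->]|]; first exact: msS_neq.
by case: (mcases x) => [->|[y ->]] // _; exists y.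
Qed.

(** The checks are phrased negatively so that undefined labels pass. For a total labelling each
    label is either true or false, the negative clauses become Tarski's equivalences, and the labels
    of the canonical atoms define the sets. *)
Lemma chk_sat (eta : nat -> sets M) p : arithmetical p ->
  (forall k x, mm x (eta k) <-> F (key (FMem (TVar 0) k) (ccons x mz)) = mz) ->
  (forall e, chk p (fun k => ms (F k)) e) ->
  forall e, F (key p e) = mz <-> msat (env e) eta p.
Proof.
move=> + Heta; elim: p => [|t u|t k|p IHp q IHq|p IH|p IH] //= Ha H e.
- by split=> [E|[]]; case: (H e); rewrite says_true_ms.
- case: (H e); rewrite says_true_ms says_false_ms => H1 H2.
  by split=> // E; apply: NNPP => /H2.
- case: (H e); rewrite !says_true_ms !says_false_ms Heta => H1 H2.
  by split=> [/H1/NNPP|E] //; apply: NNPP => /H2.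
- case/andP: Ha => Ha1 Ha2.
  rewrite -IHp // -?IHq // => [|e'|e']; try by case: (H e') => _ [].
  case: (H e) => -[]; rewrite !says_true_ms !says_false_ms => H1 H2 _.
  split=> [E1 E2|E]; first by apply: NNPP; exact: H1.
  by apply: NNPP => /H2 [/NNPP H3 H4]; apply: H4; exact: E.
- have {}IH := IH Ha (fun e' => proj2 (H e')).
  split=> [E x|Hx].
    rewrite -env_cons -IH; case: (H (ccons x e)) => -[].
    by rewrite tlE says_true_ms says_false_ms => /(_ E) /NNPP.
  apply: NNPP; case: (H e) => -[_]; rewrite says_false_ms says_true_ms => H2 _ /H2; apply.
  by rewrite IH env_cons; exact: Hx.
Qed.

End Path.

(** A check at [e] consults finitely many labels. In the universal clause one of the keys contains
    the witness read from the labelling, so the bound is chosen for a fixed [lk']. *)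
Lemma chk_local p (lk' : D -> D) e : exists N, forall lk, (forall k, mlt k N -> lk k = lk' k) ->
  (chk p lk e <-> chk p lk' e).
Proof.
pose mx (a b N N' : D) := madd (ms a) (madd (ms b) (madd N N')).
have B2 (a b N N' : D) : mlt a (mx a b N N') /\ mlt b (mx a b N N') /\
   mle N (mx a b N N') /\ mle N' (mx a b N N').
  split; [|split; [|split]].
  - exact: le_addl.
  - apply: le_trans (le_addr _ _); exact: le_addl.
  - do 2!(apply: le_trans (le_addr _ _)); exact: le_addl.
  - do 3!(apply: le_trans (le_addr _ _)); exact: le_refl.
have mono (N N' : D) lk : mle N N' -> (forall k, mlt k N' -> lk k = lk' k) ->
    forall k, mlt k N -> lk k = lk' k.
  by move=> le H k Hk; apply: H; exact: lt_le_trans Hk le.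
elim: p => [|t u|t k|p [N1 IHp] q [N2 IHq]|p [N1 IH]|p IH].
- by exists (ms (key FBot e)) => lk H /=; rewrite H //; exact: le_refl.
- by exists (ms (key (FEq t u) e)) => lk H /=; rewrite H //; exact: le_refl.
- set a := key (FMem t k) e; set b := key (FMem (TVar 0) k) (ccons (mteval (env e) t) mz).
  have [H1 [H2 _]] := B2 a b mz mz.
  by exists (mx a b mz mz) => lk H /=; rewrite -/a -/b (H _ H1) (H _ H2).
- set a := key (FImp p q) e; set b := key p e; set c := key q e.
  have [H1 [_ [_ H2]]] := B2 a mz mz (mx b c N1 N2).
  have [H3 [H4 [H5 H6]]] := B2 b c N1 N2.
  exists (mx a mz mz (mx b c N1 N2)) => lk H /=; rewrite (IHp lk) ?(IHq lk).
  + by rewrite -/a -/b -/c (H _ H1) !(mono _ _ lk H2 H).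
  + by apply: mono H; exact: le_trans H2.
  + by apply: mono H; exact: le_trans H2.
- set a1 := key (FAll p) (tl e); set a2 := key (FAll p) e; set a3 := key p e.
  set a4 := key p (ccons (ap pPred [:: ap pPred [:: lk' a2]]) e).
  have [H1 [H2 [_ H]]] := B2 a1 a2 mz (mx a3 a4 N1 mz).
  have [H3 [H4 [H5 _]]] := B2 a3 a4 N1 mz.
  exists (mx a1 a2 mz (mx a3 a4 N1 mz)) => lk HH /=; rewrite (IH lk); last by apply: mono HH; exact: le_trans H.
  rewrite -/a1 -/a2 -/a3 (HH _ H1) (HH _ H2) -/a4.
  by rewrite !(mono _ _ lk H HH).
- by exists mz.
Qed.

End Tree.

(** * Well-foundedness of the tree and truth *)

Lemma arithmetical_subst p : forall s, arithmetical (fsubst s p) = arithmetical p.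
Proof. by elim: p => //= p IHp q IHq s; rewrite IHp IHq. Qed.

Lemma DF_msat (M : model) A (pv : A -> nat -> dom M) eta (rho : A -> nat -> dom M) q :
  arithmetical q -> (forall i, DT pv (fun a => rho a i)) ->
  DF pv (fun _ => eta) (fun a => msat (rho a) eta q).
Proof.
move=> Hq H; pose tm i := proj1_sig (constructive_indefinite_description _ (H i)).
exists (fsubst tm q); split=> [|a]; first by rewrite arithmetical_subst.
rewrite msat_subst.
suff -> : (fun i => mteval (pv a) (tm i)) = rho a by [].
apply: functional_extensionality => i.
by rewrite /tm; case: (constructive_indefinite_description _ _) => t /= ->.
Qed.

Lemma DT_num (M : model) A (pv : A -> nat -> dom M) n : DT pv (fun _ => num n).
Proof. elim: n => [|n IH] /=; [exact: DT_mz|exact: DT_ap1]. Qed.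

Lemma DT_env (M : model) A (pv : A -> nat -> dom M) e i : DT pv e -> DT pv (fun a => env (e a) i).
Proof. by move=> H; apply: DT_ap1; apply: DT_ap2 => //; exact: DT_num. Qed.

Lemma msat_WF (M : aca_model) f rho eta : @msat M rho eta (WF f) <->
  forall X : sets M, (exists x, mm x X) -> exists x, mm x X /\ forall y, mm y X -> ~ tru (ap f [:: y; x]).
Proof.
pose C := FAll (FImp (FMem (TVar 0) 0) (FNot (tprec f (TVar 0) (TVar 1)))).
have HA X : msat rho (mcons X eta) (FEx (FMem (TVar 0) 0)) <-> exists x, mm x X by rewrite msat_ex.
have HC X : msat rho (mcons X eta) (FEx (FAnd (FMem (TVar 0) 0) C)) <->
    exists x, mm x X /\ forall y, mm y X -> ~ tru (ap f [:: y; x]).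
  have HC x : msat (mcons x rho) (mcons X eta) C <-> forall y, mm y X -> ~ tru (ap f [:: y; x]).
    by rewrite /C /= -/(TT f _); split=> H y; move: (H y); rewrite mt_TT //= mt_zero.
  rewrite msat_ex; split=> -[x Hx]; exists x.
    by move: Hx; rewrite msat_and HC.
  by rewrite msat_and HC.
by split=> H X; [rewrite -HA -HC; exact: H|move: (H X); rewrite -HA -HC].
Qed.

Section WFtree.
Variable M : aca_model.
Local Notation D := (dom M).
Implicit Types (x y z e s t w : D) (rho : nat -> D) (p q r : formula).

(** * If [r] is valid in the model, no nonempty set descends in its tree *)

Section Soundness.
Variables (r : formula) (X : sets M).
Hypothesis Harith : arithmetical r.
Hypothesis Hr : forall rho (eta : nat -> sets M), msat rho eta r.
Hypothesis Xex : exists x, mm x X.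
Hypothesis Xmin : forall x, mm x X -> exists y, mm y X /\ tru (ap (treeord r) [:: y; x]).

Lemma X_desc x : mm x X -> exists y, mm y X /\ mKB y x.
Proof. by move/Xmin => [y [Hy /tru_treeord [_ [_ H]]]]; exists y. Qed.

Lemma X_tree x : mm x X -> mTree r x.
Proof. by move/Xmin => [y [Hy /tru_treeord [_ []]]]. Qed.

Variable Z : sets M.
(* Z is the set of initial segments of the path towards which X descends. *)
Hypothesis HZ : forall s, mm s Z <-> exists t, mm t X /\ mE t s /\
  forall t', mm t' X -> (t' = t \/ mKB t' t) -> mE t' s.

Lemma Z_nil : mm mz Z.
Proof.
apply/HZ; case: Xex => t Ht; exists t; split=> //; split; first exact: E_nil.
by move=> t' _ _; exact: E_nil.
Qed.

(** Of the two witnesses in [X], the one lower in the Kleene-Brouwer order extends both segments. *)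
Lemma Z_linear s1 s2 : mm s1 Z -> mm s2 Z -> mE s1 s2 \/ mE s2 s1.
Proof.
move=> /HZ [t1 [X1 [E1 H1]]] /HZ [t2 [X2 [E2 H2]]].
case: (KB_total t1 t2) => H.
- by subst; exact: E_linear E1 E2.
- by apply: E_linear E1 _; apply: H2 => //; right.
- by apply: E_linear _ E2; apply: H1 => //; right.
Qed.

Lemma Z_child s : mm s Z -> exists a, mm (ccons a s) Z.
Proof.
move=> /HZ [t [Xt [Est Hs]]].
have [t1 [X1 [K1 N1]]] : exists t1, mm t1 X /\ mKB t1 t /\ t1 <> s.
  have [t1 [X1 K1]] := X_desc Xt.
  case: (classic (t1 = s)) => [E|]; last by exists t1.
  have [t2 [X2 K2]] := X_desc X1; exists t2; split=> //; split; first exact: KB_trans K2 K1.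
  by move=> E2; rewrite E E2 in K2; exact: KB_irrefl K2.
have [b Hb] := E_proper (Hs _ X1 (or_intror K1)) N1.
(* [Y] collects the possible next entries after [s] among members of [X] below [t]. With the least
   such entry, no lower member of [X] can branch off to the left. *)
mset M (fun a => exists u, mm u X /\ mKB u t /\ mE u (ccons a s)) => -[Y HY].
have [|a [/HY [u [Xu [Ku Eu]]] Hmin]] := @least M Y; first by exists b; apply/HY; exists t1.
exists a; apply/HZ; exists u; split=> //; split=> // v Xv Huv.
have Kv : mKB v t by case: Huv => [->//|H]; exact: KB_trans H Ku.
have Ev := Hs _ Xv (or_intror Kv).
case: Huv => [->//|Kvu].
(* [u] properly extends [s] and so lies below it, while [v] lies below [u]. *)
have Nv : v <> s.
  move=> E; subst v; apply: (@KB_irrefl _ s); apply: KB_trans Kvu _; right; split.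
    by move=> E; rewrite E in Eu; exact: len_lt_neq Eu.
  by apply: E_trans Eu _; exact: E_cons.
have [c Hc] := E_proper Ev Nv.
have Hac : mle a c by apply: Hmin; apply/HY; exists v.
case: (le_eqlt Hac) => [-> //|lt].
case: (@KB_irrefl _ u); apply: KB_trans Kvu; left.
by exists s, a, c.
Qed.

Lemma Z_len n : exists s, mm s Z /\ len s = n.
Proof.
move: n; mind M.
  by exists mz; split; [exact: Z_nil|exact: len0].
by move=> n [s [/Z_child [a Ha] <-]]; exists (ccons a s); split=> //; exact: lenS.
Qed.

(** The branch [Z] yields a total labelling [F] that passes every check, so [F] is truth for the
    sets it defines itself. Since the root formula is not labelled true, this refutes [r]. *)
Lemma tree_contradiction : False.
Proof.
have Fex k : exists w, exists v, mm (ccons w v) Z /\ len v = k.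
  have [s [Zs]] := Z_len (ms k).
  case: (cons_surj s) Zs => [->|[a [v ->]]]; first by rewrite len0 => _ /esym/msS_neq.
  by rewrite lenS => Zs /ms_inj <-; exists a, v.
pose F k := proj1_sig (constructive_indefinite_description _ (Fex k)).
have HF k : exists v, mm (ccons (F k) v) Z /\ len v = k.
  by rewrite /F; case: (constructive_indefinite_description _ _).
have Funiq k w v : mm (ccons w v) Z -> len v = k -> w = F k.
  move=> Zw Hk; have [u [Zu Hu]] := HF k.
  have Elen : len (ccons w v) = len (ccons (F k) u) by rewrite !lenS Hk Hu.
  suff /cons_inj [] : ccons w v = ccons (F k) u by [].
  by case: (Z_linear Zw Zu) => /E_len []; rewrite ?Elen // => /lt_irrefl.
have HFlook s t k : mm s Z -> mE t s -> mlt k (len s) -> look t k = ms (F k).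
  move=> Zs Ets Hk; have [v [Zv Hv]] := HF k.
  apply/look_iff; exists v; split=> //; apply: E_trans Ets _.
  case: (Z_linear Zs Zv) => // /E_len [->|]; first exact: E_refl.
  by rewrite lenS Hv => H; case: (lt_irrefl (lt_le_trans H Hk)).
have Hchk e : chk r (fun k => ms (F k)) e.
  have [N HN] := chk_local r (fun k => ms (F k)) e.
  (* Length [N + e] serves two ends: [t] then agrees with [F] at all positions below [N], and
     [e <= len t <= t] puts [e] in the range that the tree condition checks. *)
  have [s [Zs Hs]] := Z_len (madd N e).
  have /HZ [t [Xt [Ets _]]] := Zs.
  apply/(HN (fun k => look t k)).
    move=> k Hk; apply: HFlook Zs Ets _; rewrite Hs; apply: lt_le_trans Hk _; exact: le_addl.
  apply: (proj2 (X_tree Xt)); apply: (le_trans (le_addr N e)); rewrite -Hs.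
  apply: le_trans (len_le t).
  by case: (E_len Ets) => [->|/lt_le]; [exact: le_refl|].
have Hroot : F (key r mz) <> mz.
  move=> E; have [s [Zs Hs]] := Z_len (ms (key r mz)).
  have /HZ [t [Xt [Ets _]]] := Zs.
  apply: (proj1 (X_tree Xt)); rewrite (HFlook s) ?Hs //; last exact: le_refl.
  by rewrite E.
(* The numeral of the atom is abstracted to [c] so that it enters comprehension as a parameter. *)
have Hset c : exists Y : sets M, forall x, mm x Y <-> exists v, mm (ccons mz v) Z /\ len v = ccons c (ccons x mz).
  clear -Z; mset M (fun x => exists v, mm (ccons mz v) Z /\ len v = ccons c (ccons x mz)).
  by [].
pose eta k := proj1_sig (constructive_indefinite_description _ (Hset (num (godel (FMem (TVar 0) k))))).
apply: Hroot; apply/(@chk_sat M F eta) => //.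
move=> k x; rewrite /eta; case: (constructive_indefinite_description _ _) => /= Y ->.
split=> [[v [Zv Hv]]|H]; first by rewrite -(Funiq _ _ _ Zv Hv).
by have [v] := HF (key (FMem (TVar 0) k) (ccons x mz)); rewrite H => Hv; exists v.
Qed.

End Soundness.

Lemma WF_of_true r : arithmetical r -> (forall rho (eta : nat -> sets M), msat rho eta r) ->
  forall rho eta, @msat M rho eta (WF (treeord r)).
Proof.
move=> Ha Hr rho eta; apply/msat_WF => X Xex; apply: NNPP => Hn.
have Xmin x : mm x X -> exists y, mm y X /\ tru (ap (treeord r) [:: y; x]).
  move=> Hx; apply: NNPP => Hn'; apply: Hn; exists x; split=> // y Hy H.
  by apply: Hn'; exists y.
mset M (fun s => exists t, mm t X /\ mE t s /\
  forall t', mm t' X -> (t' = t \/ mKB t' t) -> mE t' s) => -[Z HZ].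
exact: tree_contradiction Ha Hr Xex Xmin Z HZ.
Qed.


(** * If [r] fails in the model, its truth values form an infinite branch *)

Section Completeness.
Variables (eta : nat -> sets M).

(** Taking the least counterexample makes the labelling single-valued, hence definable without
    choice; for formulas other than universal ones the witness is 0 by convention. *)
Definition witness q e w : Prop :=
  if q is FAll q' then exists x, w = ms x /\ ~ msat (mcons x (env e)) eta q' /\
    forall y, ~ msat (mcons y (env e)) eta q' -> mle x y
  else w = ms mz.

Definition val q e w : Prop :=
  (msat (env e) eta q /\ w = mz) \/ (~ msat (env e) eta q /\ witness q e w).

(** A membership formula brings along the canonical atom that its check consults. *)
Fixpoint subs p : seq formula :=
  p :: match p with
       | FMem t k => [:: FMem (TVar 0) k]
       | FImp q r => subs q ++ subs r
       | FAll q => subs q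
       | _ => [::]
       end.

(** Only the finitely many formulas in [L] are labelled by truth, so the labelling is arithmetical
    by a finite case distinction, without a truth predicate. All other positions get the filler
    0. *)
Fixpoint graph (L : seq formula) k w : Prop :=
  if L is q :: L' then (exists e, k = key q e /\ val q e w) \/ (~ (exists e, k = key q e) /\ graph L' k w)
  else w = mz.

Lemma val_ex q e : arithmetical q -> exists w, val q e w.
Proof.
move=> Ha; case: (classic (msat (env e) eta q)) => H; first by exists mz; left.
case: q Ha H => [|t u|t k|p q|q|q] Ha H; try by exists (ms mz); right.
have [Y HY] : exists Y : sets M, forall x, mm x Y <-> ~ msat (mcons x (env e)) eta q.
  apply: (@formula_set M (nth mz [:: e]) eta); apply: DF_not; apply: DF_msat => //.
  move=> [|i] /=; first by dvar.
  by apply: DT_env; dvar.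
have [|x [Hx Hmin]] := @least M Y.
  by apply: NNPP => Hn; apply: H => x; apply: NNPP => Hx; apply: Hn; exists x; apply/HY.
exists (ms x); right; split=> //; exists x; split=> //; split; first exact/HY.
by move=> y /HY; exact: Hmin.
Qed.

Lemma val_unique q e w w' : val q e w -> val q e w' -> w = w'.
Proof.
move=> [[H1 ->]|[H1 H2]] [[H3 ->]|[H3 H4]] //.
case: q {H1 H3} H2 H4 => [|t u|t k|p q|q|q] /=; try by move=> -> ->.
move=> [x [-> [Hx Hmin]]] [y [-> [Hy Hmin']]].
by congr (ms _); apply: le_anti; [apply: Hmin|apply: Hmin'].
Qed.

Lemma DF_val A (pv : A -> nat -> D) te tw q : arithmetical q -> DT pv te -> DT pv tw ->
  DF pv (fun _ => eta) (fun a => val q (te a) (tw a)).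
Proof.
move=> Ha He Hw.
have Hs : DF pv (fun _ => eta) (fun a => msat (env (te a)) eta q).
  by apply: DF_msat => // i; exact: DT_env.
apply: DF_or; apply: DF_and => //; [by apply: DF_eq => //; exact: DT_mz|exact: DF_not|].
case: q Ha Hs => [|t u|t k|p q|q|q] Ha _ /=;
  try by apply: DF_eq => //; apply: DT_ap1; exact: DT_mz.
have lift (t : A -> D) : DT pv t -> DT (fun ax : A * D => mcons ax.2 (pv ax.1)) (fun ax => t ax.1).
  move=> [tm H]; exists (tshift tm) => a; by rewrite mteval_shift H.
have lift2 (t : A -> D) : DT pv t ->
    DT (fun ax : A * D * D => mcons ax.2 (mcons ax.1.2 (pv ax.1.1))) (fun ax => t ax.1.1).
  by move=> [tm H]; exists (tshift (tshift tm)) => a; rewrite !mteval_shift H.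
apply: DF_ex; apply: DF_and; first by apply: DF_eq; [exact: lift|apply: DT_ap1; dvar].
apply: DF_and.
  apply: DF_not; apply: DF_msat => // -[|i] /=; first by dvar.
  by apply: DT_env; exact: lift.
apply: DF_all; apply: DF_imp.
  apply: DF_not; apply: DF_msat => // -[|i] /=; first by dvar.
  by apply: DT_env; exact: lift2.
by rewrite /mle; apply: DF_ex; dform.
Qed.

Lemma graph_spec L : (forall q, List.In q L -> arithmetical q) -> forall k,
  (exists w, graph L k w) /\ (forall w w', graph L k w -> graph L k w' -> w = w').
Proof.
elim: L => [|q L IH] HL k /=; first by split; [exists mz|move=> w w' -> ->].
have [|[w Hw] Hu] := IH _ k; first by move=> p Hp; apply: HL; right.
split.
  case: (classic (exists e, k = key q e)) => [[e He]|Hn].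
    have [|w' Hw'] := @val_ex q e; first by apply: HL; left.
    by exists w'; left; exists e.
  by exists w; right.
move=> x y [[e [He Hx]]|[H1 H2]] [[e' [He' Hy]]|[H3 H4]].
- move: He'; rewrite He => /key_inj [_ Ee]; subst e'; exact: val_unique Hx Hy.
- by case: H3; exists e.
- by case: H1; exists e'.
- exact: Hu.
Qed.

Lemma graph_val L q e w : List.In q L -> graph L (key q e) w -> val q e w.
Proof.
elim: L => //= p L IH Hq [[e' [/key_inj [-> ->]]] //|[Hn H]].
case: Hq => [E|Hq]; last exact: IH.
by case: Hn; exists e; rewrite E.
Qed.

Lemma DF_graph A (pv : A -> nat -> D) tk tw L : (forall q, List.In q L -> arithmetical q) ->
  DT pv tk -> DT pv tw -> DF pv (fun _ => eta) (fun a => graph L (tk a) (tw a)).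
Proof.
move=> + Hk Hw; elim: L => [|q L IH] HL /=; first by apply: DF_eq => //; exact: DT_mz.
have lift (t : A -> D) : DT pv t -> DT (fun ax : A * D => mcons ax.2 (pv ax.1)) (fun ax => t ax.1).
  move=> [tm H]; exists (tshift tm) => a; by rewrite mteval_shift H.
have Hkey : DF (fun ax : A * D => mcons ax.2 (pv ax.1)) (fun _ => eta) (fun ax => tk ax.1 = key q ax.2).
  by apply: DF_eq; [exact: lift|apply: DT_ap2; [exact: DT_num|dvar]].
apply: DF_or; last first.
  apply: DF_and; last by apply: IH => p Hp; apply: HL; right.
  by apply: DF_not; exact: DF_ex.
apply: DF_ex; apply: DF_and => //; apply: DF_val; [by apply: HL; left|by dvar|exact: lift].
Qed.

Lemma subs_arith p : arithmetical p -> forall q, List.In q (subs p) -> arithmetical q.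
Proof.
elim: p => [|t u|t k|p IHp q IHq|p IH|p IH] //= Ha r; try by move=> [<-|] //.
- by move=> [<-|[<-|]].
- case/andP: (Ha) => Ha1 Ha2 [<- //|/List.in_app_iff [/IHp|/IHq]]; exact.
- by move=> [<- //|/IH]; exact.
Qed.

(** Each check is a consequence of a Tarski clause and concerns defined labels only, so it passes
    for every partial restriction [lk] of the correct labelling [F]. *)
Lemma chk_val (F lk : D -> D) p :
  (forall q, List.In q (subs p) -> forall e, val q e (F (key q e))) ->
  (forall k, lk k = mz \/ lk k = ms (F k)) -> forall e, chk p lk e.
Proof.
move=> + Hlk.
have HT k : says_true (lk k) -> F k = mz.
  by move=> H; case: (Hlk k) => E; rewrite E in H; [case/esym/msS_neq: H|apply/says_true_ms].
have HF k : says_false (lk k) -> F k <> mz /\ lk k = ms (F k).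
  move=> H; case: (Hlk k) => E; last by rewrite E in H; split=> //; apply/says_false_ms.
  by rewrite E in H; case/leS0: H.
have vT q e w : val q e w -> w = mz -> msat (env e) eta q.
  move=> [[]//|[_ +] E]; rewrite E; case: q => [|t u|t k|p' q|q|q] /=;
    try by move=> /esym/msS_neq.
  by move=> [x [/esym/msS_neq]].
have vF q e w : val q e w -> w <> mz -> ~ msat (env e) eta q.
  by move=> [[_ ->]|[]].
elim: p => [|t u|t k|p IHp q IHq|p IH|p IH] HV e //=.
- by move=> /HT; exact: (vT FBot) (HV _ (or_introl erefl) e).
- have H := HV _ (or_introl erefl) e.
  by split=> [/HT|/HF []]; [exact: (vT (FEq t u)) H|move=> + _; exact: (vF (FEq t u)) H].
- have H := HV _ (or_introl erefl) e.
  have H' := HV _ (or_intror (or_introl erefl)) (ccons (mteval (env e) t) mz).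
  have E : msat (env (ccons (mteval (env e) t) mz)) eta (FMem (TVar 0) k) <->
      msat (env e) eta (FMem t k) by rewrite env_cons.
  split=> [/HT H1 /HF [H2 _]|/HF [H1 _] /HT H2].
    by apply: (vF _ _ _ H' H2); apply/E; exact: vT H H1.
  by apply: (vF _ _ _ H H1); apply/E; exact: vT H' H2.
- have H := HV _ (or_introl erefl) e.
  have Hp q' (Hq' : List.In q' (subs p)) : List.In q' (subs (FImp p q)).
    by right; apply/List.in_app_iff; left.
  have Hq q' (Hq' : List.In q' (subs q)) : List.In q' (subs (FImp p q)).
    by right; apply/List.in_app_iff; right.
  have Ip : List.In p (subs p) by case: (p) => *; left.
  have Iq : List.In q (subs q) by case: (q) => *; left.
  have V1 := HV _ (Hp _ Ip) e; have V2 := HV _ (Hq _ Iq) e.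
  split; last by split; [apply: IHp|apply: IHq] => q' Hq'; apply: HV; auto.
  split=> [/HT H1 /HT H2 /HF [H3 _]|/HF [H1 _]].
    by apply: (vF _ _ _ V2 H3); apply: (vT _ _ _ H H1); exact: vT V1 H2.
  split=> [/HF [H2 _]|/HT H2]; apply: (vF _ _ _ H H1) => /= H3.
    by case: (vF _ _ _ V1 H2).
  exact: vT V2 H2.
- have Hp q' (Hq' : List.In q' (subs p)) : List.In q' (subs (FAll p)) by right.
  have Ip : List.In p (subs p) by case: (p) => *; left.
  split; last by apply: IH => q' Hq'; apply: HV; auto.
  split=> [/HT H1 /HF [H2 _]|/HF [H1 ->] /HT].
    apply: (vF _ _ _ (HV _ (Hp _ Ip) e) H2); rewrite env_tl.
    exact: (vT _ _ _ (HV (FAll p) (or_introl erefl) (tl e)) H1).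
  rewrite predS; case: (HV (FAll p) (or_introl erefl) e) => [[_ /H1 //]|[_ /= [x [-> [Hx _]]]]].
  rewrite predS => H2; apply: Hx; rewrite -env_cons.
  exact: (vT _ _ _ (HV _ (Hp _ Ip) _) H2).
Qed.

(** [X] consists of the finite approximations to the true labelling. Each is prolonged by the next
    value of [F], and a proper extension is lower in the Kleene-Brouwer order. *)
Lemma not_WF r : arithmetical r -> ~ msat (env mz) eta r ->
  exists X : sets M, (exists x, mm x X) /\
    forall x, mm x X -> exists y, mm y X /\ tru (ap (treeord r) [:: y; x]).
Proof.
move=> Ha Hr; have HL := subs_arith Ha; set L := subs r in HL.
pose F k := proj1_sig (constructive_indefinite_description _ (proj1 (graph_spec HL k))).
have HF k : graph L k (F k) by rewrite /F; case: (constructive_indefinite_description _ _).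
have HFu k w : graph L k w -> w = F k by move=> H; exact: (proj2 (graph_spec HL k)) H (HF k).
have [Z HZ] : exists Z : sets M, forall z, mm z Z <-> graph L (tl z) (hd z).
  apply: (@formula_set M (nth mz [::]) eta); apply: DF_graph => //; apply: DT_ap1; dvar.
have HZF k w : mm (ccons w k) Z <-> w = F k.
  by rewrite HZ tlE hdE; split=> [/HFu|->].
mset M (fun s => forall w v, mE s (ccons w v) -> mm (ccons w (len v)) Z) => -[X HX].
have HXF s w v : mm s X -> mE s (ccons w v) -> w = F (len v).
  by move=> /HX H /H /HZF.
have Xtree s : mm s X -> mTree r s.
  move=> Xs; have Hlk k : look s k = mz \/ look s k = ms (F k).
    case: (mcases (look s k)) => [->|[w Hw]]; [by left|right; rewrite Hw].
    by case/look_iff: Hw => v [/(HXF _ _ _ Xs) -> <-].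
  have HV q : List.In q L -> forall e, val q e (F (key q e)).
    by move=> Hq e; exact: graph_val Hq (HF _).
  split; last by move=> e _; exact: (@chk_val F).
  (* A true label at the root would be the value 0 of [F], but the label of a false formula is a
     successor. *)
  move=> HT; apply: Hr; have Ir : List.In r L by rewrite /L; case: (r) => *; left.
  case: (Hlk (key r mz)) => E; rewrite E in HT; first by case/esym/msS_neq: HT.
  move/says_true_ms: HT => HT; case: (HV _ Ir mz) => [[] //|[_]]; rewrite HT.
  case: (r) => [|t u|t k|p q|q|q] /=; try by move=> /esym/msS_neq.
  by move=> [x [/esym/msS_neq]].
exists X; split; first by exists mz; apply/HX => w v /nil_E /cons_neq0.
move=> s Xs; exists (ccons (F (len s)) s).
have Xc : mm (ccons (F (len s)) s) X.
  apply/HX => w v /cons_E [/cons_inj [-> ->]|H]; first exact/HZF.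
  exact: (proj1 (HX s) Xs).
split=> //; apply/tru_treeord; split; [exact: Xtree|split; first exact: Xtree].
right; split; [exact: cons_neq|exact: E_cons].
Qed.

End Completeness.

(** As [r] has no free number variable, its truth may be tested in the environment coded by 0, the
    one at which the tree starts. *)
Lemma true_of_WF r rho0 eta0 : arithmetical r -> nv r = 0 -> @msat M rho0 eta0 (WF (treeord r)) ->
  forall rho (eta : nat -> sets M), msat rho eta r.
Proof.
move=> Ha Hn /msat_WF HW rho eta.
rewrite (@msat_ext M r rho (env mz) eta eta) ?Hn //.
apply: NNPP => /(not_WF Ha) [X [Xex Xmin]].
have [x [/Xmin [y [Hy Hyx]] H]] := HW X Xex.
exact: H Hy Hyx.
Qed.

End WFtree.

(** * The standard model and embeddings of orders *)

Definition std : model :=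
  @Model nat (nat -> Prop) (fun n X => X n)
    (fun n f v => peval f (fun j => if (insub j : option 'I_n) is Some o then v o else 0)).

Lemma peval_ext n (f : prf n) : forall v w, (forall j, j < n -> v j = w j) -> peval f v = peval f w.
Proof.
elim: f => [||n' i|k n' g IHg hs IHh|n' g IHg h IHh] v w H //=.
- by rewrite H.
- by rewrite H.
- apply: IHg => j Hj; case: insubP => // o _ _; exact: IHh.
- rewrite H //; elim: (w 0) => [|m IH]; first by apply: IHg => j Hj; exact: H.
  by apply: IHh => -[|[|j]] //= Hj; exact: H.
Qed.

Lemma ap_std n (f : prf n) l : @ap std n f l = peval f (nth 0 l).
Proof.
rewrite /ap /=; apply: peval_ext => j Hj; rewrite insubT /=.
by congr nth; rewrite /mz /=.
Qed.

Lemma peval_PRS n (g : prf n) h m l :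
  peval (PR g h) (nth 0 (m.+1 :: l)) = peval h (nth 0 (m :: peval (PR g h) (nth 0 (m :: l)) :: l)).
Proof. by rewrite /=; apply: peval_ext => -[|[|j]]. Qed.

Lemma teval_std rho t : teval rho t = @mteval std rho t.
Proof.
elim: t => //= n f a IH; rewrite mt_app /=; apply: peval_ext => j Hj.
by rewrite insubT; exact: IH.
Qed.

Lemma sat_std p : forall rho eta, sat rho eta p <-> @msat std rho eta p.
Proof.
elim: p => [|t u|t k|p IHp q IHq|p IH|p IH] rho eta /=; rewrite ?teval_std //.
- by rewrite IHp IHq.
- by split=> H n; move: (H n); rewrite IH.
- by split=> H n; move: (H n); rewrite IH.
Qed.

Lemma nth_TVars rho i0 n j : j < n ->
  @mteval std rho (nth (TVar 0) [seq TVar i | i <- iota i0 n] j) = rho (i0 + j).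
Proof. by move=> H; rewrite (nth_map 0) ?size_iota // nth_iota // mt_var. Qed.

Lemma fun_axioms_std n (f : prf n) p : List.In p (fun_axioms f) ->
  forall rho eta, @msat std rho eta p.
Proof.
case: f => [||n' i|k n' g hs|n' g h] /=.
- by [].
- case=> [<-|[<-|[]]] rho eta /=; rewrite !mt_succ ?mt_zero !ap_std /=; first by [].
  by case.
- by case=> [<-|[]] rho eta /=; rewrite mt_app /= valK.
- case=> [<-|[]] rho eta /=; rewrite !mt_app /=; apply: peval_ext => j Hj.
  by rewrite insubT mt_app /=.
- have E m rho' (l := (fun i => rho' i.+1)) :
    peval (PR g h) (vcons m.+1 l) = peval h (vcons m (vcons (peval (PR g h) (vcons m l)) l)) by [].
  case=> [<-|[<-|[]]] rho eta; rewrite /= !mt_app.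
    transitivity (peval (PR g h) (vcons 0 rho)).
      apply: peval_ext => j Hj; rewrite insubT /targs /=.
      by case: j Hj => [|j] Hj /=; [rewrite mt_zero|rewrite nth_TVars].
    rewrite /=; apply: peval_ext => j Hj; rewrite insubT /tvars //=.
  transitivity (peval (PR g h) (vcons (rho 0).+1 (fun i => rho i.+1))).
    apply: peval_ext => j Hj; rewrite insubT /targs /=.
    by case: j Hj => [|j] Hj /=; [rewrite mt_succ ap_std|rewrite nth_TVars].
  rewrite E; apply: peval_ext => j Hj; rewrite insubT /targs /=.
  case: j Hj => [|[|j]] Hj /=; [by []| |by rewrite nth_TVars].
  rewrite mt_app; apply: (@peval_ext _ (PR g h)) => j Hj'; rewrite insubT /tvars mt_var.
  by case: j Hj'.
Qed.

Lemma aca_std : models std ACA0.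
Proof.
move=> p [[n [f [q [Hq ->]]]]|[->|[q [Hq ->]]]] rho eta.
- apply/msat_closure => rho' eta'; exact: fun_axioms_std Hq _ _.
- rewrite /induction_ax => X.
  suff H : msat rho (mcons X eta) (FAnd (FMem tzero 0)
      (FAll (FImp (FMem (TVar 0) 0) (FMem (tsucc (TVar 0)) 0)))) -> forall n : nat, X n by exact: H.
  rewrite msat_and => -[H0 HS] n.
  elim: n => [|n IH]; first by move: H0; rewrite /= mt_zero.
  by have := HS n IH; rewrite /= mt_succ ap_std.
- apply/msat_closure => rho' eta'; apply/msat_ex2.
  exists (fun x => @msat std (mcons x rho') eta' q) => x.
  by rewrite -/msat msat_iff msat_sshift.
Qed.

Definition stdA : aca_model := @AcaModel std (fun _ => False) aca_std.

Lemma tru_std f x y : prec f x y <-> @ap stdA 2 f [:: x; y] <> mz.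
Proof.
rewrite /prec ap_std; suff -> : peval f (vcons x (vcons y (fun=> 0))) = peval f (nth 0 [:: x; y]) by [].
by apply: peval_ext => -[|[|j]].
Qed.

(** * The root as greatest element of the tree order *)

Section TreeOrder.
Variable M : aca_model.
Implicit Types (x y s t k : dom M).

(** Keys are codes of nonempty sequences, hence nonzero: a labelling defined at most at position 0
    labels no formula. *)
Lemma chk_undef p (lk : dom M -> dom M) e : (forall k, k <> mz -> lk k = mz) -> chk p lk e.
Proof.
move=> H.
have nT a x : ~ says_true (lk (ccons a x)) by rewrite H; [move/esym/msS_neq|exact: cons_neq0].
have nF a x : ~ says_false (lk (ccons a x)) by rewrite H; [move/leS0|exact: cons_neq0].
elim: p => [|t u|t k|p IHp q IHq|p IH|p IH] //=.
by split=> [/nT|/nF].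
Qed.

Lemma Tree_nil r : mTree r (mz : dom M).
Proof.
have H k : look mz k = mz.
  by case: (mcases (look mz k)) => // -[w /look_iff [v [/nil_E/cons_neq0]]].
by split=> [|e _]; [rewrite H => /esym/msS_neq|exact: chk_undef].
Qed.

(** A one-entry sequence fills only position 0, which is no key. Such nodes ensure that the root has
    something below it and so belongs to the field of the order. *)
Lemma Tree_single r (a : dom M) : mTree r (ccons a mz).
Proof.
have H k : k <> mz -> look (ccons a mz) k = mz.
  move=> Hk; case: (mcases (look (ccons a mz) k)) => // -[w /look_iff [v [H1 H2]]].
  case: Hk; move: H2; case/cons_E: H1 => [/cons_inj [_ ->]|/nil_E/cons_neq0 //].
  by rewrite len0.
split=> [|e _]; last exact: chk_undef.
by rewrite H; [move/esym/msS_neq|exact: cons_neq0].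
Qed.

Lemma treeord_single r (a : dom M) : tru (ap (treeord r) [:: ccons a mz; mz]).
Proof.
apply/tru_treeord; split; [exact: Tree_single|split; first exact: Tree_nil].
by right; split; [exact: cons_neq0|exact: E_nil].
Qed.

Lemma KB_nil s : ~ mKB mz s.
Proof. by case=> [[v [a [b [/nil_E/cons_neq0 //]]]]|[H /nil_E E]]; apply: H. Qed.

Lemma KB_to_nil s : s <> mz -> mKB s mz.
Proof. by right; split=> //; exact: E_nil. Qed.

End TreeOrder.

Lemma treeord_wo r : arithmetical r -> (forall rho (eta : nat -> sets stdA), msat rho eta r) ->
  well_ordering (prec (treeord r)).
Proof.
move=> Ha Hr; split; [|split; [|split]].
- by move=> x /tru_std /tru_treeord [_ [_ /KB_irrefl]].
- move=> x y z /tru_std /tru_treeord [H1 [H2 H3]] /tru_std /tru_treeord [_ [H5 H6]].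
  by apply/tru_std/tru_treeord; split=> //; split=> //; exact: KB_trans H3 H6.
- have F x : in_field (prec (treeord r)) x -> mTree r (x : dom stdA).
    by case=> y [] /tru_std /tru_treeord [? []].
  move=> x y /F Hx /F Hy; case: (@KB_total stdA x y) => H; [by left|right; left|right; right];
    exact/tru_std/tru_treeord.
- have HW := proj1 (@msat_WF stdA (treeord r) (fun _ => 0) (fun _ _ => False)) (@WF_of_true stdA r Ha Hr _ _).
  move=> a; apply: NNPP => Hacc.
  have [|x [Hx Hmin]] := HW (fun x => ~ Acc (prec (treeord r)) x); first by exists a.
  apply: (Hx); constructor => y Hy; apply: NNPP => Hn.
  by apply: (Hmin y Hn); apply/tru_std.
Qed.

(** The pairing [2 ^ a * (2 * b + 1)] by repeated doubling; in the standard model it is the [pr] of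
    the Goedel numbering, whose injectivity can be reused. *)
Definition pPr : prf 2 :=
  prec_ 1 (tsucc (TT pAdd [:: TVar 0; TVar 0])) (TT pAdd [:: TVar 1; TVar 1]).

Definition emb_formula (f g : prf 2) : formula :=
  let X a b := FMem (TT pPr [:: TVar a; TVar b]) 0 in
  FAnd (FAll (FEx (X 1 0)))
    (FAll (FAll (FAll (FAll (FImp (X 3 2) (FImp (X 1 0)
      (FImp (tprec f (TVar 3) (TVar 1)) (tprec g (TVar 2) (TVar 0))))))))).

Definition emb (f g : prf 2) : formula := FEx2 (emb_formula f g).

Lemma msat_emb (M : aca_model) f g rho eta : @msat M rho eta (emb f g) <->
  exists X : sets M, (forall a, exists b, mm (ap pPr [:: a; b]) X) /\
    forall a b a' b', mm (ap pPr [:: a; b]) X -> mm (ap pPr [:: a'; b']) X ->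
      tru (ap f [:: a; a']) -> tru (ap g [:: b; b']).
Proof.
have HX X r : @msat M r (mcons X eta) (emb_formula f g) <->
    (forall a, exists b, mm (ap pPr [:: a; b]) X) /\
    forall a b a' b', mm (ap pPr [:: a; b]) X -> mm (ap pPr [:: a'; b']) X ->
      tru (ap f [:: a; a']) -> tru (ap g [:: b; b']).
  have H1 a : msat (mcons a r) (mcons X eta) (FEx (FMem (TT pPr [:: TVar 1; TVar 0]) 0)) <->
      exists b, mm (ap pPr [:: a; b]) X.
    by rewrite msat_ex; split=> -[b Hb]; exists b; move: Hb; rewrite /= mt_TT.
  rewrite msat_and; split=> -[HA HB]; split.
  - by move=> a; apply/H1; exact: HA.
  - move=> a b a' b'; have := HB a b a' b'; rewrite /= !mt_zero -/(TT f _) -/(TT g _).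
    by rewrite !mt_TT.
  - by move=> a; apply/H1; exact: HA.
  - move=> a b a' b'; have := HB a b a' b'; rewrite /= !mt_zero -/(TT f _) -/(TT g _).
    by rewrite !mt_TT.
by rewrite msat_ex2; split=> -[X H]; exists X; apply/(HX X rho).
Qed.

(** A minimal element of the image of [A] comes from an element of [A], which is then minimal. *)
Lemma emb_WF (M : aca_model) f g rho eta :
  @msat M rho eta (emb f g) -> msat rho eta (WF g) -> msat rho eta (WF f).
Proof.
move=> /msat_emb [X [Htot Hhom]] /msat_WF HW; apply/msat_WF => A [a Ha].
mset M (fun b => exists a, mm a A /\ mm (ap pPr [:: a; b]) X) => -[B HB].
have [|y [/HB [x [Hx Hxy]] Hmin]] := HW B.
  by have [b Hb] := Htot a; exists b; apply/HB; exists a.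
exists x; split=> // z Hz Hzx; have [w Hw] := Htot z.
by apply: (Hmin w); [apply/HB; exists z|exact: Hhom Hw Hxy Hzx].
Qed.

Lemma pPr0 (M : aca_model) (b : dom M) : ap pPr [:: mz; b] = ms (madd b b).
Proof. by rewrite rec0 // mt_succ mt_TT. Qed.

Lemma pPrS (M : aca_model) (a b : dom M) :
  ap pPr [:: ms a; b] = madd (ap pPr [:: a; b]) (ap pPr [:: a; b]).
Proof. by rewrite recS // mt_TT. Qed.

Lemma succ_std (x : nat) : @ap stdA 1 PS [:: x] = x.+1.
Proof. exact: ap_std. Qed.

Lemma add_std (x y : nat) : @ap stdA 2 pAdd [:: x; y] = x + y.
Proof.
elim: x => [|x IH]; first exact: (@add0x stdA).
by have := @addSx stdA x y; rewrite !succ_std IH.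
Qed.

Lemma pPr_std a b : @ap stdA 2 pPr [:: a; b] = pr a b.
Proof.
elim: a => [|a IH]; first by rewrite (@pPr0 stdA) add_std succ_std /pr; lia.
have := @pPrS stdA a b; rewrite !succ_std add_std IH => ->.
by rewrite /pr expnS; lia.
Qed.

Lemma emb_true (f g : prf 2) h : (forall a b, prec f a b -> prec g (h a) (h b)) -> true_in_N (emb f g).
Proof.
move=> Hh; apply/sat_std; apply/(@msat_emb stdA).
exists (fun z => exists a, z = pr a (h a)); split=> [a|a b a' b'].
  by exists (h a), a; exact: pPr_std.
move=> [x +] [y +]; rewrite !pPr_std => /pr_inj [-> ->] /pr_inj [-> ->].
by move=> H; apply/tru_std; apply: Hh; apply/tru_std.
Qed.

(** The hypothesis maps everything below the root to points below [y0]; sending the root 0 to [y0]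
    extends this to the whole order. *)
Lemma emb_treeord r g : arithmetical r ->
  otp_seg_lt (prec (treeord r)) 0 (prec g) -> true_in_N (emb (treeord r) g).
Proof.
move=> Ha [y0 [h [_ [H1 H2]]]].
apply: (@emb_true _ _ (fun a => if a == 0 then y0 else h a)) => a b Hab.
have /tru_std/tru_treeord [Ta [Tb Kab]] := Hab.
have Na : (a == 0) = false by apply/eqP => E; subst; exact: (@KB_nil stdA) Kab.
rewrite Na; case: eqP => Eb; first by apply: H2; rewrite -Eb.
apply: H1 => //; apply/tru_std/tru_treeord; split=> //; split; first exact: (@Tree_nil stdA).
exact: (@KB_to_nil stdA).
Qed.

Lemma treeord_field r : in_field (prec (treeord r)) 0.
Proof.
exists (@ap stdA 2 pCons [:: 0; 0]); right; apply/tru_std; exact: (@treeord_single stdA).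
Qed.

(** * True embedding sentences form a Sigma^1_1 set *)

Notation lc x v := ((pr x v).+1).

Section Evaluation.
(* R 0 n c v w: c codes a function symbol of arity n with value w at the list coded by v;
   R 1 n (pr k l) v u: the k codes listed in l evaluate at v to the list u;
   R 2 0 i v w: the i-th entry of the list v is w. *)
Variable R : nat -> nat -> nat -> nat -> nat -> Prop.

(** The witness [d] expresses [i < n] by addition. The recursion clause demands that both [g] and
    [h] have some value, so that any value certifies the whole code, even at [x = 0] where [h] is
    not called. *)
Definition eval_step n c v w : Prop :=
  (c = pr 0 0 /\ n = 0 /\ w = 0) \/
  (c = pr 1 0 /\ n = 1 /\ exists x v', v = lc x v' /\ w = x.+1) \/
  (exists i d, c = pr 2 (pr n i) /\ n = (i + d).+1 /\ R 2 0 i v w) \/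
  (exists k g l u, c = pr 3 (pr k (pr n (pr g l))) /\ R 1 n (pr k l) v u /\ R 0 k g u w) \/
  (exists m g h, n = m.+1 /\ c = pr 4 (pr m (pr g h)) /\
     (exists v' w', R 0 m g v' w') /\ (exists v' w', R 0 m.+2 h v' w') /\
     exists x v', v = lc x v' /\
       ((x = 0 /\ R 0 m g v' w) \/
        exists x' z, x = x'.+1 /\ R 0 n c (lc x' v') z /\ R 0 m.+2 h (lc x' (lc z v')) w)).

Definition list_step n kl v u : Prop :=
  (kl = pr 0 0 /\ u = 0) \/
  exists k c l w u', kl = pr k.+1 (lc c l) /\ u = lc w u' /\ R 0 n c v w /\ R 1 n (pr k l) v u'.

Definition nth_step i v w : Prop :=
  exists x v', v = lc x v' /\ ((i = 0 /\ w = x) \/ exists i', i = i'.+1 /\ R 2 0 i' v' w).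

(** An arithmetical condition on [R]. Any two solutions agree on genuine codes, so quantifying over
    one existentially is harmless. *)
Definition evaluator : Prop :=
  (forall n c v w, R 0 n c v w <-> eval_step n c v w) /\
  (forall n c v w, R 1 n c v w <-> list_step n c v w) /\
  (forall i v w, R 2 0 i v w <-> nth_step i v w).

End Evaluation.

Definition step R k n c v w : Prop :=
  match k with
  | 0 => eval_step R n c v w
  | 1 => list_step R n c v w
  | 2 => n = 0 /\ nth_step R c v w
  | _ => False
  end.

Lemma step_mono (R R' : nat -> nat -> nat -> nat -> nat -> Prop) :
  (forall k n c v w, R k n c v w -> R' k n c v w) ->
  forall k n c v w, step R k n c v w -> step R' k n c v w.
Proof.
move=> H [|[|[|k]]] n c v w //=.
- case=> [|[|[|[|]]]].
  + by left.
  + by right; left.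
  + by move=> [i [d [? [? ?]]]]; right; right; left; exists i, d; auto.
  + move=> [k [g [l [u [? [? ?]]]]]]; right; right; right; left; exists k, g, l, u; auto.
  + move=> [m [g [h [? [? [[v1 [w1 ?]] [[v2 [w2 ?]] [x [v' [? H3]]]]]]]]]].
    right; right; right; right; exists m, g, h; split=> //; split=> //.
    split; first by exists v1, w1; auto.
    split; first by exists v2, w2; auto.
    exists x, v'; split=> //.
    case: H3 => [[? ?]|[x' [z [? [? ?]]]]]; [left|right]; first by auto.
    by exists x', z; auto.
- move=> [?|[k [c' [l [w' [u' [? [? [? ?]]]]]]]]]; [left|right] => //.
  by exists k, c', l, w', u'; auto.
- move=> [? [x [v' [? [?|[i' [? ?]]]]]]]; split=> //; exists x, v'; split=> //; [left|right] => //.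
  by exists i'; auto.
Qed.

(** The least fixed point of the monotone [step], as the intersection of all relations closed under
    it. *)
Lemma evaluator_ex : exists R, evaluator R.
Proof.
pose L k n c v w := forall R : nat -> nat -> nat -> nat -> nat -> Prop,
  (forall k n c v w, step R k n c v w -> R k n c v w) -> R k n c v w.
have H1 k n c v w : step L k n c v w -> L k n c v w.
  move=> H R HR; apply: (HR); apply: step_mono H => k' n' c' v' w'. by apply.
have H2 k n c v w : L k n c v w -> step L k n c v w.
  by apply=> k' n' c' v' w'; apply: step_mono; exact: H1.
exists L; split; [|split] => [n c v w|n c v w|i v w].
- by split=> [/H2|H]; last exact: (H1 0).
- by split=> [/H2|H]; last exact: (H1 1).
- by split=> [/H2 [] //|H]; apply: (H1 2); split.
Qed.

Lemma pr_gtl a b : a < pr a b.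
Proof. by apply: leq_trans (leq_pmulr _ _) => //; exact: ltn_expl. Qed.

Lemma pr_gtr a b : b < pr a b.
Proof. by apply: leq_trans (leq_pmull _ _); [lia|rewrite expn_gt0]. Qed.

Section EvaluatorTheory.
Variable R : nat -> nat -> nat -> nat -> nat -> Prop.
Hypothesis HR : evaluator R.

Lemma nth_correct l i w : R 2 0 i (enc_list l) w <-> i < size l /\ w = nth 0 l i.
Proof.
have [_ [_ H]] := HR; elim: l i => [|x l IH] i; rewrite H /nth_step.
  by split=> [[x [v' []]]|[]].
split=> [[x' [v' [[/pr_inj [<- <-]] [[-> ->]|[i' [-> Hi']]]]]]|] //.
  exact: (proj1 (IH i') Hi').
by case: i => [|i] /= [Hi Hw]; exists x, (enc_list l); split=> //;
  [left|right; exists i; split=> //; apply/IH].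
Qed.

Lemma list_correct n v cs ws u : size ws = size cs ->
  (forall i, i < size cs -> forall w, R 0 n (nth 0 cs i) v w <-> w = nth 0 ws i) ->
  R 1 n (pr (size cs) (enc_list cs)) v u <-> u = enc_list ws.
Proof.
have [_ [H _]] := HR; elim: cs ws u => [|c cs IH] [|w ws] u //= Hs Hc; rewrite H /list_step.
  split=> [[[_ ->] //|[k [c [l [w [u' [/pr_inj [] //]]]]]]]|->].
  by left.
have {}IH := IH ws _ (succn_inj Hs) (fun i Hi => Hc i.+1 Hi).
split=> [[[/pr_inj [] //]|[k [c' [l [w' [u' [/pr_inj [[<-] [/pr_inj [<- <-]]] [-> [H1 H2]]]]]]]]]|->].
  by rewrite ((Hc 0 (ltn0Sn _) _).1 H1) ((IH _).1 H2).
right; exists (size cs), c, (enc_list cs), w, (enc_list ws); split=> //; split=> //.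
by split; [exact/(Hc 0 (ltn0Sn _))|exact/IH].
Qed.

Lemma eval_correct n (f : prf n) l w : size l = n ->
  R 0 n (enc_prf f) (enc_list l) w <-> w = peval f (nth 0 l).
Proof.
have [H _] := HR.
elim: f l w => [||n' i|k n' g IHg hs IHh|n' g IHg h IHh] l w Hl; rewrite H /eval_step.
- split=> [|->]; last by left.
  by case=> [[_ [_ ->]]|[[]|[[i [d [/pr_inj []]]]|[[? [? [? [? [/pr_inj []]]]]]|[? [? [? []]]]]]]].
- case: l Hl => [|x [|y l]] // _.
  split=> [|->]; last by right; left; do 2!split => //; exists x, 0.
  case=> [[/pr_inj []]|[[_ [_ [x' [v' [[/pr_inj [-> _]]]]]]]|[[i [d [/pr_inj []]]]|
    [[? [? [? [? [/pr_inj []]]]]]|[? [? [? [_ [/pr_inj []]]]]]]]]] //.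
- split=> [|->]; last first.
    right; right; left; exists i, (n' - i.+1); split=> //; split; first by have := ltn_ord i; lia.
    by apply/nth_correct; rewrite Hl.
  case=> [[/pr_inj []]|[[/pr_inj []]|[[i' [d [/pr_inj [_ /pr_inj [_ <-]] [_ /nth_correct [] //]]]]|
    [[? [? [? [? [/pr_inj []]]]]]|[? [? [? [_ [/pr_inj []]]]]]]]]] //.
- pose ws := [seq peval (hs i) (nth 0 l) | i <- enum 'I_k].
  have Hws : size ws = k by rewrite size_map size_enum_ord.
  have Hlist u : R 1 n' (pr k (enc_list [seq enc_prf (hs i) | i <- enum 'I_k])) (enc_list l) u <->
      u = enc_list ws.
    have E : k = size [seq enc_prf (hs i) | i <- enum 'I_k] by rewrite size_map size_enum_ord.
    rewrite {1}E; apply: list_correct; rewrite -E // => i Hi w'.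
    have d : 'I_k := Ordinal Hi.
    by rewrite /ws (nth_map d) ?size_enum_ord // (nth_map d) ?size_enum_ord //; apply: IHh.
  have Hg w' : R 0 k (enc_prf g) (enc_list ws) w' <-> w' = peval (PC g hs) (nth 0 l).
    rewrite IHg //=.
    suff -> : peval g (nth 0 ws) =
      peval g (fun j => if insub j is Some o then peval (hs o) (nth 0 l) else 0) by [].
    apply: peval_ext => j Hj; rewrite insubT (nth_map (Ordinal Hj)) ?size_enum_ord //.
    by congr (peval (hs _) _); apply: val_inj; rewrite /= nth_enum_ord.
  split=> [|E]; last first.
    right; right; right; left.
    exists k, (enc_prf g), (enc_list [seq enc_prf (hs i) | i <- enum 'I_k]), (enc_list ws).
    by split=> //; split; [exact/Hlist|exact/Hg].
  case=> [[/pr_inj []]|[[/pr_inj []]|[[? [? [/pr_inj []]]]|[|[? [? [? [_ [/pr_inj []]]]]]]]]] //.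
  move=> [k' [g' [l' [u [/pr_inj [_ /pr_inj [E1 /pr_inj [_ /pr_inj [E2 E3]]]]]]]]].
  by rewrite -E1 -E2 -E3 => -[/Hlist -> /Hg].
- have vg : exists v' w', R 0 n' (enc_prf g) v' w'.
    by exists (enc_list (nseq n' 0)); eexists; apply/IHg => //; rewrite size_nseq.
  have vh : exists v' w', R 0 n'.+2 (enc_prf h) v' w'.
    by exists (enc_list (nseq n'.+2 0)); eexists; apply/IHh => //; rewrite size_nseq.
  case: l Hl => [|x l] //= [Hl]; rewrite -/(enc_list l).
  have main y w' : R 0 n'.+1 (enc_prf (PR g h)) (enc_list (y :: l)) w' <->
      w' = peval (PR g h) (nth 0 (y :: l)).
    elim: y w' => [|y IH] w'; rewrite H.
      split=> [|E]; last first.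
        do 4!right; exists n', (enc_prf g), (enc_prf h); do !split => //.
        by exists 0, (enc_list l); split=> //; left; split=> //; apply/IHg.
      case=> [[/pr_inj []]|[[/pr_inj []]|[[? [? [/pr_inj []]]]|[[? [? [? [? [/pr_inj []]]]]]|]]]] //.
      move=> [m [g' [h' [_ [/pr_inj [_ /pr_inj [E1 /pr_inj [E2 E3]]] [_ [_ [x' [v' [[/pr_inj [<- <-]] H2]]]]]]]]]].
      by case: H2 => [[_]|[? [? [//]]]]; rewrite -E1 -E2 => /IHg ->.
    split=> [|E]; last first.
      do 4!right; exists n', (enc_prf g), (enc_prf h); do !split => //.
      exists y.+1, (enc_list l); split=> //; right; exists y, (peval (PR g h) (nth 0 (y :: l))).
      split=> //; split; first exact/IH.
      apply/(IHh [:: y, peval (PR g h) (nth 0 (y :: l)) & l]); first by rewrite /= Hl.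
      by rewrite E peval_PRS.
    case=> [[/pr_inj []]|[[/pr_inj []]|[[? [? [/pr_inj []]]]|[[? [? [? [? [/pr_inj []]]]]]|]]]] //.
    move=> [m [g' [h' [_ [/pr_inj [_ /pr_inj [E1 /pr_inj [E2 E3]]] [_ [_ [x' [v' [[/pr_inj [<- <-]] H2]]]]]]]]]].
    case: H2 => [[//]|[x'' [z [[<-] [/IH -> ]]]]]; rewrite -E1 -E3.
    move/(IHh [:: y, peval (PR g h) (nth 0 (y :: l)) & l]) => ->; first by rewrite peval_PRS.
    by rewrite /= Hl.
  exact: (iff_trans (iff_sym (H _ _ _ _)) (main x w)).
Qed.

Lemma list_valid n v B :
  (forall c, c < B -> forall w, R 0 n c v w -> exists f : prf n, c = enc_prf f) ->
  forall k l u, l <= B -> R 1 n (pr k l) v u ->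
  exists fs : seq (prf n), size fs = k /\ l = enc_list [seq enc_prf f | f <- fs].
Proof.
have [_ [H _]] := HR; move=> HB; elim=> [|k IH] l u Hl; rewrite H.
  by case=> [[/pr_inj [_ ->] _]|[? [? [? [? [? [/pr_inj []]]]]]]] //; exists [::].
case=> [[/pr_inj []] //|[k' [c [l' [w [u' [/pr_inj [[<-] E] [_ [H1 H2]]]]]]]]].
have ltc := pr_gtl c l'; have ltl := pr_gtr c l'.
have [|f Ef] := HB c _ w H1; first by lia.
have [|fs [Hs El]] := IH l' u' _ H2; first by lia.
by exists (f :: fs); rewrite /= Hs E Ef El.
Qed.

(** Strong induction on the code: each clause yields values for the component codes, which are
    smaller. Thus no solution assigns values to numbers that code no function. *)
Lemma eval_valid c : forall n v w, R 0 n c v w -> exists f : prf n, c = enc_prf f.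
Proof.
have [H _] := HR.
elim/ltn_ind: c => c IH n v w; rewrite H.
case=> [[-> [-> _]]|[[-> [-> _]]|[|[|]]]].
- by exists PZ.
- by exists PS.
- move=> [i [d [-> [-> _]]]]; have Hi : i < (i + d).+1 by lia.
  by exists (PP (Ordinal Hi)).
- move=> [k [g [l [u [E [H1 H2]]]]]].
  have g1 := pr_gtr 3 (pr k (pr n (pr g l))); have g2 := pr_gtr k (pr n (pr g l)).
  have g3 := pr_gtr n (pr g l); have g4 := pr_gtl g l; have g5 := pr_gtr g l.
  have [|g' Eg] := IH g _ _ _ _ H2; first by lia.
  have [c' Hc' w'|fs [Hs El]] := @list_valid n v l _ k l u (leqnn _) H1.
    by apply: IH; lia.
  exists (PC g' (fun i => tnth (@Tuple _ _ fs (introT eqP Hs)) i)).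
  rewrite E Eg El /=; congr (pr 3 (pr k (pr n (pr _ (enc_list _))))).
  by rewrite (map_comp (@enc_prf n) (tnth (@Tuple _ _ fs (introT eqP Hs)))) map_tnth_enum.
- move=> [m [g [h [-> [E [[v1 [w1 H1]] [[v2 [w2 H2]] _]]]]]]].
  have g1 := pr_gtr 4 (pr m (pr g h)); have g2 := pr_gtr m (pr g h).
  have g4 := pr_gtl g h; have g5 := pr_gtr g h.
  have [|g' Eg] := IH g _ _ _ _ H1; first by lia.
  have [|h' Eh] := IH h _ _ _ _ H2; first by lia.
  by exists (PR g' h'); rewrite E Eg Eh.
Qed.

End EvaluatorTheory.

Section GodelEmb.

Definition gnot x := pr 3 (pr x (pr 0 0)).
Definition gand x y := gnot (pr 3 (pr x (gnot y))).
Definition gprec a s t := gnot (pr 1 (pr (pr 1 (pr 2 (pr a (lc s (lc t 0))))) (enc_term tzero))).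

(** The Goedel number of an embedding sentence as a term in the codes of the two functions, so that
    being such a number becomes arithmetically definable. *)
Definition gemb a b :=
  gnot (pr 5 (gnot (gand (godel (FAll (FEx (FMem (TT pPr [:: TVar 1; TVar 0]) 0))))
    (pr 4 (pr 4 (pr 4 (pr 4 (pr 3 (pr (godel (FMem (TT pPr [:: TVar 3; TVar 2]) 0))
       (pr 3 (pr (godel (FMem (TT pPr [:: TVar 1; TVar 0]) 0))
         (pr 3 (pr (gprec a (enc_term (TVar 3)) (enc_term (TVar 1)))
                   (gprec b (enc_term (TVar 2)) (enc_term (TVar 0)))))))))))))))).

Local Opaque pr.

Lemma godel_not p : godel (FNot p) = gnot (godel p).
Proof. by []. Qed.

Lemma godel_and p q : godel (FAnd p q) = gand (godel p) (godel q).
Proof. by []. Qed.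

Lemma godel_prec f s t : godel (tprec f s t) = gprec (enc_prf f) (enc_term s) (enc_term t).
Proof.
rewrite /tprec godel_not /gprec.
suff -> : godel (FEq (TApp f (targs [:: s; t])) tzero) =
  pr 1 (pr (pr 1 (pr 2 (pr (enc_prf f) (lc (enc_term s) (lc (enc_term t) 0))))) (enc_term tzero)) by [].
have E : [seq enc_term (targs (n := 2) [:: s; t] i) | i <- enum 'I_2] = [:: enc_term s; enc_term t].
  by rewrite !enum_ordSl enum_ord0.
by rewrite [LHS]/= E.
Qed.

Lemma godel_emb f g : godel (emb f g) = gemb (enc_prf f) (enc_prf g).
Proof.
rewrite /emb /FEx2 godel_not /gemb; congr gnot.
have imp p q : godel (FImp p q) = pr 3 (pr (godel p) (godel q)) by [].
have all p : godel (FAll p) = pr 4 (godel p) by [].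
have all2 p : godel (FAll2 p) = pr 5 (godel p) by [].
rewrite all2 godel_not /emb_formula godel_and.
congr (pr 5 (gnot (gand _ _))).
by rewrite 4!all 3!imp !godel_prec.
Qed.

End GodelEmb.

(* Facts of kind 3 in Y are the pairs of the embedding. *)
Definition fact (Y : nat -> Prop) k n c v w : Prop := @mm std (pr k (pr n (pr c (pr v w)))) Y.

(** Having some value certifies that [a] and [b] code binary functions. The order relation holds
    when the value is not 0, hence the negated facts. Evaluator and embedding share one set, so one
    existential set quantifier is enough. *)
Definition true_emb_code (n : nat) (Y : nat -> Prop) : Prop :=
  evaluator (fact Y) /\ exists a b, n = gemb a b /\
    (exists v w, fact Y 0 2 a v w) /\ (exists v w, fact Y 0 2 b v w) /\
    (forall x, exists y, fact Y 3 0 0 x y) /\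
    (forall x y x' y', fact Y 3 0 0 x y -> fact Y 3 0 0 x' y' ->
       ~ fact Y 0 2 a (lc x (lc x' 0)) 0 -> ~ fact Y 0 2 b (lc y (lc y' 0)) 0).

Lemma true_emb_codeP n : (exists f g, true_in_N (emb f g) /\ godel (emb f g) = n) <->
  exists Y, true_emb_code n Y.
Proof.
have embP f g : true_in_N (emb f g) <-> exists X : nat -> Prop,
    (forall a, exists b, X (pr a b)) /\ forall a b a' b', X (pr a b) -> X (pr a' b') ->
      prec f a a' -> prec g b b'.
  rewrite /true_in_N sat_std (@msat_emb stdA); split=> -[X [H1 H2]]; exists X; split.
  - by move=> a; have [b] := H1 a; rewrite pPr_std => Hb; exists b.
  - move=> a b a' b'; have := H2 a b a' b'; rewrite !pPr_std => H X1 X2 /tru_std Hf.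
    by apply/tru_std; exact: H.
  - by move=> a; have [b Hb] := H1 a; exists b; rewrite pPr_std.
  - move=> a b a' b'; rewrite !pPr_std => X1 X2 /tru_std Hf.
    by apply/tru_std; exact: H2 X1 X2 Hf.
have precP R f x y : evaluator R -> prec f x y <-> ~ R 0 2 (enc_prf f) (lc x (lc y 0)) 0.
  move=> HR; have /= -> := @eval_correct R HR 2 f [:: x; y] 0 erefl.
  suff -> : prec f x y = (peval f (nth 0 [:: x; y]) <> 0) by split=> H /esym.
  by rewrite /prec; congr (_ <> _); apply: peval_ext => -[|[|j]].
split=> [[f [g [/embP [X [H1 H2]] <-]]]|[Y [HY [a [b [-> [[v1 [w1 Ha]] [[v2 [w2 Hb]] [H1 H2]]]]]]]]].
  have [R HR] := evaluator_ex.
  pose Q k n c v w := if k == 3 then n = 0 /\ c = 0 /\ X (pr v w) else R k n c v w.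
  pose Y z := exists k n c v w, z = pr k (pr n (pr c (pr v w))) /\ Q k n c v w.
  have EQ : fact Y = Q.
    do 5!(apply: functional_extensionality => ?); apply: propositional_extensionality.
    split=> [[k [n' [c [v [w [+ H]]]]]]|H]; last by do 5!eexists; split; [reflexivity|exact: H].
    by move=> /pr_inj [-> /pr_inj [-> /pr_inj [-> /pr_inj [-> ->]]]].
  (* The evaluation clauses mention the kinds 0, 1 and 2 only, so they hold for [Q] by
     conversion. *)
  have HQ : evaluator Q by exact: HR.
  exists Y; rewrite /true_emb_code EQ; split=> //.
  exists (enc_prf f), (enc_prf g); split; first exact: godel_emb.
  have ex (h : prf 2) : exists v w, Q 0 2 (enc_prf h) v w.
    exists (enc_list [:: 0; 0]), (peval h (nth 0 [:: 0; 0])).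
    exact: (proj2 (@eval_correct R HR 2 h [:: 0; 0] _ erefl) erefl).
  split; [exact: ex|split; [exact: ex|split]].
    by move=> x; have [y Hy] := H1 x; exists y.
  move=> x y x' y' [_ [_ X1]] [_ [_ X2]] /(precP _ _ _ _ HQ) Hf; apply/(precP _ _ _ _ HQ).
  exact: H2 X1 X2 Hf.
have [f Ef] := eval_valid HY Ha; have [g Eg] := eval_valid HY Hb; subst.
exists f, g; split; last exact: godel_emb.
apply/embP; exists (fun z => exists x y, z = pr x y /\ fact Y 3 0 0 x y); split.
  by move=> x; have [y Hy] := H1 x; exists y, x, y.
move=> x y x' y' [? [? [/pr_inj [<- <-] X1]]] [? [? [/pr_inj [<- <-] X2]]].
by move=> /(precP _ _ _ _ HY) Hf; apply/(precP _ _ _ _ HY); exact: H2 X1 X2 Hf.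
Qed.

Section StdDefinability.
Variables (A : Type) (pv : A -> nat -> nat).
Notation DTs := (@DT std A pv).

Lemma DT_pr t u : DTs t -> DTs u -> DTs (fun a => pr (t a) (u a)).
Proof.
move=> Ht Hu; have [tm Htm] := DT_ap2 pPr Ht Hu; exists tm => a.
by rewrite Htm; exact: pPr_std.
Qed.

Lemma DT_succ t : DTs t -> DTs (fun a => (t a).+1).
Proof.
move=> Ht; have [tm Htm] := DT_ap1 PS Ht; exists tm => a.
by rewrite Htm; exact: succ_std.
Qed.

Lemma DT_add t u : DTs t -> DTs u -> DTs (fun a => t a + u a).
Proof.
move=> Ht Hu; have [tm Htm] := DT_ap2 pAdd Ht Hu; exists tm => a.
by rewrite Htm; exact: add_std.
Qed.

Lemma DT_const n : DTs (fun _ => n).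
Proof.
elim: n => [|n IH]; last exact: DT_succ.
by exists tzero => a; rewrite mt_zero.
Qed.

End StdDefinability.

(** For the standard model, where terms are built from constants, [pr], addition and successor. *)
Ltac dterm ::= cbv beta; lazymatch goal with
  | |- DT _ (fun _ => ?c) => apply DT_const
  | |- DT _ (fun a => pr _ _) => apply DT_pr; [dterm|dterm]
  | |- DT _ (fun a => (_ + _)%N) => apply DT_add; [dterm|dterm]
  | |- DT _ (fun a => S _) => apply DT_succ; dterm
  | |- _ => dvar
  end.

Lemma DF_true_emb_code : @DF std (nat * (nat -> Prop)) (fun a _ => a.1) (fun a _ => a.2)
  (fun a => true_emb_code a.1 a.2).
Proof.
rewrite /true_emb_code /evaluator /eval_step /list_step /nth_step /fact /gemb /gprec /gand /gnot.
dform.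
Qed.

(** * Reduction of Pi^1_1 consequences *)

Lemma tnv_subst s t m : (forall i, tnv (s i) <= m) -> tnv (tsubst s t) <= m.
Proof. by move=> H; elim: t => [i|n f a IH]; [exact: H|apply/tnv_appP]. Qed.

Lemma tnv_subst_lt s t m : (forall i, i < tnv t -> tnv (s i) <= m) -> tnv (tsubst s t) <= m.
Proof.
elim: t => [i|n f a IH] H; first by apply: H => /=.
apply/tnv_appP => i; apply: IH => j Hj; apply: H; exact: leq_trans Hj (tnv_app f a i).
Qed.

Lemma nv_subst p : forall s m, (forall i, tnv (s i) <= m) -> nv (fsubst s p) <= m.
Proof.
elim: p => //= [t u|t k|p IHp q IHq|p IH] s m H.
- by rewrite geq_max !tnv_subst.
- exact: tnv_subst.
- by rewrite geq_max IHp // IHq.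
- suff : nv (fsubst (up s) p) <= m.+1 by lia.
  apply: IH => -[|i] //=; apply: tnv_subst_lt => j Hj /=; have := H i; lia.
Qed.

Lemma nv_ssubst p : forall r, nv (fssubst r p) = nv p.
Proof. by elim: p => //= [p IHp q IHq|p IH] s; rewrite ?IHp ?IHq ?IH. Qed.

Lemma arithmetical_ssubst p : forall r, arithmetical (fssubst r p) = arithmetical p.
Proof. by elim: p => //= p IHp q IHq r; rewrite IHp IHq. Qed.

Lemma sv_ssubst p : forall r m, (forall i, i < sv p -> r i < m) -> sv (fssubst r p) <= m.
Proof.
elim: p => //= [t k|p IHp q IHq|p IH] r m H.
- exact: H.
- by rewrite geq_max IHp ?IHq // => i Hi; apply: H; rewrite leq_max Hi ?orbT.
- suff : sv (fssubst (sup r) p) <= m.+1 by lia.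
  by apply: IH => -[|i] Hi //=; rewrite ltnS; apply: H; lia.
Qed.

Lemma sv_sshift p : sv (sshift p) <= (sv p).+1.
Proof. by apply: sv_ssubst. Qed.

Lemma iter_ex2_bounds k p : nv (iter k FEx2 p) = nv p /\ sv (iter k FEx2 p) = sv p - k.
Proof. by elim: k => [|k [IH1 IH2]] /=; [rewrite subn0|rewrite IH1 IH2; lia]. Qed.

Lemma iter_all2_bounds k p : nv (iter k FAll2 p) = nv p /\ sv (iter k FAll2 p) = sv p - k.
Proof. by elim: k => [|k [IH1 IH2]] /=; [rewrite subn0|rewrite IH1 IH2; lia]. Qed.

Lemma msat_iter_ex2 (M : model) k q rho eta : msat rho eta (iter k FEx2 q) <->
  exists eta', (forall i, eta' (i + k) = eta i) /\ @msat M rho eta' q.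
Proof.
elim: k eta => [|k IH] eta.
  split=> [H|[eta' [E H]]]; first by exists eta; split=> // i; rewrite addn0.
  suff -> : eta = eta' by [].
  by apply: functional_extensionality => i; rewrite -E addn0.
rewrite iterS msat_ex2; split=> [[X /IH [eta' [E H]]]|[eta' [E H]]].
  by exists eta'; split=> // i; rewrite addnS -addSn E.
by exists (eta' k); apply/IH; exists eta'; split=> // -[|i] //=; rewrite addSnnS E.
Qed.

Lemma msat_closed_all2 (M : model) k q : sentence (iter k FAll2 q) ->
  (forall rho eta, @msat M rho eta (iter k FAll2 q)) <-> (forall rho eta, @msat M rho eta q).
Proof.
move=> Hs; split=> H rho eta; last by apply/msat_iter_all2 => eta' _.
have /msat_iter_all2 := H rho (fun i => eta (i + k)); exact.
Qed.

Definition imps (l : seq formula) (p : formula) : formula := foldr FImp p l.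

Lemma msat_imps (M : model) rho eta l p : @msat M rho eta (imps l p) <->
  ((forall q, List.In q l -> msat rho eta q) -> msat rho eta p).
Proof.
elim: l => [|q l IH] /=; first by split=> // H; exact: H.
rewrite IH; split=> H H1; first by apply: H => [|r Hr]; apply: H1; auto.
by move=> H2; apply: H => r [<-|]; auto.
Qed.

Definition emb_truth : theory := fun p => exists f g, p = emb f g /\ true_in_N p.

Lemma sentence_emb f g : sentence (emb f g).
Proof.
have E2 (F : prf 2) s t : tnv (TApp F (targs [:: s; t])) = maxn (tnv s) (tnv t).
  by rewrite /= !enum_ordSl enum_ord0 /= /targs /= maxn0.
have E0 : tnv tzero = 0 by rewrite /= enum_ord0.
by split; rewrite /emb /emb_formula /FEx2 /FAnd /tprec /FEx /FNot /TT; cbn [nv sv]; rewrite ?E2 ?E0.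
Qed.

Lemma emb_sigma11 f g : sigma11 (emb f g).
Proof. by exists 1, (emb_formula f g). Qed.

Lemma true_any p rho (eta : nat -> sets std) : sentence p -> true_in_N p <-> msat rho eta p.
Proof. by move=> Hp; rewrite /true_in_N sat_std; exact: msat_sentence. Qed.

Section Theories.
Variable T : theory.
Hypothesis HT : is_theory T.

Lemma Prv_iff p : Prv T p <-> forall M, models M T -> forall rho eta, @msat M rho eta p.
Proof. by split=> [H M HM rho eta|]; [exact: soundness H HM rho eta|exact: completeness]. Qed.

(** Members of [V] are sentences, so their truth is independent of the assignment, and the
    generalisation rules go through under finitely many of them. *)
Lemma Prv_union_finite V p : (forall q, V q -> sentence q) -> Prv (tunion T V) p ->
  exists l, (forall q, List.In q l -> V q) /\ Prv T (imps l p).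
Proof.
move=> HV H; elim: H => {p};
  try by move=> *; exists [::]; split=> //; constructor.
- move=> p [Tp|Vp]; first by exists [::]; split=> //; exact: PrvAx.
  exists [:: p]; split=> [q [<-|]|] //; apply/Prv_iff => M HM rho eta; apply/msat_imps; apply; by left.
- move=> p q _ [l1 [V1 /Prv_iff H1]] _ [l2 [V2 /Prv_iff H2]].
  exists (l1 ++ l2); split=> [r /List.in_app_iff []|]; auto.
  apply/Prv_iff => M HM rho eta; apply/msat_imps => Hl.
  have /msat_imps H3 := H1 M HM rho eta; have /msat_imps H4 := H2 M HM rho eta.
  apply: H3 => [r Hr|]; first by apply: Hl; apply/List.in_app_iff; left.
  by apply: H4 => r Hr; apply: Hl; apply/List.in_app_iff; right.
- move=> p _ [l [Vl /Prv_iff H]]; exists l; split=> //.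
  apply/Prv_iff => M HM rho eta; apply/msat_imps => Hl x.
  have /msat_imps := H M HM (mcons x rho) eta; apply=> q Hq.
  exact: (proj1 (@msat_sentence M q rho (mcons x rho) eta eta (HV _ (Vl _ Hq))) (Hl q Hq)).
- move=> p _ [l [Vl /Prv_iff H]]; exists l; split=> //.
  apply/Prv_iff => M HM rho eta; apply/msat_imps => Hl X.
  have /msat_imps := H M HM rho (mcons X eta); apply=> q Hq.
  exact: (proj1 (@msat_sentence M q rho rho eta (mcons X eta) (HV _ (Vl _ Hq))) (Hl q Hq)).
Qed.

End Theories.

Lemma sentence_ex2 p : sentence (FEx2 p) -> nv p = 0 /\ sv p <= 1.
Proof. by rewrite /sentence /=; lia. Qed.

(** Each embedding hypothesis contributes one innermost set quantifier:
    [(exists X, A) -> forall Y, r] becomes [forall Y X, (A -> r)]. *)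
Lemma prenex_imps l p : (forall q, List.In q l -> emb_truth q) -> sentence p -> pi11 p ->
  exists m r, [/\ arithmetical r, sentence (iter m FAll2 r) &
    forall M rho eta, @msat M rho eta (iter m FAll2 r) <-> msat rho eta (imps l p)].
Proof.
move=> + Hs [k [q [Hq Ep]]]; elim: l => [|e l IH] Hl.
  by exists k, q; split; rewrite -?Ep.
have [|m [r [Hr Sr Er]]] := IH; first by move=> q' Hq'; apply: Hl; right.
have [f [g [Ee _]]] := Hl e (or_introl erefl).
pose A := emb_formula f g.
have [nA sA] : nv A = 0 /\ sv A <= 1.
  exact: sentence_ex2 (sentence_emb f g).
have arA : arithmetical A by [].
(* Only the variable bounds and arithmeticity of the matrix matter from here on, so its body is
   forgotten. *)
move: A nA sA arA (erefl : emb f g = FEx2 A) => A nA sA arA EA.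
have [nr sr] : nv r = 0 /\ sv r <= m.
  by move: Sr; rewrite /sentence; case: (iter_all2_bounds m r) => -> ->; lia.
exists m.+1, (FImp A (sshift r)); split.
- by rewrite /= arA arithmetical_ssubst Hr.
- rewrite /sentence; case: (iter_all2_bounds m.+1 (FImp A (sshift r))) => -> ->.
  rewrite /= /sshift nv_ssubst; have := sv_sshift r; rewrite /sshift; lia.
move=> M rho eta.
rewrite [imps _ _]/= [X in _ <-> X]/= -/msat -Er Ee EA.
have -> : msat rho eta (FEx2 A) <-> exists X, msat rho (mcons X eta) A by exact: msat_ex2.
rewrite msat_iter_all2; split=> H.
  move=> [X HX]; apply/msat_iter_all2 => eta' E.
  have H1 : msat rho (mcons X eta') (FImp A (sshift r)).
    by apply: H => i; rewrite addnS /= E.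
  apply/(msat_sshift X); apply: H1.
  by apply: (proj1 (@msat_ext M A rho rho (mcons X eta) (mcons X eta') _ _)) HX => // -[|i] //; lia.
move=> eta' E HA; rewrite -(mcons_eta eta'); apply/msat_sshift.
have /msat_iter_all2 : msat rho eta (iter m FAll2 r).
  apply: H; exists (eta' 0).
  by apply: (proj1 (@msat_ext M A rho rho eta' (mcons (eta' 0) eta) _ _)) HA => // -[|i] //; lia.
by apply=> i; rewrite -E addnS.
Qed.

(** * Adjoining the true embedding sentences to a theory *)

Definition with_emb (T : theory) : theory := tunion T emb_truth.

Lemma emb_truth_sentence p : emb_truth p -> sentence p.
Proof. by move=> [f [g [-> _]]]; exact: sentence_emb. Qed.

Lemma emb_truth_def : exists q, [/\ arithmetical q, nv q <= 1, sv q <= 1 &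
  forall n, (exists p, emb_truth p /\ godel p = n) <->
    exists Y : nat -> Prop, forall eta, @msat std (fun _ => n) (mcons Y eta) q].
Proof.
have [q [Hq Eq]] := DF_true_emb_code.
(* Every number index of [q] is read as [n] and every set index as [Y], so all free indices may be
   collapsed to 0. *)
exists (fssubst (fun _ => 0) (fsubst (fun _ => TVar 0) q)); split.
- by rewrite arithmetical_ssubst arithmetical_subst.
- by rewrite nv_ssubst; exact: nv_subst.
- exact: sv_ssubst.
move=> n; transitivity (exists f g, true_in_N (emb f g) /\ godel (emb f g) = n).
  split=> [[p [[f [g [-> H]]] <-]]|[f [g [H E]]]]; first by exists f, g.
  by exists (emb f g); split=> //; exists f, g.
rewrite true_emb_codeP; split=> -[Y H]; exists Y.
  by move=> eta; rewrite msat_ssubst msat_subst; exact: (proj2 (Eq (n, Y))).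
by have := H (fun _ _ => False); rewrite msat_ssubst msat_subst => /(proj1 (Eq (n, Y))).
Qed.

Lemma with_emb_definable T : sigma11_definable T -> sigma11_definable (with_emb T).
Proof.
move=> [p [[k [q [Hq ->]]] [Hn [Hs HT]]]].
have [q' [Hq' Hn' Hs' Hdef]] := emb_truth_def.
have [n1 s1] := iter_ex2_bounds k q; rewrite n1 in Hn; rewrite s1 in Hs.
(* A new innermost set quantifier takes index 0 for [q']; the [k] quantifiers of the definition of
   [T] move up by one. *)
pose Q := FOr (sshift q) q'.
exists (iter k.+1 FEx2 Q); split; [|split; [|split]].
- by exists k.+1, Q; rewrite /= arithmetical_ssubst Hq Hq'.
- have [-> _] := iter_ex2_bounds k.+1 Q.
  by rewrite /Q /FOr /FNot /= /sshift nv_ssubst; lia.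
- have [_ ->] := iter_ex2_bounds k.+1 Q.
  have := sv_sshift q; rewrite /Q /FOr /FNot /=; lia.
move=> n; rewrite sat_std msat_iter_ex2.
have HTn := HT n; rewrite sat_std msat_iter_ex2 in HTn.
split.
- move=> [p' [[Tp|Vp] Ep]].
    have /HTn [eta' [E H]] : exists p, T p /\ godel p = n by exists p'.
    exists (mcons (fun _ => False) eta'); split=> [i|]; first by rewrite addnS /= E.
    by apply/msat_or; left; apply/msat_sshift.
  have /Hdef [Y H] : exists p, emb_truth p /\ godel p = n by exists p'.
  exists (mcons Y (fun _ _ => False)); split=> [i|]; first by rewrite addnS.
  by apply/msat_or; right.
- move=> [eta' [E /msat_or [H|H]]].
    have /HTn [p' [Tp Ep]] : exists eta' : nat -> sets std,
        (forall i, eta' (i + k) = (fun _ : nat => False)) /\ @msat std (fun _ => n) eta' q.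
      exists (fun i => eta' i.+1); split=> [i|]; first by rewrite -addnS E.
      by apply/(msat_sshift (eta' 0)); rewrite mcons_eta.
    by exists p'; split=> //; left.
  have /Hdef [p' [Vp Ep]] : exists Y : nat -> Prop, forall eta, @msat std (fun _ => n) (mcons Y eta) q'.
    exists (eta' 0) => eta.
    by apply: (proj1 (@msat_ext std q' _ _ eta' (mcons (eta' 0) eta) _ _)) H => // -[|i] //; lia.
  by exists p'; split=> //; right.
Qed.

Lemma is_theory_with_emb T : is_theory T -> is_theory (with_emb T).
Proof. by move=> HT p [/HT|/emb_truth_sentence]. Qed.

Lemma models_ACA0 (M : model) T : extends_ACA0 T -> models M T -> models M ACA0.
Proof. by move=> HT HM p /HT H rho eta; exact: soundness H HM rho eta. Qed.

Lemma models_with_emb (M : model) T : models M (with_emb T) -> models M T.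
Proof. by move=> HM p Tp; apply: HM; left. Qed.

Lemma with_emb_reduction T p : is_theory T -> sentence p -> pi11 p -> Prv (with_emb T) p ->
  exists l m r, (forall q, List.In q l -> emb_truth q) /\
    [/\ arithmetical r, sentence (iter m FAll2 r), Prv T (iter m FAll2 r) &
    forall M rho eta, @msat M rho eta (iter m FAll2 r) <-> msat rho eta (imps l p)].
Proof.
move=> HT Hs Hp /(Prv_union_finite HT emb_truth_sentence) [l [Hl H]].
have [m [r [Hr Sr Er]]] := prenex_imps Hl Hs Hp.
exists l, m, r; split=> //; split=> //.
apply/(Prv_iff HT) => M HM rho eta; apply/Er; exact: soundness H HM rho eta.
Qed.

Lemma with_emb_sound T : is_theory T -> pi11_sound T -> pi11_sound (with_emb T).
Proof.
move=> HT HS p Hs Hp /(with_emb_reduction HT Hs Hp) [l [m [r [Hl [Hr Sr HP Er]]]]].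
have Ht : true_in_N (iter m FAll2 r) by apply: HS => //; exists m, r.
apply/sat_std; move/sat_std/Er/msat_imps: Ht; apply=> q /Hl [f [g [_]]].
by move/sat_std.
Qed.

Lemma with_emb_admissible T : admissible T -> admissible (with_emb T).
Proof.
move=> [HT [Hd [Hs He]]]; split; first exact: is_theory_with_emb.
split; first exact: with_emb_definable.
split; first exact: with_emb_sound.
move=> p /He H; apply/(Prv_iff (is_theory_with_emb HT)) => M HM rho eta.
exact: soundness H (models_with_emb HM) rho eta.
Qed.

Lemma with_emb_le T U p : admissible T -> admissible U -> wf_ord_le T U ->
  sentence p -> pi11 p -> Prv (with_emb T) p -> Prv (with_emb U) p.
Proof.
move=> [HT [_ [HTs HTe]]] [HU [_ [_ HUe]]] Hle Hs Hp.
move=> /(with_emb_reduction HT Hs Hp) [l [m [r [Hl [Hr Sr HP Er]]]]].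
have nr : nv r = 0 by case: Sr; case: (iter_all2_bounds m r) => ->.
have Ht : true_in_N (iter m FAll2 r) by apply: HTs => //; exists m, r.
have Hstd : forall rho (eta : nat -> sets stdA), msat rho eta r.
  apply/(msat_closed_all2 stdA Sr) => rho eta; exact/(true_any rho eta Sr).
have HPWF : Prv T (WF (treeord r)).
  apply/(Prv_iff HT) => M HM rho eta.
  pose MA := AcaModel (eta 0) (models_ACA0 HTe HM).
  apply: (@WF_of_true MA r Hr); apply/(msat_closed_all2 MA Sr) => rho' eta'.
  exact: soundness HP HM rho' eta'.
(* The comparison is applied at the root 0, whose segment is the whole order apart from the root. *)
have [g [_ [HgU Hemb]]] := Hle _ (treeord_wo Hr Hstd) HPWF 0 (treeord_field r).
have Et : emb_truth (emb (treeord r) g).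
  by exists (treeord r), g; split=> //; exact: emb_treeord.
apply/(Prv_iff (is_theory_with_emb HU)) => M HM rho eta.
have HMU := models_with_emb HM.
pose MA := AcaModel (eta 0) (models_ACA0 HUe HMU).
have Hall : forall rho (eta : nat -> sets M), msat rho eta r.
  apply: (@true_of_WF MA r rho eta Hr nr); apply: (@emb_WF MA _ g).
    by apply: HM; right.
  exact: soundness HgU HMU rho eta.
have /Er/msat_imps := proj2 (msat_closed_all2 M Sr) Hall rho eta.
by apply=> q /Hl Vq; apply: HM; right.
Qed.

Theorem mainTheorem1 (E : theory -> theory -> Prop) (HE : Equivalence E) (Hgood : good E)
  (T U : theory)
  (HT : is_theory T) (HU : is_theory U)
  (HTdef : sigma11_definable T) (HUdef : sigma11_definable U)
  (HTsound : pi11_sound T) (HUsound : pi11_sound U)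
  (HTaca : extends_ACA0 T) (HUaca : extends_ACA0 U)
  (Hwf : wf_ord_eq T U) :
  E T U.
Proof.
have AT : admissible T by [].
have AU : admissible U by [].
have Htrue p : emb_truth p -> sentence p /\ sigma11 p /\ true_in_N p.
  by move=> [f [g [-> H]]]; split; [exact: sentence_emb|split; [exact: emb_sigma11|]].
case: Hgood => Hequiv Hadd; case: Hwf => HTU HUT.
transitivity (with_emb T); first exact: (Hadd _ _ AT AT _ Htrue).
transitivity (with_emb U); last by symmetry; exact: (Hadd _ _ AU AU _ Htrue).
apply: Hequiv; [exact: with_emb_admissible|exact: with_emb_admissible|].
by move=> p Hs Hp; split; exact: with_emb_le.
Qed.
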